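(* Let $f\in\mathcal{SR}(\Omega_D,A)$, let $y\in\Omega_D$, let $J\in\mathbb S_A$ be such that $y\in\mathbb C_J$ and let $r>0$ be such that $\mathrm{clos}(\mathrm U_A(y,r))\subset\Omega_D$. Write $y=\xi+J\eta$ with $\xi,\eta\in\mathbb R$ and put $w:=\xi+i\eta\in D$. Define $\mathrm U_J(y,r):=\mathrm U_A(y,r)\cap\mathbb C_J$ and $S_f:=\sup_{\partial\mathrm U_J(y,r)}\|f\|_A$. Then the following assertions hold. (i) There exists a unique sequence $\{s_n\}_{n\in\mathbb N}$ in $A$ such that $$f(x)=\sum_{n\in\mathbb N}\mathscr S_{y,n}(x)s_n\quad\text{for each }x\in\mathrm U_A(y,r).$$ (ii) For each $n\in\mathbb N$, $$s_n=(2\pi J)^{-1}\int_{\partial\mathrm U_J(y,r)}(\mathscr S_{y,n+1}(\zeta))^{-1}\,d\zeta\,f(\zeta).$$ Furthermore, there exists a positive real constant $C$, depending only on $\mathfrak a$ and on $\|\cdot\|_A$, such that $$\|s_n\|_A\le\frac{C\,S_f}{r^n}\quad\text{for each }n\in\mathbb N.$$ (iii) For every $n\in\mathbb N$, $$f(x)-\sum_{k=0}^n\mathscr S_{y,k}(x)s_k=(2\pi)^{-1}\big(\mathscr S_{y,n+1}\cdot\mathfrak R_{y,n}(f)\big)(x)$$ for each $x\in\mathrm U_A(y,r)$, where the product on the right is the slice product and $\mathfrak R_{y,n}(f):\mathrm U_A(y,r)\to A$ is the slice regular function induced by the holomorphic stem function $$\mathrm U(w,r)\ni z\longmapsto\int_{\partial\mathrm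 U_J(y,r)}\Delta_\zeta(z)^{-1}(\zeta^c-z)J^{-1}(\mathscr S_{y,n+1}(\zeta))^{-1}\,d\zeta\,f(\zeta).$$ Furthermore, if $A$ is associative, then $$\mathfrak R_{y,n}(f)(x)=\int_{\partial\mathrm U_J(y,r)}\Delta_\zeta(x)^{-1}(\zeta^c-x)J^{-1}(\mathscr S_{y,n+1}(\zeta))^{-1}\,d\zeta\,f(\zeta)$$ for each $x\in\mathrm U_A(y,r)$. (iii') There exists a positive real constant $C'$, depending only on $\mathfrak a$ and on $\|\cdot\|_A$, such that $$\left\|f(x)-\sum_{k=0}^n\mathscr S_{y,k}(x)s_k\right\|_A\le C'\,S_f\,\frac{\mathrm u_A(x,y)^n}{r^n}\,\frac{(3r+2|\mathrm{Im}(w)|)(r+2|\mathrm{Im}(w)|)^2}{r\,(r-\mathrm u_A(x,y))^2}$$ for each $n\in\mathbb N$ and for each $x\in\mathrm U_A(y,r)$.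
   Context: Algebra. $A$ is a finite-dimensional real alternative algebra with unity $1$ (so $\mathbb R\subset A$), equipped with a real linear anti-involution $\mathfrak a:x\mapsto x^c$ (so $(x^c)^c=x$, $(xy)^c=y^cx^c$). Put $t(x):=x+x^c$, $n(x):=xx^c$. The quadratic cone is $\mathcal Q_A:=\mathbb R\cup\{x\in A: t(x)\in\mathbb R,\ n(x)\in\mathbb R,\ 4n(x)>t(x)^2\}$; $\mathbb S_A:=\{J\in\mathcal Q_A: J^2=-1\}$ is assumed non-empty; for $J\in\mathbb S_A$, $\mathbb C_J:=\mathbb R+\mathbb RJ\simeq\mathbb C$. One has $\mathcal Q_A=\bigcup_{J}\mathbb C_J$ and $\mathbb C_I\cap\mathbb C_J=\mathbb R$ if $I\ne\pm J$. $A$ is equipped with a norm $\|\cdot\|_A$ such that $\|x\|_A=\sqrt{n(x)}$ for all $x\in\mathcal Q_A$; $\mathrm{clos}$ denotes closure in $\mathcal Q_A$ (euclidean topology). Slice functions. $D\subset\mathbb C$ is non-empty, open, conjugation invariant, and $\Omega_D:=\{\alpha+\beta J: \alpha,\beta\in\mathbb R,\ \alpha+i\beta\in D,\ J\in\mathbb S_A\}$ is assumed connected. A stem function is a map $F=F_1+iF_2:D\to A\otimes_{\mathbb R}\mathbb C$ ($F_1,F_2$ $A$-valued) with $F_1(\bar z)=F_1(z)$, $F_2(\bar z)=-F_2(z)$; it induces the slice function $\mathcal I(F):\Omega_D\to A$, $\mathcal I(F)(\alpha+\beta J):=F_1(z)+JF_2(z)$, $z=\alpha+i\beta$ (same definitions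 for any other conjugation invariant open set). $f=\mathcal I(F)$ is slice regular, $f\in\mathcal{SR}(\Omega_D,A)$, if $F$ is $C^1$ and holomorphic: $\frac{\partial F}{\partial\alpha}+i\frac{\partial F}{\partial\beta}=0$. Slice product: $\mathcal I(F)\cdot\mathcal I(G):=\mathcal I(FG)$, product in $A\otimes_{\mathbb R}\mathbb C$. Spherical series. For $y\in\mathcal Q_A$, $\Delta_y(x):=x^2-x\,t(y)+n(y)$; $\mathscr S_{y,2m}(x):=\Delta_y(x)^m$, $\mathscr S_{y,2m+1}(x):=\Delta_y(x)^m(x-y)$, $m\in\mathbb N$; these are the slice functions on $\mathcal Q_A$ induced by $z\mapsto\Delta_y(z)^m$ and $z\mapsto\Delta_y(z)^m(z-y)$. For $s\in A$, $\mathscr S_{y,n}(x)s$ is the value at $x$ of the slice function induced by $z\mapsto\mathscr S_{y,n}(z)s$. Pseudo-metric. $\mathrm u_A(x,y):=\sqrt{\|\Delta_y(x)\|_A}$ for $x,y\in\mathcal Q_A$; $\mathrm U_A(y,r):=\{x\in\mathcal Q_A:\mathrm u_A(x,y)<r\}$. For $w\in\mathbb C$, $\mathrm U(w,r):=\{z\in\mathbb C:\sqrt{|z-w||z-\overline w|}<r\}$; if $y=\xi+J\eta$, $w=\xi+i\eta$, then $\mathrm U_A(y,r)$ is the set of all $\alpha+\beta I$ with $\alpha+i\beta\in\mathrm U(w,r)$, $I\in\mathbb S_A$. Integrals. $\partial\mathrm U_J(y,r)$ is the boundary in $\mathbb C_J$, with the boundary orientation induced via the identification $\mathbb C\to\mathbb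 C_J$, $\alpha+i\beta\mapsto\alpha+J\beta$ (counterclockwise around each component). For a parametrization $\zeta(t)$, $\int g(\zeta)\,d\zeta\,f(\zeta)$ means $\int\big(g(\zeta(t))\zeta'(t)\big)f(\zeta(t))\,dt$, where $g$ has values in $\mathbb C_J$ (or in $\mathbb C_J\otimes_{\mathbb R}\mathbb C$, for the stem function). *)

(* Defs.v *)
From Stdlib Require Import Reals List Permutation ClassicalEpsilon.
From Coquelicot Require Import Coquelicot.
Import ListNotations.

Set Implicit Arguments.
Unset Strict Implicit.
Unset Printing Implicit Defensive.
Open Scope R_scope.

(* The norm [norm] of the underlying normed module plays the role of the norm
   of [A]; it induces the euclidean topology because [A] is
   finite-dimensional.  The product is not associative: [a ** b ** c] is
   [(a ** b) ** c].  [aone <> zero] is what identifies R with a subset of A. *)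
Record alt_star_algebra := AltStarAlgebra {
  acarrier :> CompleteNormedModule R_AbsRing;
  amul : acarrier -> acarrier -> acarrier;
  aone : acarrier;
  aconj : acarrier -> acarrier;
  afin_dim : exists (d : nat) (e : nat -> acarrier),
    forall x, exists c : nat -> R, x = sum_n (fun i => scal (c i) (e i)) d;
  amul_plus_l : forall x y z, amul (plus x y) z = plus (amul x z) (amul y z);
  amul_plus_r : forall x y z, amul x (plus y z) = plus (amul x y) (amul x z);
  amul_scal_l : forall (a : R) x y, amul (scal a x) y = scal a (amul x y);
  amul_scal_r : forall (a : R) x y, amul x (scal a y) = scal a (amul x y);
  amul_one_l : forall x, amul aone x = x;
  amul_one_r : forall x, amul x aone = x;
  aone_neq0 : aone <> zero;
  amul_alt_l : forall x y, amul (amul x x) y = amul x (amul x y);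
  amul_alt_r : forall x y, amul (amul y x) x = amul y (amul x x);
  aconj_plus : forall x y, aconj (plus x y) = plus (aconj x) (aconj y);
  aconj_scal : forall (a : R) x, aconj (scal a x) = scal a (aconj x);
  aconjK : forall x, aconj (aconj x) = x;
  aconj_mul : forall x y, aconj (amul x y) = amul (aconj y) (aconj x)
}.

Arguments amul {_} _ _.
Arguments aone {_}.
Arguments aconj {_} _.

Infix "**" := amul (at level 40, left associativity).

Definition associative_algebra (A : alt_star_algebra) : Prop :=
  forall x y z : A, (x ** y) ** z = x ** (y ** z).

Definition power (T : Type) (mul : T -> T -> T) (e x : T) (m : nat) : T :=
  Nat.iter m (fun v => mul v x) e.

(* The two-sided inverse (an arbitrary element if there is none). *)
Definition inverse (T : Type) (mul : T -> T -> T) (e x : T) : T :=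
  epsilon (inhabits e) (fun v => mul x v = e /\ mul v x = e).

Section Algebra.
Variable A : alt_star_algebra.
Implicit Types (x y s I J : A) (z w : C).

Definition areal (a : R) : A := scal a aone.
Definition apow x (m : nat) : A := power amul aone x m.
Definition ainv x : A := inverse amul aone x.

Definition tr x : A := plus x (aconj x).
Definition nrm x : A := x ** aconj x.

Definition quadratic_cone x : Prop :=
  (exists a : R, x = areal a) \/
  (exists t n : R, tr x = areal t /\ nrm x = areal n /\ 4 * n > t ^ 2).

Definition imag_sphere J : Prop :=
  quadratic_cone J /\ J ** J = areal (-1).

Definition norm_compatible : Prop :=
  forall x (n : R), quadratic_cone x -> nrm x = areal n -> norm x = sqrt n.

Definition inC J z : A := plus (areal (Re z)) (scal (Im z) J).

Definition slice_plane J x : Prop := exists z, x = inC J z.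

Definition adherent (E : A -> Prop) x : Prop :=
  forall P : A -> Prop, locally x P -> exists x', P x' /\ E x'.

Definition closure_in (S E : A -> Prop) x : Prop := S x /\ adherent E x.

Definition boundary_in (S E : A -> Prop) x : Prop :=
  S x /\ adherent E x /\ adherent (fun x' => S x' /\ ~ E x') x.

Definition connected (S : A -> Prop) : Prop :=
  forall P Q : A -> Prop, open P -> open Q ->
    (forall x, S x -> P x \/ Q x) ->
    (exists x, S x /\ P x) -> (exists x, S x /\ Q x) ->
    exists x, S x /\ P x /\ Q x.

(* [(a, b) : A * A] stands for the element [a + i b] of the complexification
   of [A]. *)

Definition cmul (u v : A * A) : A * A :=
  (minus (fst u ** fst v) (snd u ** snd v),
   plus (fst u ** snd v) (snd u ** fst v)).
Definition cone : A * A := (aone, zero).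
Definition cpow (u : A * A) (m : nat) : A * A := power cmul cone u m.
Definition cinv (u : A * A) : A * A := inverse cmul cone u.
Definition ofA x : A * A := (x, zero).
Definition ofC z : A * A := (areal (Re z), areal (Im z)).
Definition imul (u : A * A) : A * A := (opp (snd u), fst u).

Definition conj_invariant (D : C -> Prop) : Prop :=
  forall z, D z -> D (Cconj z).

Definition Omega (D : C -> Prop) x : Prop :=
  exists J z, imag_sphere J /\ D z /\ x = inC J z.

Definition stem (D : C -> Prop) (F : C -> A * A) : Prop :=
  forall z, D z ->
    fst (F (Cconj z)) = fst (F z) /\ snd (F (Cconj z)) = opp (snd (F z)).

Definition holomorphic (D : C -> Prop) (F : C -> A * A) : Prop :=
  exists Fa Fb : C -> A * A, forall z, D z ->
    is_derive (fun a : R => F (a, Im z)) (Re z) (Fa z) /\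
    is_derive (fun b : R => F (Re z, b)) (Im z) (Fb z) /\
    continuous Fa z /\ continuous Fb z /\
    plus (Fa z) (imul (Fb z)) = zero.

(* The slice function induced by [F]: when [F] is a stem function on [D], the
   value selected at a point of [Omega D] is the same for all its
   representations [inC J z]. *)
Definition slice (F : C -> A * A) x : A :=
  epsilon (inhabits zero) (fun v =>
    exists J z, imag_sphere J /\ x = inC J z /\
      v = plus (fst (F z)) (J ** snd (F z))).

(* Only the values of [f] on [Omega D] matter. *)
Definition slice_regular (D : C -> Prop) (f : A -> A) : Prop :=
  exists F : C -> A * A, stem D F /\ holomorphic D F /\
    forall x, Omega D x -> f x = slice F x.

Definition Delta y x : A :=
  plus (minus (x ** x) (x ** tr y)) (nrm y).

Definition spherical y (n : nat) x : A :=
  let d := apow (Delta y x) (Nat.div2 n) in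
  if Nat.even n then d else d ** minus x y.

Definition Delta_stem y z : A * A :=
  plus (minus (cmul (ofC z) (ofC z)) (cmul (ofC z) (ofA (tr y)))) (ofA (nrm y)).

Definition spherical_stem y (n : nat) z : A * A :=
  let d := cpow (Delta_stem y z) (Nat.div2 n) in
  if Nat.even n then d else cmul d (minus (ofC z) (ofA y)).

(* [S_{y,n}(x) s] in the slice sense; in general it is not the pointwise
   product [spherical y n x ** s]. *)
Definition spherical_term y (n : nat) s : A -> A :=
  slice (fun z => cmul (spherical_stem y n z) (ofA s)).

Definition u_dist x y : R := sqrt (norm (Delta y x)).

Definition U_ball y (r : R) x : Prop := quadratic_cone x /\ u_dist x y < r.

Definition U_slice J y (r : R) x : Prop := U_ball y r x /\ slice_plane J x.

Definition U_plane w (r : R) z : Prop :=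
  sqrt (Cmod (z - w) * Cmod (z - Cconj w)) < r.

Definition sup_boundary J y (r : R) (f : A -> A) : R :=
  real (Lub_Rbar (fun v =>
    exists x, boundary_in (slice_plane J) (U_slice J y r) x /\ v = norm (f x))).

End Algebra.

(* A contour is a finite list of arcs parametrized by [0,1]. *)
Definition velocity (g : R -> C) (t : R) : C :=
  (Derive (fun u => fst (g u)) t, Derive (fun u => snd (g u)) t).

Definition C1_arc (g : R -> C) : Prop :=
  forall t, 0 <= t <= 1 ->
    ex_derive (fun u => fst (g u)) t /\ ex_derive (fun u => snd (g u)) t /\
    continuous (velocity g) t.

(* [contour_int c H] is the integral over [c] of [H zeta dzeta]. *)
Definition contour_int (V : CompleteNormedModule R_AbsRing)
    (c : list (R -> C)) (H : C -> C -> V) : V :=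
  fold_right plus zero
    (map (fun g => RInt (fun t => H (g t) (velocity g t)) 0 1) c).

Definition contour_int2 (V : CompleteNormedModule R_AbsRing)
    (c : list (R -> C)) (H : C -> C -> V * V) : V * V :=
  (contour_int c (fun z dz => fst (H z dz)),
   contour_int c (fun z dz => snd (H z dz))).

(* [2 pi i] times the winding number of [c] around [z]. *)
Definition winding_int (c : list (R -> C)) (z : C) : C :=
  contour_int2 (V := R_CompleteNormedModule)
    c (fun zeta dzeta => (dzeta / (zeta - z))%C).

(* [c] is a piecewise C^1 parametrization of the boundary in C_J of a subset
   [E] of C_J, with its boundary orientation: the arcs match up into closed
   curves (their initial points are, with multiplicity, their final points),
   they trace exactly the boundary, and they wind once counterclockwise around
   the points of [E] and not at all around the points off its closure.  Since
   the winding numbers on both sides of a boundary arc determine how many times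
   it is traversed, algebraically, the integral of a continuous form over [c]
   does not depend on the choice of [c].  Arcs rather than loops, as the
   boundary may have several components, or a double point (a lemniscate). *)
Record boundary_param (A : alt_star_algebra) (J : A) (E : A -> Prop)
    (c : list (R -> C)) : Prop := BoundaryParam {
  bp_C1 : forall g, In g c -> C1_arc g;
  bp_closed : Permutation (map (fun g => g 0) c) (map (fun g => g 1) c);
  bp_trace : forall x, boundary_in (slice_plane J) E x <->
    exists g t, In g c /\ 0 <= t <= 1 /\ x = inC J (g t);
  bp_inside : forall z, E (inC J z) -> winding_int c z = (2 * PI * Ci)%C;
  bp_outside : forall z, ~ closure_in (slice_plane J) E (inC J z) ->
    winding_int c z = 0%C
}.

Section Formulas.
Variable A : alt_star_algebra.
Implicit Types (x y J : A) (f : A -> A) (c : list (R -> C)).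

Definition coef_integral J y f c (n : nat) : A :=
  ainv (scal (2 * PI) J) **
  contour_int c (fun zeta dzeta =>
    (ainv (spherical y (S n) (inC J zeta)) ** inC J dzeta) ** f (inC J zeta)).

Definition remainder_stem J y f c (n : nat) (z : C) : A * A :=
  contour_int2 c (fun zeta dzeta =>
    let q := inC J zeta in
    let kernel :=
      cmul (cmul (cmul (cinv (Delta_stem q z)) (minus (ofA (aconj q)) (ofC A z)))
                 (ofA (ainv J)))
           (ofA (ainv (spherical y (S n) q))) in
    cmul (cmul kernel (ofA (inC J dzeta))) (ofA (f q))).

Definition remainder_integral J y f c (n : nat) x : A :=
  contour_int c (fun zeta dzeta =>
    let q := inC J zeta in
    let kernel :=
      ainv (Delta q x) ** minus (aconj q) x ** ainv J **
      ainv (spherical y (S n) q) in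
    (kernel ** inC J dzeta) ** f q).

End Formulas.

(* Main.v *)
Require Import Defs.
From Stdlib Require Import Reals Lra Lia List Permutation Arith Classical ClassicalEpsilon FunctionalExtensionality.
From Coquelicot Require Import Coquelicot.
Import ListNotations.
Open Scope R_scope.

(* Along a plane C_J the spherical polynomials are the Newton polynomials with
   nodes alternating between w and its conjugate, and U_J(y,r) is the lemniscate
   domain |p(z)| < r^2 of p(z) = (z - w)(z - conj w).  A holomorphic function G on
   |p| < R0 is E(p) + (z - Re w) O(p) with E and O holomorphic on the disc
   |t| < R0, E being the average of G over the two preimages of t; expanding E and
   O in powers of t gives the spherical series, first for the real coordinates of
   the stem function and hence for f.  Since the elements of a fixed plane C_J act
   associatively on A, the integral formulas follow by integrating the series term
   by term: the coefficients by partial fractions over the poles w and conj w,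
   which have winding number one, and the remainders by Newton's interpolation
   identity for 1/(zeta - z).  The stem functions are recovered from their values
   along J and -J. *)

(** * Linear combinations in real modules *)

(** The constants may depend neither on w nor on r, although the boundary changes shape with them
    and acquires a double point when |Im w| = r. Estimating the contour integral directly would need
    uniform control of its length. The bound on s_n comes instead from Fourier coefficients in the
    variable t = p(z) on the circle |t| = r^2: only the odd part is singular there, like 1/|h| with
    h^2 = t - (Im w)^2, and this is integrable uniformly in w. The same bound with supremum 0 gives
    uniqueness, and summing it gives (iii'). Of the contour only the arcs, their matching ends, the
    trace and the winding numbers are known. Since D contains a slightly larger lemniscate domain,
    the expansion converges geometrically on the boundary, and every integral to be evaluated is
    reduced to one of a rational function with poles inside. Elements of different planes do not
    associate with each other and with A. Factors are therefore moved only inside one plane, and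
    identities at points of another plane are read off from stem functions. *)

Lemma scal_Rplus (V : ModuleSpace R_Ring) (a b : R) (x : V) :
  scal (a + b) x = plus (scal a x) (scal b x).
Proof. exact (scal_distr_r a b x). Qed.

Lemma scal_Rmult (V : ModuleSpace R_Ring) (a b : R) (x : V) :
  scal (a * b) x = scal a (scal b x).
Proof. symmetry; exact (scal_assoc a b x). Qed.

Lemma scal_R1 (V : ModuleSpace R_Ring) (x : V) : scal 1 x = x.
Proof. exact (scal_one x). Qed.

Lemma scal_R0 (V : ModuleSpace R_Ring) (x : V) : scal 0 x = zero.
Proof. exact (scal_zero_l x). Qed.

Lemma scal_Rm1 (V : ModuleSpace R_Ring) (x : V) : scal (-1) x = opp x.
Proof. exact (scal_opp_one x). Qed.

Section LinearExpressions.
Variable V : ModuleSpace R_Ring.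

Inductive lexpr :=
  | LZero | LVar (n : nat) | LPlus (a b : lexpr) | LMinus (a b : lexpr)
  | LOpp (a : lexpr) | LScal (r : R) (a : lexpr).

Fixpoint leval (env : list V) (e : lexpr) : V :=
  match e with
  | LZero => zero
  | LVar n => nth n env zero
  | LPlus a b => plus (leval env a) (leval env b)
  | LMinus a b => minus (leval env a) (leval env b)
  | LOpp a => opp (leval env a)
  | LScal r a => scal r (leval env a)
  end.

Fixpoint lcoef (e : lexpr) (i : nat) : R :=
  match e with
  | LZero => 0
  | LVar n => if Nat.eqb n i then 1 else 0
  | LPlus a b => lcoef a i + lcoef b i
  | LMinus a b => lcoef a i - lcoef b i
  | LOpp a => - lcoef a i
  | LScal r a => r * lcoef a i
  end.

Fixpoint lin_comb (k : nat -> R) (env : list V) : V :=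
  match env with
  | nil => zero
  | x :: l => plus (scal (k 0%nat) x) (lin_comb (fun i => k (S i)) l)
  end.

Lemma lin_comb_ext k k' env : (forall i, (i < length env)%nat -> k i = k' i) ->
  lin_comb k env = lin_comb k' env.
Proof.
  revert k k'; induction env as [|x l IH]; intros k k' H; simpl; [easy|].
  rewrite (H 0%nat) by (simpl; lia). f_equal. apply IH.
  intros i Hi; apply H; simpl; lia.
Qed.

Lemma lin_comb_plus k k' env :
  lin_comb (fun i => k i + k' i) env = plus (lin_comb k env) (lin_comb k' env).
Proof.
  revert k k'; induction env as [|x l IH]; intros k k'; simpl.
  { now rewrite plus_zero_l. }
  rewrite IH, scal_Rplus, <- !plus_assoc.
  f_equal. rewrite !plus_assoc. f_equal. apply plus_comm.
Qed.

Lemma lin_comb_scal r k env :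
  lin_comb (fun i => r * k i) env = scal r (lin_comb k env).
Proof.
  revert k; induction env as [|x l IH]; intros k; simpl.
  { now rewrite scal_zero_r. }
  now rewrite IH, scal_distr_l, scal_Rmult.
Qed.

Lemma lin_comb_zero env : lin_comb (fun _ => 0) env = zero.
Proof.
  induction env as [|x l IH]; simpl; [easy|].
  rewrite IH, plus_zero_r. apply scal_R0.
Qed.

Lemma lin_comb_var n env :
  lin_comb (fun i => if Nat.eqb n i then 1 else 0) env = nth n env zero.
Proof.
  revert n; induction env as [|x l IH]; intros [|n]; simpl; try easy.
  - rewrite lin_comb_zero, plus_zero_r.
    apply scal_R1.
  - rewrite IH. rewrite scal_R0. apply plus_zero_l.
Qed.

Lemma leval_lin_comb env e : leval env e = lin_comb (lcoef e) env.
Proof.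
  induction e; simpl.
  - symmetry; apply lin_comb_zero.
  - symmetry; apply lin_comb_var.
  - rewrite IHe1, IHe2. symmetry; apply lin_comb_plus.
  - unfold minus. rewrite <- (scal_Rm1 _ (leval env e2)), IHe1, IHe2, <- lin_comb_scal.
    rewrite <- lin_comb_plus. apply lin_comb_ext. intros; simpl; ring.
  - rewrite <- (scal_Rm1 _ (leval env e)), IHe, <- lin_comb_scal.
    apply lin_comb_ext. intros; ring.
  - rewrite IHe. symmetry; apply lin_comb_scal.
Qed.

(** Computes to one real equation per atom, so that [repeat split] leaves only goals for [ring] or
    [field]. *)
Fixpoint coefs_eq (e1 e2 : lexpr) (n : nat) : Prop :=
  match n with
  | O => True
  | S n => lcoef e1 n = lcoef e2 n /\ coefs_eq e1 e2 n
  end.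

Lemma leval_eq env e1 e2 : coefs_eq e1 e2 (length env) ->
  leval env e1 = leval env e2.
Proof.
  intros H. rewrite !leval_lin_comb. apply lin_comb_ext.
  revert H. generalize (length env) as n. induction n as [|n IH]; intros H i Hi.
  { lia. }
  destruct H as [H1 H2]. destruct (Nat.eq_dec i n) as [->|]; [easy|].
  apply IH; [easy | lia].
Qed.

End LinearExpressions.

Ltac lin_mem x l :=
  lazymatch l with
  | nil => constr:(false)
  | x :: _ => constr:(true)
  | _ :: ?l' => lin_mem x l'
  end.
Ltac lin_index x l :=
  lazymatch l with
  | x :: _ => constr:(O)
  | _ :: ?l' => let n := lin_index x l' in constr:(S n)
  end.
Ltac lin_atoms l e :=
  lazymatch e with
  | zero => l
  | plus ?a ?b => let l := lin_atoms l a in lin_atoms l b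
  | minus ?a ?b => let l := lin_atoms l a in lin_atoms l b
  | opp ?a => lin_atoms l a
  | scal _ ?a => lin_atoms l a
  | _ => let m := lin_mem e l in
         lazymatch m with true => l | false => constr:(e :: l) end
  end.
Ltac lin_reify V l e :=
  lazymatch e with
  | zero => constr:(LZero)
  | plus ?a ?b => let a := lin_reify V l a in let b := lin_reify V l b in
                  constr:(LPlus a b)
  | minus ?a ?b => let a := lin_reify V l a in let b := lin_reify V l b in
                   constr:(LMinus a b)
  | opp ?a => let a := lin_reify V l a in constr:(LOpp a)
  | scal ?r ?a => let a := lin_reify V l a in constr:(LScal r a)
  | _ => let n := lin_index e l in constr:(LVar n)
  end.
(* [module_norm] reduces an equality between linear combinations in an R-module
   to the equalities of their coefficients. *)
Ltac module_norm :=
  lazymatch goal with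
  | |- @eq ?T ?e1 ?e2 =>
    let l := lin_atoms (@nil T) e1 in
    let l := lin_atoms l e2 in
    let r1 := lin_reify T l e1 in
    let r2 := lin_reify T l e2 in
    refine (@leval_eq _ l r1 r2 _);
    cbn [coefs_eq lcoef length Nat.eqb]; repeat split
  end.
Ltac module := module_norm; try (unfold Re, Im; simpl; ring).

(** * The planes C_J *)

Section PlaneAlgebra.
Variable A : alt_star_algebra.
Implicit Types (x y s I J : A) (z w a b : C).

Lemma amul_zero_l x : zero ** x = zero.
Proof.
  transitivity (scal 0 x ** x); [f_equal; module|]. rewrite amul_scal_l. module.
Qed.

Lemma amul_zero_r x : x ** zero = zero.
Proof.
  transitivity (x ** scal 0 x); [f_equal; module|]. rewrite amul_scal_r. module.
Qed.

Lemma amul_opp_l x y : opp x ** y = opp (x ** y).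
Proof.
  transitivity (scal (-1) x ** y); [f_equal; module|]. rewrite amul_scal_l. module.
Qed.

Lemma amul_opp_r x y : x ** opp y = opp (x ** y).
Proof.
  transitivity (x ** scal (-1) y); [f_equal; module|]. rewrite amul_scal_r. module.
Qed.

Lemma amul_minus_l x y s : minus x y ** s = minus (x ** s) (y ** s).
Proof. unfold minus. now rewrite amul_plus_l, amul_opp_l. Qed.

Lemma amul_minus_r x y s : s ** minus x y = minus (s ** x) (s ** y).
Proof. unfold minus. now rewrite amul_plus_r, amul_opp_r. Qed.

Lemma aconj_one : aconj (aone : A) = aone.
Proof.
  rewrite <- (amul_one_l (aconj aone)). rewrite <- (aconjK (aone ** aconj aone)).
  rewrite aconj_mul, aconjK, amul_one_l, aconjK. reflexivity.
Qed.

Lemma aconj_areal (t : R) : aconj (areal A t) = areal A t.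
Proof. unfold areal. now rewrite aconj_scal, aconj_one. Qed.

Lemma aconj_minus x y : aconj (minus x y) = minus (aconj x) (aconj y).
Proof.
  transitivity (aconj (plus x (scal (-1) y))); [f_equal; module|].
  rewrite aconj_plus, aconj_scal. module.
Qed.

Lemma areal_mul_l (t : R) x : areal A t ** x = scal t x.
Proof. unfold areal. now rewrite amul_scal_l, amul_one_l. Qed.

Lemma areal_mul_r (t : R) x : x ** areal A t = scal t x.
Proof. unfold areal. now rewrite amul_scal_r, amul_one_r. Qed.

Lemma areal_inj (s t : R) : areal A s = areal A t -> s = t.
Proof.
  unfold areal. intros H. destruct (Req_dec s t) as [|n]; [easy|].
  exfalso. apply (@aone_neq0 A).
  transitivity (scal (/ (s - t)) (minus (scal s (aone : A)) (scal t aone))).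
  - module. field. lra.
  - rewrite H. module.
Qed.

Lemma real_square_neg (t : R) : areal A t ** areal A t <> areal A (-1).
Proof.
  rewrite areal_mul_l. unfold areal. rewrite <- scal_Rmult.
  intros H. apply areal_inj in H. nra.
Qed.

Lemma imag_sphere_sq J : imag_sphere J -> J ** J = areal A (-1).
Proof. now intros []. Qed.

(** Membership in the cone only gives [aconj J] = t - J with t real. Then [nrm J] = t J + 1 is real,
    so t <> 0 would make J itself real, and no real element has square -1. *)
Lemma imag_sphere_conj J : imag_sphere J -> aconj J = opp J.
Proof.
  intros [[[t ->]|(t & n & Ht & Hn & _)] H2]; [now apply real_square_neg in H2|].
  assert (Hc : aconj J = minus (areal A t) J).
  { rewrite <- Ht. unfold tr. module. }
  unfold nrm in Hn. rewrite Hc, amul_minus_r, areal_mul_r, H2 in Hn.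
  destruct (Req_dec t 0) as [->|n0].
  { rewrite Hc. unfold areal. module. }
  exfalso. apply (real_square_neg ((n - 1) / t)). rewrite <- H2.
  assert (HJ : J = areal A ((n - 1) / t)).
  { transitivity (scal (/ t) (plus (minus (scal t J) (areal A (-1))) (areal A (-1)))).
    { module. field. easy. }
    apply (f_equal (fun v => scal (/ t) (plus v (areal A (-1))))) in Hn.
    etransitivity; [exact Hn|]. unfold areal. module. field. easy. }
  now rewrite <- HJ.
Qed.

Lemma inC_plus J a b : inC J (a + b)%C = plus (inC J a) (inC J b).
Proof. unfold inC, areal, Re, Im; simpl. module. Qed.

Lemma inC_minus J a b : inC J (a - b)%C = minus (inC J a) (inC J b).
Proof. unfold inC, areal, Re, Im; simpl. module. Qed.

Lemma inC_opp J a : inC J (- a)%C = opp (inC J a).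
Proof. unfold inC, areal, Re, Im; simpl. module. Qed.

Lemma inC_RtoC J (t : R) : inC J (RtoC t) = areal A t.
Proof. unfold inC, areal, Re, Im; simpl. module. Qed.

Lemma inC_scal J (t : R) a : inC J (RtoC t * a)%C = scal t (inC J a).
Proof. unfold inC, areal, Re, Im; simpl. module. Qed.

Lemma inC_Ci J : inC J Ci = J.
Proof. unfold inC, areal, Re, Im; simpl. module. Qed.

Lemma inC_act J a x : inC J a ** x = plus (scal (Re a) x) (scal (Im a) (J ** x)).
Proof. unfold inC. now rewrite amul_plus_l, areal_mul_l, amul_scal_l. Qed.

Lemma inC_one J : inC J (RtoC 1) = aone.
Proof. rewrite inC_RtoC. unfold areal. module. Qed.

Lemma inC_zero J : inC J (RtoC 0) = zero.
Proof. rewrite inC_RtoC. unfold areal. module. Qed.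

Lemma inC_opp_conj J a : inC (opp J) a = inC J (Cconj a).
Proof. unfold inC, areal, Re, Im; simpl. module. Qed.

Section Sphere.
Variable J : A.
Hypothesis HJ : imag_sphere J.

(** Left alternativity gives J (J x) = (J J) x = - x. Hence A is a left module over [C_J], and this
    is the substitute for associativity throughout. *)
Lemma inC_mul_act a b x : inC J a ** (inC J b ** x) = inC J (a * b)%C ** x.
Proof.
  rewrite !inC_act, amul_plus_r, !amul_scal_r, <- amul_alt_l, (imag_sphere_sq J HJ).
  rewrite areal_mul_l. simpl. module.
Qed.

Lemma inC_mul a b : inC J a ** inC J b = inC J (a * b)%C.
Proof.
  rewrite <- (amul_one_r (inC J b)), inC_mul_act. apply amul_one_r.
Qed.

Lemma inC_inv_act a x : a <> 0%C -> inC J (/ a)%C ** (inC J a ** x) = x.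
Proof.
  intros Ha. rewrite inC_mul_act, Cinv_l, inC_one by easy. apply amul_one_l.
Qed.

(** [epsilon] returns some two-sided inverse v; cancelling [inC J a] on the left through the action
    of [C_J] forces v to be the expected element. *)
Lemma ainv_inC a : a <> 0%C -> ainv (inC J a) = inC J (/ a)%C.
Proof.
  intros Ha. unfold ainv, inverse.
  assert (H : exists v, inC J a ** v = aone /\ v ** inC J a = aone).
  { exists (inC J (/ a)%C). rewrite !inC_mul, Cinv_r, Cinv_l, inC_one by easy.
    easy. }
  destruct (epsilon_spec (inhabits (aone : A)) _ H) as [H1 _].
  rewrite <- (inC_inv_act a (epsilon _ _)) by easy.
  rewrite H1. apply amul_one_r.
Qed.

Lemma aconj_inC a : aconj (inC J a) = inC J (Cconj a).
Proof.
  unfold inC. rewrite aconj_plus, aconj_scal, aconj_areal, (imag_sphere_conj J HJ).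
  unfold areal; simpl. module.
Qed.

Lemma tr_inC a : tr (inC J a) = areal A (2 * Re a).
Proof. unfold tr. rewrite aconj_inC. unfold inC, areal, Re, Im; simpl. module. Qed.

Lemma nrm_inC a : nrm (inC J a) = areal A (Re a ^ 2 + Im a ^ 2).
Proof.
  unfold nrm. rewrite aconj_inC, inC_mul. unfold inC, areal, Re, Im; simpl. module.
Qed.

Lemma cone_inC a : quadratic_cone (inC J a).
Proof.
  destruct (Req_dec (Im a) 0) as [H|H].
  - left. exists (Re a). unfold inC. rewrite H. unfold areal. module.
  - right. exists (2 * Re a), (Re a ^ 2 + Im a ^ 2).
    rewrite tr_inC, nrm_inC. repeat split. assert (0 < Im a ^ 2) by now apply pow2_gt_0.
    lra.
Qed.

Lemma imag_sphere_opp : imag_sphere (opp J).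
Proof.
  split.
  - replace (opp J) with (inC J (- Ci)%C) by now rewrite inC_opp, inC_Ci.
    apply cone_inC.
  - rewrite amul_opp_l, amul_opp_r, opp_opp. apply (imag_sphere_sq J HJ).
Qed.

End Sphere.

Lemma norm_inC (hnorm : norm_compatible A) J a : imag_sphere J -> norm (inC J a) = Cmod a.
Proof.
  intros HJ. rewrite (hnorm (inC J a) (Re a ^ 2 + Im a ^ 2)).
  - reflexivity.
  - now apply cone_inC.
  - now apply nrm_inC.
Qed.

(** Trace and norm recover [Re] and the square of [Im], hence the complex number up to conjugation.
    Conjugation is compensated by the sign of the unit, and on the real axis the unit is
    arbitrary. *)
Lemma inC_eq_cases I J a b : imag_sphere I -> imag_sphere J -> inC I a = inC J b ->
  (a = b /\ (I = J \/ Im a = 0)) \/ (a = Cconj b /\ I = opp J).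
Proof.
  intros HI HJ H.
  assert (H1 := tr_inC I HI a). rewrite H, (tr_inC J HJ) in H1. apply areal_inj in H1.
  assert (H2 := nrm_inC I HI a). rewrite H, (nrm_inC J HJ) in H2. apply areal_inj in H2.
  assert (HR : Re a = Re b) by lra.
  assert (HIm : (Im a - Im b) * (Im a + Im b) = 0) by (rewrite HR in H2; nra).
  assert (HS : scal (Im a) I = scal (Im b) J).
  { transitivity (minus (inC I a) (areal A (Re a))).
    - unfold inC. module.
    - rewrite H, HR. unfold inC. module. }
  destruct (Req_dec (Im a) 0) as [H0|H0].
  - left. assert (Im b = 0) by (rewrite H0 in HIm; nra).
    split; [|now right]. apply injective_projections; unfold Re, Im in *; lra.
  - apply Rmult_integral in HIm. destruct HIm as [HIm|HIm].
    + left. split; [apply injective_projections; unfold Re, Im in *; lra|]. left.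
      transitivity (scal (/ Im a) (scal (Im a) I)); [module; now field|].
      rewrite HS. replace (Im b) with (Im a) by lra. module. now field.
    + right. split; [apply injective_projections; unfold Re, Im, Cconj in *; simpl; lra|].
      transitivity (scal (/ Im a) (scal (Im a) I)); [module; now field|].
      rewrite HS. replace (Im b) with (- Im a) by lra. module. now field.
Qed.

(** Completing the square in x^2 = t x - n shows that (x - t/2)/d, with d = sqrt (n - t^2/4),
    squares to -1. A real x carries no unit of its own and borrows the given one. *)
Lemma cone_repr x : (exists J, imag_sphere J) -> quadratic_cone x ->
  exists I z, imag_sphere I /\ x = inC I z.
Proof.
  intros [J HJ] [[t ->]|(t & n & Ht & Hn & Hd)].
  - exists J, (RtoC t). now rewrite inC_RtoC.
  - set (d := sqrt (n - t ^ 2 / 4)).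
    assert (Hd0 : 0 < d) by (apply sqrt_lt_R0; lra).
    assert (Hd2 : d * d = n - t ^ 2 / 4) by (apply sqrt_sqrt; lra).
    assert (Hc : aconj x = minus (areal A t) x) by (rewrite <- Ht; unfold tr; module).
    assert (Hxx : x ** x = minus (scal t x) (areal A n)).
    { rewrite <- Hn. unfold nrm. rewrite Hc, amul_minus_r, areal_mul_r. module. }
    set (K := scal (/ d) (minus x (areal A (t / 2)))).
    assert (HKc : aconj K = opp K).
    { unfold K. rewrite aconj_scal, aconj_minus, aconj_areal, Hc.
      unfold areal. module; field; lra. }
    assert (HKK : K ** K = areal A (-1)).
    { replace n with (d * d + t ^ 2 / 4) in Hxx by lra.
      unfold K. rewrite amul_scal_l, amul_scal_r, amul_minus_l, !amul_minus_r.
      rewrite !areal_mul_l, !areal_mul_r, Hxx. unfold areal. module; field; lra. }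
    exists K, (t / 2, d). split.
    + split; [|easy]. right. exists 0, 1. unfold tr, nrm. rewrite HKc, amul_opp_r, HKK.
      unfold areal. repeat split; [module | module | lra].
    + unfold inC, K, areal; simpl. module; field; lra.
Qed.

(** Whatever representation [epsilon] picks, the value is the same: passing to (- J, conj z) changes
    the sign of J and of the second component together, and on the real axis the symmetry forces the
    second component to be 0. *)
Lemma slice_inC (F : C -> A * A) J z : imag_sphere J ->
  fst (F (Cconj z)) = fst (F z) -> snd (F (Cconj z)) = opp (snd (F z)) ->
  slice F (inC J z) = plus (fst (F z)) (J ** snd (F z)).
Proof.
  intros HJ H1 H2. unfold slice.
  assert (H : exists v, exists J0 z0, imag_sphere J0 /\ inC J z = inC J0 z0 /\
      v = plus (fst (F z0)) (J0 ** snd (F z0))) by (now exists (plus (fst (F z)) (J ** snd (F z))), J, z).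
  destruct (epsilon_spec (inhabits (zero : A)) _ H) as (J0 & z0 & HJ0 & Hz & Hv).
  etransitivity; [exact Hv|]. clear Hv.
  destruct (inC_eq_cases _ _ _ _ HJ HJ0 Hz) as [[-> [->|H0]]|[-> ->]].
  - easy.
  - assert (Hc : Cconj z0 = z0).
    { apply injective_projections; unfold Im in *; simpl; lra. }
    rewrite Hc in H2.
    assert (Hs : snd (F z0) = zero).
    { transitivity (scal (/ 2) (plus (snd (F z0)) (snd (F z0)))); [module; field|].
      rewrite H2 at 1. module. }
    now rewrite Hs, !amul_zero_r.
  - rewrite Cconj_conj in H1, H2. rewrite H1, H2, amul_opp_l, amul_opp_r. module.
Qed.

End PlaneAlgebra.

(** * Newton polynomials and spherical polynomials *)

Definition lemn (w z : C) : C := ((z - w) * (z - Cconj w))%C.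

Definition node (w : C) (i : nat) : C := if Nat.even i then w else Cconj w.

Fixpoint newton (w : C) (n : nat) (z : C) : C :=
  match n with
  | O => RtoC 1
  | S n => (newton w n z * (z - node w n))%C
  end.

(* [newton w n = newton_lin w n - w * newton_cst w n] with both parts real on
   the real axis. *)
Definition newton_lin (w : C) (n : nat) (z : C) : C :=
  (lemn w z ^ Nat.div2 n * (if Nat.even n then RtoC 1 else z))%C.
Definition newton_cst (w : C) (n : nat) (z : C) : C :=
  if Nat.even n then RtoC 0 else (lemn w z ^ Nat.div2 n)%C.

Lemma even_or_odd_div2 n :
  (Nat.even n = true /\ n = 2 * Nat.div2 n)%nat \/
  (Nat.even n = false /\ n = S (2 * Nat.div2 n))%nat.
Proof.
  pose proof (Nat.div2_odd n) as H. rewrite <- Nat.negb_even in H.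
  destruct (Nat.even n); simpl in H; [left | right]; split; easy || lia.
Qed.

Lemma newton_even w m z : newton w (2 * m) z = (lemn w z ^ m)%C.
Proof.
  induction m as [|m IH]; [easy|].
  replace (2 * S m)%nat with (S (S (2 * m))) by lia.
  cbn [newton]. rewrite IH. unfold node.
  replace (Nat.even (S (2 * m))) with false by (rewrite Nat.even_succ, Nat.odd_even; easy).
  rewrite Nat.even_even. rewrite Cpow_S. unfold lemn. ring.
Qed.

Lemma newton_odd w m z : newton w (S (2 * m)) z = (lemn w z ^ m * (z - w))%C.
Proof.
  cbn [newton]. rewrite newton_even. unfold node. now rewrite Nat.even_even.
Qed.

Lemma newton_split w n z : newton w n z = (newton_lin w n z - w * newton_cst w n z)%C.
Proof.
  unfold newton_lin, newton_cst.
  destruct (even_or_odd_div2 n) as [[H1 H2]|[H1 H2]]; rewrite H1;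
  rewrite H2 at 1; [rewrite newton_even | rewrite newton_odd]; ring.
Qed.

Lemma lemn_conj w z : lemn w (Cconj z) = Cconj (lemn w z).
Proof. unfold lemn. rewrite Cmult_conj, !Cminus_conj, Cconj_conj. ring. Qed.

Lemma newton_lin_conj w n z : newton_lin w n (Cconj z) = Cconj (newton_lin w n z).
Proof.
  unfold newton_lin. rewrite lemn_conj, Cmult_conj, Cpow_conj. f_equal.
  destruct (Nat.even n); [|easy]. apply injective_projections; simpl; ring.
Qed.

Lemma newton_cst_conj w n z : newton_cst w n (Cconj z) = Cconj (newton_cst w n z).
Proof.
  unfold newton_cst. rewrite lemn_conj. destruct (Nat.even n).
  - apply injective_projections; simpl; ring.
  - now rewrite Cpow_conj.
Qed.

(** Evaluation i |-> J on the complexification. It is not multiplicative in general; only left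
    factors with complex components, or with components in [C_J], can be pulled out. *)
Definition slice_at {A : alt_star_algebra} (J : A) (u : A * A) : A :=
  plus (fst u) (J ** snd u).

Section Spherical.
Variable A : alt_star_algebra.
Implicit Types (x y s I J : A) (z w a b : C).

Lemma apow_inC J a m : imag_sphere J -> apow (inC J a) m = inC J (a ^ m)%C.
Proof.
  intros HJ. induction m as [|m IH].
  - symmetry. apply inC_one.
  - change (apow (inC J a) (S m)) with (apow (inC J a) m ** inC J a).
    rewrite IH, inC_mul, Cpow_S by easy. f_equal. ring.
Qed.

Lemma ofC_mul a b : cmul (ofC A a) (ofC A b) = ofC A (a * b)%C.
Proof.
  unfold cmul, ofC; simpl. rewrite !areal_mul_l.
  f_equal; unfold areal; simpl; module.
Qed.

Lemma cpow_ofC a m : cpow (ofC A a) m = ofC A (a ^ m)%C.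
Proof.
  induction m as [|m IH].
  - unfold cpow, ofC, power, cone, areal; simpl. f_equal; module.
  - change (cpow (ofC A a) (S m)) with (cmul (cpow (ofC A a) m) (ofC A a)).
    rewrite IH, ofC_mul, Cpow_S. f_equal. ring.
Qed.

Lemma cmul_ofC a (u : A * A) :
  cmul (ofC A a) u = (minus (scal (Re a) (fst u)) (scal (Im a) (snd u)),
                      plus (scal (Re a) (snd u)) (scal (Im a) (fst u))).
Proof. unfold cmul, ofC; simpl. now rewrite !areal_mul_l. Qed.

Lemma slice_at_ofC I a : slice_at I (ofC A a) = inC I a.
Proof. unfold slice_at, ofC, inC; simpl. now rewrite areal_mul_r. Qed.

Lemma slice_at_cmul_ofC I a (u : A * A) : imag_sphere I ->
  slice_at I (cmul (ofC A a) u) = inC I a ** slice_at I u.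
Proof.
  intros HI. rewrite cmul_ofC. unfold slice_at; simpl.
  rewrite inC_act, !amul_plus_r, <- amul_alt_l, (imag_sphere_sq A I HI), areal_mul_l.
  rewrite !amul_scal_r. module.
Qed.

Lemma cmul_inC J a b c d : imag_sphere J ->
  cmul (inC J a, inC J b) (inC J c, inC J d) =
  (inC J (a * c - b * d)%C, inC J (a * d + b * c)%C).
Proof.
  intros HJ. unfold cmul; simpl. now rewrite !inC_mul, inC_minus, inC_plus.
Qed.

Lemma slice_at_cmul J a b (u : A * A) : imag_sphere J ->
  slice_at J (cmul (inC J a, inC J b) u) = inC J (a + Ci * b)%C ** slice_at J u.
Proof.
  intros HJ. unfold cmul, slice_at; simpl.
  rewrite inC_plus, amul_plus_l, !amul_plus_r.
  assert (E : forall v, J ** v = inC J Ci ** v) by (intros; now rewrite inC_Ci).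
  rewrite !E, !inC_mul_act by easy.
  replace (Ci * b * Ci)%C with (- b)%C by (apply injective_projections; simpl; ring).
  replace (a * Ci)%C with (Ci * a)%C by ring.
  rewrite inC_opp, amul_opp_l. module.
Qed.

Lemma slice_at_opp_cmul J a b (u : A * A) : imag_sphere J ->
  slice_at (opp J) (cmul (inC J a, inC J b) u) =
  inC J (a - Ci * b)%C ** slice_at (opp J) u.
Proof.
  intros HJ. pose proof (imag_sphere_opp A J HJ) as HJ'.
  pose proof (slice_at_cmul (opp J) (Cconj a) (Cconj b) u HJ') as H.
  rewrite !inC_opp_conj, !Cconj_conj in H. rewrite H. do 2 f_equal.
  apply injective_projections; simpl; ring.
Qed.

Section AtPoint.
Variables (J : A) (w : C).
Hypothesis HJ : imag_sphere J.

(** The coefficients of [Delta], a trace and a norm, are real. So it is the same complex polynomial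
    on every plane [C_I], not only on the plane of its centre. *)
Lemma Delta_inC I z : imag_sphere I -> Defs.Delta (inC J w) (inC I z) = inC I (lemn w z).
Proof.
  intros HI. unfold Defs.Delta. rewrite tr_inC, nrm_inC, inC_mul, areal_mul_r by easy.
  unfold lemn, inC, areal; simpl. module.
Qed.

Lemma Delta_stem_inC z : Delta_stem (inC J w) z = ofC A (lemn w z).
Proof.
  unfold Delta_stem. rewrite ofC_mul, cmul_ofC. unfold ofA. rewrite tr_inC, nrm_inC by easy.
  unfold lemn, ofC, areal; simpl. apply injective_projections; simpl.
  - etransitivity; [|apply (f_equal (fun r => scal r (aone : A)))]; [|reflexivity].
    unfold Re, Im; simpl.
    match goal with |- ?e = _ => change e with
      (plus (minus (scal (fst z * fst z - snd z * snd z) (aone : A))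
       (minus (scal (fst z) (scal (2 * fst w) aone)) (scal (snd z) zero)))
       (scal (fst w * (fst w * 1) + snd w * (snd w * 1)) aone)) end.
    module.
  - match goal with |- ?e = _ => change e with
      (plus (minus (scal (fst z * snd z + snd z * fst z) (aone : A))
       (plus (scal (fst z) zero) (scal (snd z) (scal (2 * fst w) aone)))) zero) end.
    module.
Qed.

Lemma spherical_inC n z : spherical (inC J w) n (inC J z) = inC J (newton w n z).
Proof.
  unfold spherical. rewrite Delta_inC, apow_inC by easy.
  destruct (even_or_odd_div2 n) as [[H1 H2]|[H1 H2]]; rewrite H1.
  - rewrite H2 at 2. now rewrite newton_even.
  - rewrite H2 at 2. rewrite newton_odd, <- inC_minus. now apply inC_mul.
Qed.

Lemma spherical_stem_mul n z s :
  cmul (spherical_stem (inC J w) n z) (ofA s) =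
  (minus (scal (Re (newton_lin w n z)) s) (scal (Re (newton_cst w n z)) (inC J w ** s)),
   minus (scal (Im (newton_lin w n z)) s) (scal (Im (newton_cst w n z)) (inC J w ** s))).
Proof.
  unfold spherical_stem, newton_lin, newton_cst. rewrite Delta_stem_inC, cpow_ofC.
  set (d := (lemn w z ^ Nat.div2 n)%C).
  destruct (Nat.even n).
  - rewrite cmul_ofC. unfold ofA; simpl. apply injective_projections; simpl; module.
  - rewrite cmul_ofC. unfold ofA, cmul.
    apply injective_projections; cbn [fst snd];
    rewrite amul_zero_r;
    change (fst (minus (ofC A z) (inC J w, zero))) with (minus (areal A (Re z)) (inC J w));
    change (snd (minus (ofC A z) (inC J w, zero))) with (minus (areal A (Im z)) zero);
    rewrite ?amul_minus_l, ?amul_plus_l, ?amul_zero_l, !amul_scal_l, !amul_minus_l, !areal_mul_l,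
      ?amul_zero_l; rewrite ?amul_zero_r; module.
Qed.

Lemma slice_at_stem_mul I n z s : imag_sphere I ->
  slice_at I (cmul (spherical_stem (inC J w) n z) (ofA s)) =
  minus (inC I (newton_lin w n z) ** s) (inC I (newton_cst w n z) ** (inC J w ** s)).
Proof.
  intros HI. rewrite spherical_stem_mul. unfold slice_at; simpl.
  rewrite !inC_act, amul_minus_r, !amul_scal_r. module.
Qed.

(** Off the plane of the centre, w lives in [C_J] and z in [C_I], so the Newton polynomial cannot be
    formed. Its two parts with real coefficients act through [C_I], after w has acted on s through
    [C_J]. *)
Lemma spherical_term_inC I n z s : imag_sphere I ->
  spherical_term (inC J w) n s (inC I z) =
  minus (inC I (newton_lin w n z) ** s) (inC I (newton_cst w n z) ** (inC J w ** s)).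
Proof.
  intros HI. rewrite <- slice_at_stem_mul by easy. unfold spherical_term.
  apply slice_inC; [easy| |]; rewrite !spherical_stem_mul; cbn [fst snd];
    rewrite newton_lin_conj, newton_cst_conj.
  - now rewrite !re_conj.
  - rewrite !im_conj. module.
Qed.

Lemma spherical_term_slice n z s :
  spherical_term (inC J w) n s (inC J z) = inC J (newton w n z) ** s.
Proof.
  rewrite spherical_term_inC, inC_mul_act, newton_split, inC_minus, amul_minus_l by easy.
  do 3 f_equal. ring.
Qed.

End AtPoint.
End Spherical.

(** * Boundedness of the product *)

Lemma norm_scal_le (V : NormedModule R_AbsRing) (r : R) (x : V) :
  norm (scal r x) <= Rabs r * norm x.
Proof. exact (norm_scal r x). Qed.

Lemma norm_triangle_le (V : NormedModule R_AbsRing) (x y : V) a b :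
  norm x <= a -> norm y <= b -> norm (plus x y) <= a + b.
Proof. intros H1 H2. generalize (norm_triangle x y). lra. Qed.

Lemma norm_minus_le (V : NormedModule R_AbsRing) (x y : V) a b :
  norm x <= a -> norm y <= b -> norm (minus x y) <= a + b.
Proof.
  intros H1 H2. apply norm_triangle_le; [easy|]. now rewrite norm_opp.
Qed.

Lemma norm_minus_sym (V : NormedModule R_AbsRing) (x y : V) :
  norm (minus x y) = norm (minus y x).
Proof. rewrite <- norm_opp. f_equal. module. Qed.

(** * Bounded coordinates in finite dimension *)

Section FiniteDimension.
Variable V : NormedModule R_AbsRing.

Fixpoint lin_sum (n : nat) (c : nat -> R) (e : nat -> V) : V :=
  match n with
  | O => zero
  | S n => plus (lin_sum n c e) (scal (c n) (e n))
  end.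

Fixpoint norm_sum (n : nat) (e : nat -> V) : R :=
  match n with
  | O => 0
  | S n => norm_sum n e + norm (e n)
  end.

Lemma norm_sum_ge0 n e : 0 <= norm_sum n e.
Proof. induction n; simpl; [lra|]. generalize (norm_ge_0 (e n)). lra. Qed.

Lemma lin_sum_ext n c c' e : (forall i, (i < n)%nat -> c i = c' i) ->
  lin_sum n c e = lin_sum n c' e.
Proof.
  induction n as [|n IH]; intros H; simpl; [easy|].
  rewrite IH, (H n) by (intros; try apply H; lia). easy.
Qed.

Lemma lin_sum_lin n a b c d e :
  lin_sum n (fun i => a * c i + b * d i) e =
  plus (scal a (lin_sum n c e)) (scal b (lin_sum n d e)).
Proof. induction n as [|n IH]; simpl; [module|]. rewrite IH. module. Qed.

Lemma lin_sum_bound n c e m : 0 <= m -> (forall i, (i < n)%nat -> Rabs (c i) <= m) ->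
  norm (lin_sum n c e) <= m * norm_sum n e.
Proof.
  intros Hm. induction n as [|n IH]; intros H; simpl.
  - rewrite norm_zero. lra.
  - rewrite Rmult_plus_distr_l. apply norm_triangle_le.
    + apply IH. intros; apply H; lia.
    + eapply Rle_trans; [apply norm_scal_le|].
      apply Rmult_le_compat_r; [apply norm_ge_0|]. apply H; lia.
Qed.

Definition span (n : nat) (e : nat -> V) (x : V) : Prop := exists c, x = lin_sum n c e.

Lemma span_lin n e a b x y : span n e x -> span n e y ->
  span n e (plus (scal a x) (scal b y)).
Proof.
  intros [c ->] [d ->]. exists (fun i => a * c i + b * d i). now rewrite lin_sum_lin.
Qed.

(** The vectors e may be linearly dependent: phi selects one linear and bounded system of
    coordinates on their span. *)
Definition bounded_coords (n : nat) (e : nat -> V) (phi : nat -> V -> R) (M : R) : Prop :=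
  0 <= M /\
  forall x, span n e x ->
    x = lin_sum n (fun i => phi i x) e /\
    (forall i, Rabs (phi i x) <= M * norm x) /\
    (forall i a b y, span n e y ->
       phi i (plus (scal a x) (scal b y)) = a * phi i x + b * phi i y).

(** A span with bounded coordinates is closed: if elements of it approached v, their coordinates
    would be Cauchy sequences, and the limits would express v. *)
Lemma span_distance n e phi M v : bounded_coords n e phi M -> ~ span n e v ->
  exists d, 0 < d /\ forall x, span n e x -> d <= norm (minus v x).
Proof.
  intros [HM0 HM] Hv. apply NNPP. intros Hn.
  assert (Hs : forall k : nat, exists x, span n e x /\ norm (minus v x) < / (INR k + 1)).
  { intros k. apply NNPP. intros Hk. apply Hn. exists (/ (INR k + 1)). split.
    { apply Rinv_0_lt_compat. generalize (pos_INR k); lra. }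
    intros x Hx. apply Rnot_lt_le. intros Hlt. apply Hk. now exists x. }
  set (u k := proj1_sig (constructive_indefinite_description _ (Hs k))).
  assert (Hu : forall k, span n e (u k) /\ norm (minus v (u k)) < / (INR k + 1)).
  { intros k. unfold u. now destruct (constructive_indefinite_description _ (Hs k)). }
  assert (Hinv : forall k l, (k <= l)%nat -> / (INR l + 1) <= / (INR k + 1)).
  { intros k l Hkl. apply Rinv_le_contravar; [generalize (pos_INR k); lra|].
    apply le_INR in Hkl. lra. }
  assert (Hd : forall i k l, (k <= l)%nat ->
    Rabs (phi i (u l) - phi i (u k)) <= M * (2 * / (INR k + 1))).
  { intros i k l Hkl.
    assert (Hlin : span n e (plus (scal 1 (u l)) (scal (-1) (u k)))).
    { apply span_lin; apply Hu. }
    replace (phi i (u l) - phi i (u k)) with (1 * phi i (u l) + -1 * phi i (u k)) by ring.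
    rewrite <- (proj2 (proj2 (HM _ (proj1 (Hu l))))) by apply Hu.
    eapply Rle_trans; [apply (HM _ Hlin)|]. apply Rmult_le_compat_l; [easy|].
    replace (plus (scal 1 (u l)) (scal (-1) (u k))) with
      (minus (minus v (u k)) (minus v (u l))) by module.
    replace (2 * / (INR k + 1)) with (/ (INR k + 1) + / (INR k + 1)) by ring.
    apply norm_minus_le.
    - left; apply Hu.
    - eapply Rle_trans; [left; apply Hu | now apply Hinv]. }
  assert (Hsmall : forall B eps, 0 < eps -> exists k, B * / (INR k + 1) < eps).
  { intros B eps He. destruct (INR_unbounded (Rabs B / eps)) as [k Hk]. exists k.
    assert (0 < INR k + 1) by (generalize (pos_INR k); lra).
    apply Rmult_lt_reg_r with (INR k + 1); [easy|].
    rewrite Rmult_assoc, Rinv_l, Rmult_1_r by lra.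
    apply Rle_lt_trans with (Rabs B); [apply Rle_abs|].
    apply Rmult_lt_reg_r with (/ eps); [now apply Rinv_0_lt_compat|].
    replace (eps * (INR k + 1) * / eps) with (INR k + 1) by (field; lra).
    unfold Rdiv in Hk. lra. }
  assert (Hc : forall i, exists l, Un_cv (fun k => phi i (u k)) l).
  { intros i. destruct (Rcomplete.R_complete (fun k => phi i (u k))) as [l Hl]; [|now exists l].
    intros eps He. destruct (Hsmall (2 * (M * 2)) eps He) as [N HN]. exists N.
    intros k l Hk Hl. unfold Rdist.
    replace (phi i (u k) - phi i (u l)) with
      ((phi i (u k) - phi i (u N)) - (phi i (u l) - phi i (u N))) by ring.
    eapply Rle_lt_trans; [|exact HN].
    eapply Rle_trans; [apply Rabs_triang|]. rewrite Rabs_Ropp.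
    replace (2 * (M * 2) * / (INR N + 1)) with
      (M * (2 * / (INR N + 1)) + M * (2 * / (INR N + 1))) by ring.
    apply Rplus_le_compat; apply Hd; lia. }
  set (c i := proj1_sig (constructive_indefinite_description _ (Hc i))).
  assert (Hci : forall i k, Rabs (c i - phi i (u k)) <= M * (2 * / (INR k + 1))).
  { intros i k. unfold c. destruct (constructive_indefinite_description _ (Hc i)) as [l Hl].
    simpl. apply Rnot_lt_le. intros Hlt.
    destruct (Hl _ (proj2 (Rlt_0_minus _ _) Hlt)) as [N HN].
    specialize (HN (max N k) ltac:(lia)). unfold Rdist in HN.
    specialize (Hd i k (max N k) ltac:(lia)).
    replace (l - phi i (u k)) with
      (- (phi i (u (max N k)) - l) + (phi i (u (max N k)) - phi i (u k))) in HN by ring.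
    revert HN. apply Rle_not_lt.
    generalize (Rabs_triang (- (phi i (u (max N k)) - l)) (phi i (u (max N k)) - phi i (u k))).
    rewrite Rabs_Ropp. lra. }
  apply Hv. exists c. set (x := lin_sum n c e).
  assert (Hx : forall k, norm (minus v x) <= (1 + M * 2 * norm_sum n e) * / (INR k + 1)).
  { intros k. destruct (Hu k) as [Hk1 Hk2].
    replace (minus v x) with (minus (minus v (u k)) (minus x (u k))) by module.
    rewrite Rmult_plus_distr_r, Rmult_1_l. apply norm_minus_le; [lra|].
    replace (minus x (u k)) with (lin_sum n (fun i => 1 * c i + -1 * phi i (u k)) e)
      by (rewrite lin_sum_lin, <- (proj1 (HM _ Hk1)); unfold x; module).
    replace (M * 2 * norm_sum n e * / (INR k + 1)) with
      (M * (2 * / (INR k + 1)) * norm_sum n e) by ring.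
    apply lin_sum_bound.
    - apply Rmult_le_pos; [easy|]. apply Rmult_le_pos; [lra|].
      left; apply Rinv_0_lt_compat. generalize (pos_INR k); lra.
    - intros i _. replace (1 * c i + -1 * phi i (u k)) with (c i - phi i (u k)) by ring.
      apply Hci. }
  assert (H0 : norm (minus v x) = 0).
  { apply Rle_antisym; [|apply norm_ge_0]. apply Rnot_lt_le. intros Hlt.
    destruct (Hsmall (1 + M * 2 * norm_sum n e) _ Hlt) as [k Hk].
    specialize (Hx k). lra. }
  apply norm_eq_zero in H0.
  transitivity (plus (minus v x) x); [module|]. rewrite H0. module.
Qed.

(** Induction on n. A vector [e n] already in the span gets coordinate 0. Otherwise let d > 0 bound
    its distance from the span: dividing x by its nonzero last coordinate gives [e n] up to an
    element of the span, of norm at least d, so that coordinate is at most norm x / d. *)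
Lemma bounded_coords_exists n e : exists phi M, bounded_coords n e phi M.
Proof.
  induction n as [|n (phi & M & HB)].
  { exists (fun _ _ => 0), 0. split; [lra|]. intros x [c ->]. simpl. repeat split.
    - intros i. rewrite Rabs_R0. lra.
    - intros; ring. }
  pose proof HB as [HM0 HM].
  assert (Hw : forall x, span n e x -> span (S n) e x).
  { intros x [c ->]. exists (fun i => if Nat.eqb i n then 0 else c i). simpl.
    rewrite Nat.eqb_refl. rewrite (lin_sum_ext n (fun i => if Nat.eqb i n then 0 else c i) c).
    - module.
    - intros i Hi. replace (Nat.eqb i n) with false; [easy|]. symmetry; apply Nat.eqb_neq; lia. }
  destruct (classic (span n e (e n))) as [Hs|Hs].
  - exists (fun i x => if Nat.eqb i n then 0 else phi i x), M. split; [easy|].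
    intros x Hx.
    assert (Hin : forall x, span (S n) e x -> span n e x).
    { intros z [c ->]. simpl.
      replace (plus _ _) with (plus (scal 1 (lin_sum n c e)) (scal (c n) (e n))) by module.
      apply span_lin; [now exists c | easy]. }
    apply Hin in Hx. destruct (HM x Hx) as (H1 & H2 & H3). repeat split.
    + simpl. rewrite Nat.eqb_refl. rewrite (lin_sum_ext n _ (fun i => phi i x)).
      * rewrite <- H1. module.
      * intros i Hi. replace (Nat.eqb i n) with false; [easy|]. symmetry; apply Nat.eqb_neq; lia.
    + intros i. destruct (Nat.eqb i n); [|apply H2]. rewrite Rabs_R0.
      apply Rmult_le_pos; [easy | apply norm_ge_0].
    + intros i a b y Hy. destruct (Nat.eqb i n); [ring|]. apply H3. now apply Hin.
  - destruct (span_distance n e phi M _ HB Hs) as (d & Hd0 & Hd).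
    assert (Hg : forall x, span (S n) e x -> exists g, span n e (minus x (scal g (e n)))).
    { intros x [c ->]. exists (c n), c. simpl. module. }
    assert (Hu : forall x g g', span n e (minus x (scal g (e n))) ->
      span n e (minus x (scal g' (e n))) -> g = g').
    { intros x g g' H1 H2. destruct (Req_dec g g') as [|Hne]; [easy|]. exfalso. apply Hs.
      replace (e n) with (plus (scal (/ (g' - g)) (minus x (scal g (e n))))
        (scal (- / (g' - g)) (minus x (scal g' (e n))))).
      - now apply span_lin.
      - module; field; lra. }
    set (gam x := epsilon (inhabits 0) (fun g => span n e (minus x (scal g (e n))))).
    assert (Hgam : forall x, span (S n) e x -> span n e (minus x (scal (gam x) (e n)))).
    { intros x Hx. exact (epsilon_spec (inhabits 0) _ (Hg x Hx)). }
    assert (Hgb : forall x, span (S n) e x -> Rabs (gam x) <= / d * norm x).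
    { intros x Hx. destruct (Req_dec (gam x) 0) as [H0|H0].
      - rewrite H0, Rabs_R0. apply Rmult_le_pos; [|apply norm_ge_0].
        left; now apply Rinv_0_lt_compat.
      - apply Rmult_le_reg_l with d; [easy|].
        rewrite <- Rmult_assoc, Rinv_r, Rmult_1_l by lra.
        assert (H1 : d <= norm (scal (/ gam x) x)).
        { replace (scal (/ gam x) x) with
            (minus (e n) (plus (scal (- / gam x) (minus x (scal (gam x) (e n))))
                               (scal 0 (minus x (scal (gam x) (e n))))))
            by (module; field; easy).
          apply Hd. apply span_lin; now apply Hgam. }
        assert (H2 := norm_scal_le V (/ gam x) x). rewrite Rabs_inv in H2.
        assert (H3 : 0 < Rabs (gam x)) by now apply Rabs_pos_lt.
        apply Rmult_le_reg_r with (/ Rabs (gam x)); [now apply Rinv_0_lt_compat|].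
        rewrite Rmult_assoc, Rinv_r, Rmult_1_r by lra. lra. }
    assert (Hgl : forall a b x y, span (S n) e x -> span (S n) e y ->
      gam (plus (scal a x) (scal b y)) = a * gam x + b * gam y).
    { intros a b x y Hx Hy. apply (Hu (plus (scal a x) (scal b y))).
      - apply Hgam. now apply span_lin.
      - replace (minus _ _) with (plus (scal a (minus x (scal (gam x) (e n))))
          (scal b (minus y (scal (gam y) (e n))))) by module.
        apply span_lin; now apply Hgam. }
    exists (fun i x => if Nat.eqb i n then gam x else phi i (minus x (scal (gam x) (e n)))).
    (* The last coordinate costs / d; the others are coordinates of x - gam x e_n, whose norm is at
       most 1 + norm (e n) / d times that of x. *)
    exists (/ d + M * (1 + / d * norm (e n))).
    assert (Hdi : 0 < / d) by now apply Rinv_0_lt_compat.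
    assert (Hp : 0 <= 1 + / d * norm (e n)).
    { assert (0 <= / d * norm (e n)) by (apply Rmult_le_pos; [lra|apply norm_ge_0]). lra. }
    split.
    { assert (0 <= M * (1 + / d * norm (e n))) by now apply Rmult_le_pos. lra. }
    intros x Hx. pose proof (Hgam x Hx) as Hgx. destruct (HM _ Hgx) as (H1 & H2 & H3).
    repeat split.
    + simpl. rewrite Nat.eqb_refl.
      rewrite (lin_sum_ext n _ (fun i => phi i (minus x (scal (gam x) (e n))))).
      * rewrite <- H1. module.
      * intros i Hi. replace (Nat.eqb i n) with false; [easy|]. symmetry; apply Nat.eqb_neq; lia.
    + intros i. rewrite Rmult_plus_distr_r. destruct (Nat.eqb i n).
      * assert (0 <= M * (1 + / d * norm (e n)) * norm x).
        { apply Rmult_le_pos; [now apply Rmult_le_pos | apply norm_ge_0]. }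
        generalize (Hgb x Hx). lra.
      * assert (0 <= / d * norm x) by (apply Rmult_le_pos; [lra | apply norm_ge_0]).
        apply Rle_trans with (M * (1 + / d * norm (e n)) * norm x); [|lra].
        eapply Rle_trans; [apply H2|]. rewrite Rmult_assoc. apply Rmult_le_compat_l; [easy|].
        rewrite Rmult_plus_distr_r, Rmult_1_l. apply norm_minus_le; [lra|].
        eapply Rle_trans; [apply norm_scal_le|].
        replace (/ d * norm (e n) * norm x) with ((/ d * norm x) * norm (e n)) by ring.
        apply Rmult_le_compat_r; [apply norm_ge_0 | now apply Hgb].
    + intros i a b y Hy. destruct (Nat.eqb i n); [now apply Hgl|].
      rewrite <- H3 by now apply Hgam. f_equal. rewrite Hgl by easy. module.
Qed.

End FiniteDimension.

Section AlgebraBounds.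
Variable A : alt_star_algebra.

Lemma coordinates : exists (N : nat) (e : nat -> A) (phi : nat -> A -> R) (M : R),
  0 <= M /\ (forall x, x = lin_sum A N (fun i => phi i x) e) /\
  (forall i x, Rabs (phi i x) <= M * norm x) /\
  (forall i a b x y, phi i (plus (scal a x) (scal b y)) = a * phi i x + b * phi i y).
Proof.
  destruct (@afin_dim A) as (d & e & He).
  assert (Hs : forall x, span A (S d) e x).
  { intros x. destruct (He x) as [c Hc]. exists c. rewrite Hc. clear.
    induction d as [|d IH].
    - rewrite sum_O. simpl. module.
    - rewrite sum_Sn, IH. simpl. module. }
  destruct (bounded_coords_exists A (S d) e) as (phi & M & HM0 & HM).
  exists (S d), e, phi, M. repeat split; [easy| | |].
  - intros x. now apply HM.
  - intros i x. now apply HM.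
  - intros i a b x y. now apply HM.
Qed.

Lemma linear_bounded (V : NormedModule R_AbsRing) (L : A -> V) :
  (forall x y, L (plus x y) = plus (L x) (L y)) ->
  (forall (a : R) x, L (scal a x) = scal a (L x)) ->
  exists C, 0 <= C /\ forall x, norm (L x) <= C * norm x.
Proof.
  intros H1 H2. destruct coordinates as (N & e & phi & M & HM & Hx & Hb & _).
  exists (M * norm_sum V N (fun i => L (e i))). split.
  { apply Rmult_le_pos; [easy | apply norm_sum_ge0]. }
  assert (HL : forall n c, L (lin_sum A n c e) = lin_sum V n c (fun i => L (e i))).
  { induction n as [|n IH]; intros c; simpl.
    - transitivity (L (scal 0 zero)); [f_equal; module|]. rewrite H2. module.
    - now rewrite H1, IH, H2. }
  intros x. rewrite (Hx x) at 1. rewrite HL.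
  replace (M * norm_sum V N (fun i => L (e i)) * norm x) with
    (M * norm x * norm_sum V N (fun i => L (e i))) by ring.
  apply lin_sum_bound; [|intros; apply Hb].
  apply Rmult_le_pos; [easy | apply norm_ge_0].
Qed.

(** The norm is not assumed to be submultiplicative. This M is the only quantity attached to the
    algebra that enters the final constants. *)
Lemma product_bounded : exists M, 1 <= M /\ forall x y : A, norm (x ** y) <= M * norm x * norm y.
Proof.
  destruct coordinates as (N & e & phi & M & HM & Hx & Hb & _).
  assert (HC : forall i, exists C, 0 <= C /\ forall y, norm (e i ** y) <= C * norm y).
  { intros i. apply linear_bounded; intros; [apply amul_plus_r | apply amul_scal_r]. }
  set (C i := proj1_sig (constructive_indefinite_description _ (HC i))).
  assert (HCi : forall i, 0 <= C i /\ forall y, norm (e i ** y) <= C i * norm y).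
  { intros i. unfold C. now destruct (constructive_indefinite_description _ (HC i)). }
  assert (HS : forall n, exists B, 0 <= B /\
    forall y, norm_sum A n (fun i => e i ** y) <= B * norm y).
  { induction n as [|n [B [HB0 HB]]].
    - exists 0. split; [lra|]. intros y; simpl. lra.
    - exists (B + C n). split; [generalize (proj1 (HCi n)); lra|].
      intros y; simpl. generalize (HB y) (proj2 (HCi n) y). lra. }
  destruct (HS N) as [B [HB0 HB]]. exists (1 + M * B).
  assert (0 <= M * B) by now apply Rmult_le_pos.
  split; [lra|]. intros x y.
  assert (HL : forall n c, lin_sum A n c e ** y = lin_sum A n c (fun i => e i ** y)).
  { induction n as [|n IH]; intros c; simpl.
    - apply amul_zero_l.
    - now rewrite amul_plus_l, IH, amul_scal_l. }
  rewrite (Hx x) at 1. rewrite HL.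
  assert (Hxy : 0 <= norm x * norm y) by (apply Rmult_le_pos; apply norm_ge_0).
  apply Rle_trans with (M * norm x * norm_sum A N (fun i => e i ** y)).
  - apply lin_sum_bound; [|intros; apply Hb].
    apply Rmult_le_pos; [easy | apply norm_ge_0].
  - apply Rle_trans with (M * norm x * (B * norm y)); [|nra].
    apply Rmult_le_compat_l; [|apply HB].
    apply Rmult_le_pos; [easy | apply norm_ge_0].
Qed.

End AlgebraBounds.

(** * Series and their integrals *)

Section Series.
Variable V : NormedModule R_AbsRing.
Implicit Types (a : nat -> V) (l : V).

Lemma is_series_eps a l :
  is_series a l <->
  forall eps, 0 < eps -> exists N, forall n, (N <= n)%nat -> norm (minus (sum_n a n) l) < eps.
Proof.
  unfold is_series. etransitivity; [apply (filterlim_locally_ball_norm (sum_n a) l)|]. split.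
  - intros H eps He. apply (H (mkposreal eps He)).
  - intros H eps. apply (H eps (cond_pos eps)).
Qed.

Lemma is_series_linear (W : NormedModule R_AbsRing) (L : V -> W) a l :
  is_linear L -> is_series a l -> is_series (fun n => L (a n)) (L l).
Proof.
  intros HL H. unfold is_series.
  apply filterlim_ext with (fun n => L (sum_n a n)).
  - intros n. induction n as [|n IH]; [now rewrite !sum_O|].
    now rewrite !sum_Sn, (linear_plus _ HL), IH.
  - eapply filterlim_comp; [exact H|]. now apply linear_cont.
Qed.

Lemma is_series_unique_V a l l' : is_series a l -> is_series a l' -> l = l'.
Proof. intros H H'. exact (filterlim_locally_unique _ _ _ H H'). Qed.

Lemma sum_n_norm_le a (b : nat -> R) n : (forall k, norm (a k) <= b k) ->
  norm (sum_n a n) <= sum_n b n.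
Proof.
  intros H. induction n as [|n IH].
  - rewrite !sum_O. apply H.
  - rewrite !sum_Sn. now apply norm_triangle_le.
Qed.

Lemma sum_n_gap a (b : nat -> R) n m : (forall k, norm (a k) <= b k) -> (n <= m)%nat ->
  norm (minus (sum_n a m) (sum_n a n)) <= sum_n b m - sum_n b n.
Proof.
  intros H Hm. induction Hm as [|m Hm IH].
  - rewrite Rminus_diag. replace (minus (sum_n a n) (sum_n a n)) with (zero : V) by module.
    rewrite norm_zero. lra.
  - rewrite !sum_Sn.
    replace (minus (plus (sum_n a m) (a (S m))) (sum_n a n)) with
      (plus (minus (sum_n a m) (sum_n a n)) (a (S m))) by module.
    replace (plus (sum_n b m) (b (S m)) - sum_n b n)
      with ((sum_n b m - sum_n b n) + b (S m)) by (unfold plus; simpl; ring).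
    now apply norm_triangle_le.
Qed.

Lemma sum_n_le_series (b : nat -> R) B n : (forall k, 0 <= b k) -> is_series b B ->
  sum_n b n <= B.
Proof.
  intros Hb HB. assert (HL : is_lim_seq (sum_n b) B) by exact HB.
  apply (is_lim_seq_incr_compare _ _ HL). intros k. rewrite sum_Sn.
  unfold plus; simpl. specialize (Hb (S k)). lra.
Qed.

Lemma series_tail a (b : nat -> R) l B n : (forall k, norm (a k) <= b k) ->
  is_series a l -> is_series b B -> norm (minus l (sum_n a n)) <= B - sum_n b n.
Proof.
  intros H Ha Hb. apply le_epsilon. intros eps He.
  destruct (proj1 (is_series_eps a l) Ha eps He) as [N HN].
  set (m := max N n). specialize (HN m ltac:(lia)).
  replace (minus l (sum_n a n)) with
    (minus (minus (sum_n a m) (sum_n a n)) (minus (sum_n a m) l)) by module.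
  apply norm_minus_le; [|lra].
  eapply Rle_trans; [apply sum_n_gap; [exact H | lia]|].
  apply Rplus_le_compat_r. apply sum_n_le_series; [|easy].
  intros k. exact (Rle_trans _ _ _ (norm_ge_0 (a k)) (H k)).
Qed.

Lemma series_norm_le a (b : nat -> R) l B : (forall k, norm (a k) <= b k) ->
  is_series a l -> is_series b B -> norm l <= B.
Proof.
  intros H Ha Hb. apply le_epsilon. intros eps He.
  destruct (proj1 (is_series_eps a l) Ha eps He) as [N HN]. specialize (HN N (le_n N)).
  replace l with (minus (sum_n a N) (minus (sum_n a N) l)) by module.
  apply norm_minus_le; [|lra].
  eapply Rle_trans; [apply sum_n_norm_le; exact H|]. apply sum_n_le_series; [|easy].
  intros k. exact (Rle_trans _ _ _ (norm_ge_0 (a k)) (H k)).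
Qed.

Lemma series_term_small a l : is_series a l ->
  forall eps, 0 < eps -> exists N, forall n, (N <= n)%nat -> norm (a n) < eps.
Proof.
  intros H eps He.
  destruct (proj1 (is_series_eps a l) H (eps / 2) ltac:(lra)) as [N HN].
  exists (S N). intros [|n] Hn; [lia|].
  replace (a (S n)) with (minus (minus (sum_n a (S n)) l) (minus (sum_n a n) l))
    by (rewrite sum_Sn; module).
  pose proof (HN n ltac:(lia)). pose proof (HN (S n) ltac:(lia)).
  eapply Rle_lt_trans; [apply norm_minus_le; apply Rle_refl|]. lra.
Qed.

Lemma sum_n_pairs a n :
  sum_n (fun m => plus (a (2 * m)%nat) (a (S (2 * m)))) n = sum_n a (S (2 * n)).
Proof.
  induction n as [|n IH].
  - rewrite sum_O. simpl. now rewrite sum_Sn, sum_O.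
  - rewrite sum_Sn, IH. replace (2 * S n)%nat with (S (S (2 * n))) by lia.
    rewrite (sum_Sn a (S (S (2 * n)))), (sum_Sn a (S (2 * n))). module.
Qed.

Lemma is_series_pairs a l : is_series a l ->
  is_series (fun m => plus (a (2 * m)%nat) (a (S (2 * m)))) l.
Proof.
  rewrite !is_series_eps. intros H eps He. destruct (H eps He) as [N HN].
  exists N. intros n Hn. rewrite sum_n_pairs. apply HN. lia.
Qed.

(** A partial sum that ends at an even index differs from a paired one by a single term; this is why
    the terms have to tend to 0. *)
Lemma is_series_unpair a l :
  is_series (fun m => plus (a (2 * m)%nat) (a (S (2 * m)))) l ->
  (forall eps, 0 < eps -> exists N, forall n, (N <= n)%nat -> norm (a n) < eps) ->
  is_series a l.
Proof.
  rewrite !is_series_eps. intros H Ha eps He.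
  destruct (H (eps / 2) ltac:(lra)) as [N HN]. destruct (Ha (eps / 2) ltac:(lra)) as [N' HN'].
  exists (max (2 * N) N'). intros n Hn.
  pose proof (HN (Nat.div2 n)) as H1. rewrite sum_n_pairs in H1.
  destruct (even_or_odd_div2 n) as [[_ E]|[_ E]].
  - rewrite <- E, sum_Sn in H1.
    replace (minus (sum_n a n) l) with
      (minus (minus (plus (sum_n a n) (a (S n))) l) (a (S n))) by module.
    pose proof (H1 ltac:(lia)). pose proof (HN' (S n) ltac:(lia)).
    eapply Rle_lt_trans; [apply norm_minus_le; apply Rle_refl|]. lra.
  - rewrite <- E in H1. pose proof (H1 ltac:(lia)). lra.
Qed.

End Series.

Lemma is_series_geom_scal (c q : R) : 0 <= q < 1 -> is_series (fun n => c * q ^ n) (c / (1 - q)).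
Proof.
  intros Hq. apply (is_series_scal (K := R_AbsRing) (V := R_NormedModule) c (fun n => q ^ n)).
  apply is_series_geom. rewrite Rabs_pos_eq; lra.
Qed.

Lemma is_RInt_linear (V W : NormedModule R_AbsRing) (L : V -> W) (f : R -> V) a b l :
  is_linear L -> is_RInt f a b l -> is_RInt (fun t => L (f t)) a b (L l).
Proof.
  intros HL H. unfold is_RInt.
  apply filterlim_ext with (fun ptd => L (scal (sign (b - a)) (Riemann_sum f ptd))).
  - intros ptd. rewrite (linear_scal _ HL). f_equal.
    apply (SF_cons_ind (fun ptd => L (Riemann_sum f ptd) = Riemann_sum (fun t => L (f t)) ptd)).
    + intros x0. exact (linear_zero _ HL).
    + intros h s IH. rewrite !Riemann_sum_cons, (linear_plus _ HL), IH.
      now rewrite (linear_scal _ HL).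
  - eapply filterlim_comp; [exact H|]. now apply linear_cont.
Qed.

Section SeriesIntegral.
Variable V : CompleteNormedModule R_AbsRing.

Lemma is_RInt_sum_n (f : nat -> R -> V) a b (l : nat -> V) n :
  (forall k, is_RInt (f k) a b (l k)) ->
  is_RInt (fun t => sum_n (fun k => f k t) n) a b (sum_n l n).
Proof.
  intros H. induction n as [|n IH].
  - rewrite sum_O. apply is_RInt_ext with (f 0%nat); [|apply H].
    intros; now rewrite sum_O.
  - rewrite sum_Sn.
    apply is_RInt_ext with (fun t => plus (sum_n (fun k => f k t) n) (f (S n) t)).
    { intros; now rewrite sum_Sn. }
    now apply (is_RInt_plus (V := V)).
Qed.

Lemma is_RInt_series (f : nat -> R -> V) (F : R -> V) a b (l : nat -> V) (M : nat -> R) :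
  a <= b -> (forall k, is_RInt (f k) a b (l k)) ->
  (forall k t, a <= t <= b -> norm (f k t) <= M k) -> ex_series M ->
  (forall t, a <= t <= b -> is_series (fun k => f k t) (F t)) ->
  exists L, is_series l L /\ is_RInt F a b L.
Proof.
  intros Hab Hf HM [B HB] HF.
  (* [filterlim_RInt] asks for convergence that is uniform on the whole line; clamping t to [a, b]
     provides it. *)
  set (cl t := Rmax a (Rmin b t)).
  assert (Hcl : forall t, a <= cl t <= b).
  { intros t. unfold cl. split; [apply Rmax_l|]. apply Rmax_lub; [easy | apply Rmin_l]. }
  assert (Hcl' : forall t, Rmin a b < t < Rmax a b -> cl t = t).
  { intros t. rewrite Rmin_left, Rmax_right by easy. intros Ht.
    unfold cl. rewrite Rmin_right, Rmax_right by lra. easy. }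
  destruct (filterlim_RInt (fun n t => sum_n (fun k => f k (cl t)) n) a b eventually
    _ (fun t => F (cl t)) (sum_n l)) as [L [H1 H2]].
  - intros n. apply is_RInt_ext with (fun t => sum_n (fun k => f k t) n).
    + intros t Ht. now rewrite Hcl'.
    + now apply is_RInt_sum_n.
  - apply filterlim_locally. intros eps.
    destruct (proj1 (is_series_eps R_NormedModule M B) HB eps (cond_pos eps)) as [N HN].
    exists N. intros n Hn t. apply (norm_compat1 (V := V)).
    eapply Rle_lt_trans; [right; apply (norm_minus_sym V)|]. eapply Rle_lt_trans.
    + apply (series_tail V _ M _ B); [|now apply HF | exact HB].
      intros k. apply HM, Hcl.
    + specialize (HN n Hn). change (Rabs (sum_n M n - B) < eps) in HN.
      apply Rabs_def2 in HN. lra.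
  - exists L. split; [exact H1|].
    apply is_RInt_ext with (fun t => F (cl t)); [|exact H2].
    intros t Ht. now rewrite Hcl'.
Qed.

End SeriesIntegral.

(** * Integrals on the circle and the bound on the coefficients *)

Lemma norm_C (z : C_R_NormedModule) : norm z = Cmod z.
Proof.
  unfold norm; simpl. unfold prod_norm, Cmod, norm; simpl. unfold abs; simpl.
  f_equal. f_equal; rewrite Rmult_1_r, <- Rabs_mult, Rabs_pos_eq by nra; ring.
Qed.

Lemma Csqrt_exists (c : C) : exists h, (h * h)%C = c.
Proof.
  destruct c as [x y].
  set (m := Cmod (x, y)).
  assert (Hm : m * m = x * x + y * y).
  { unfold m, Cmod; simpl. rewrite sqrt_sqrt; nra. }
  assert (Hm0 : 0 <= m) by apply Cmod_ge_0.
  assert (Hx : - m <= x <= m) by (split; nra).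
  set (a := sqrt ((m + x) / 2)). set (b := sqrt ((m - x) / 2)).
  assert (Ha : a * a = (m + x) / 2) by (apply sqrt_sqrt; lra).
  assert (Hb : b * b = (m - x) / 2) by (apply sqrt_sqrt; lra).
  assert (Ha0 : 0 <= a) by apply sqrt_pos. assert (Hb0 : 0 <= b) by apply sqrt_pos.
  assert (Hab : 2 * (a * b) = Rabs y).
  { apply Rsqr_inj; [nra | apply Rabs_pos |]. rewrite <- Rsqr_abs. unfold Rsqr.
    replace (2 * (a * b) * (2 * (a * b))) with (4 * (a * a) * (b * b)) by ring.
    rewrite Ha, Hb. nra. }
  destruct (Rle_dec 0 y) as [Hy|Hy].
  - exists (a, b). apply injective_projections; simpl.
    + lra.
    + rewrite Rabs_pos_eq in Hab by easy. lra.
  - exists (a, - b). apply injective_projections; simpl.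
    + lra.
    + rewrite Rabs_left in Hab by lra.
      replace (a * - b + - b * a) with (- (2 * (a * b))) by ring. lra.
Qed.

(** An arbitrary root, with no continuity in c. It is used together with its opposite, so that the
    choice makes no difference. *)
Definition Csqrt (c : C) : C := epsilon (inhabits (RtoC 0)) (fun h => (h * h)%C = c).

Lemma Csqrt_mul c : (Csqrt c * Csqrt c)%C = c.
Proof. exact (epsilon_spec (inhabits (RtoC 0)) _ (Csqrt_exists c)). Qed.

Lemma is_RInt_val (V : NormedModule R_AbsRing) (f : R -> V) a b l l' :
  is_RInt f a b l -> l = l' -> is_RInt f a b l'.
Proof. now intros H <-. Qed.

Definition cis (t : R) : C := (cos t, sin t).

Lemma Cmod_cis t : Cmod (cis t) = 1.
Proof.
  unfold Cmod, cis; simpl. transitivity (sqrt 1); [f_equal | apply sqrt_1].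
  generalize (sin2_cos2 t). unfold Rsqr. lra.
Qed.

Lemma cis_plus a b : cis (a + b) = (cis a * cis b)%C.
Proof.
  unfold cis. rewrite cos_plus, sin_plus. apply injective_projections; simpl; ring.
Qed.

Lemma cis_INR n t : cis (INR n * t) = (cis t ^ n)%C.
Proof.
  induction n as [|n IH].
  - rewrite Rmult_0_l. unfold cis. rewrite cos_0, sin_0. easy.
  - rewrite S_INR, Rmult_plus_distr_r, Rmult_1_l, cis_plus, IH, Cpow_S. ring.
Qed.

Lemma cis_2PI n : cis (INR n * (2 * PI)) = RtoC 1.
Proof.
  unfold cis. replace (INR n * (2 * PI)) with (0 + 2 * INR n * PI) by ring.
  now rewrite cos_period, sin_period, cos_0, sin_0.
Qed.

Lemma cis_2PI_diff n m : cis ((INR n - INR m) * (2 * PI)) = RtoC 1.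
Proof.
  assert (H : (cis ((INR n - INR m) * (2 * PI)) * RtoC 1)%C = RtoC 1).
  { rewrite <- (cis_2PI m) at 1. rewrite <- cis_plus, <- (cis_2PI n). f_equal. ring. }
  now rewrite Cmult_1_r in H.
Qed.

Lemma is_RInt_cis (n m : nat) :
  is_RInt (V := C_R_NormedModule) (fun t => cis ((INR n - INR m) * t)) 0 (2 * PI)
    (if Nat.eqb n m then RtoC (2 * PI) else RtoC 0).
Proof.
  destruct (Nat.eqb_spec n m) as [->|Hnm].
  - apply (is_RInt_ext (V := C_R_NormedModule)) with (fun _ => RtoC 1).
    { intros t _. rewrite Rminus_diag, Rmult_0_l. unfold cis. now rewrite cos_0, sin_0. }
    replace (RtoC (2 * PI)) with (scal (2 * PI - 0) (RtoC 1 : C_R_NormedModule)).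
    + apply (is_RInt_const (V := C_R_NormedModule)).
    + apply injective_projections; unfold scal; simpl; unfold scal; simpl; unfold mult; simpl; ring.
  - set (k := INR n - INR m).
    assert (Hk : k <> 0) by (unfold k; intros H; apply Hnm, INR_eq; lra).
    assert (H1 : cis (k * (2 * PI)) = RtoC 1) by apply cis_2PI_diff.
    injection H1 as Hc Hs.
    apply (is_RInt_fct_extend_pair (U := R_NormedModule) (V := R_NormedModule)); simpl.
    + eapply is_RInt_val.
      * apply (is_RInt_derive (fun t => sin (k * t) / k)).
        -- intros t _. auto_derive; [easy|]. field. easy.
        -- intros t _. apply continuity_pt_filterlim, derivable_continuous_pt.
           apply ex_derive_Reals_0. now auto_derive.
      * rewrite Hs, Rmult_0_r, sin_0. unfold minus, plus, opp; simpl. field. easy.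
    + eapply is_RInt_val.
      * apply (is_RInt_derive (fun t => - cos (k * t) / k)).
        -- intros t _. auto_derive; [easy|]. field. easy.
        -- intros t _. apply continuity_pt_filterlim, derivable_continuous_pt.
           apply ex_derive_Reals_0. now auto_derive.
      * rewrite Hc, Rmult_0_r, cos_0. unfold minus, plus, opp; simpl. field. easy.
Qed.

(** A crude form of Jordan's inequality, read off from the Taylor minorant of degree 7. *)
Lemma sin_ge_third x : 0 <= x <= PI / 2 -> x / 3 <= sin x.
Proof.
  intros [H1 H2]. assert (Hpi := PI_4).
  destruct (SIN x H1 ltac:(lra)) as [H _]. eapply Rle_trans; [|exact H].
  unfold sin_lb, sin_approx, sin_term; simpl.
  replace (-1 * (-1 * (-1 * 1))) with (-1) by ring.
  (* The factor 2/3 - x^2/6 below vanishes at x = 2, so the bound PI <= 4 is just enough. *)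
  assert (Hx : x <= 2) by lra.
  apply Rminus_le_0.
  replace (_ - _) with (x * (2 / 3 - x * x / 6) + x ^ 5 * (42 - x * x) / 5040) by (simpl; field).
  assert (0 <= x ^ 5) by now apply pow_le.
  apply Rplus_le_le_0_compat; [nra|].
  apply Rmult_le_pos; [apply Rmult_le_pos; [easy | nra] | lra].
Qed.

(* Up to constants, a majorant of 1/|h| where h^2 = t - (Im w)^2 and t runs over
   a circle; [k > 0] keeps it smooth. *)
Definition sin_weight (k t : R) : R := / sqrt (sqrt (sin t ^ 2 + k ^ 2)).

Lemma sin_weight_derive k t : 0 < k -> ex_derive (sin_weight k) t.
Proof.
  intros Hk. unfold sin_weight.
  assert (0 < sin t ^ 2 + k ^ 2) by (assert (0 <= sin t ^ 2) by apply pow2_ge_0; nra).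
  assert (0 < sqrt (sin t ^ 2 + k ^ 2)) by now apply sqrt_lt_R0.
  assert (0 < sqrt (sqrt (sin t ^ 2 + k ^ 2))) by now apply sqrt_lt_R0.
  auto_derive. simpl in *. repeat split; lra.
Qed.

Lemma sin_weight_le k t : 0 < k -> sin t <> 0 -> sin_weight k t <= / sqrt (Rabs (sin t)).
Proof.
  intros Hk Ht. unfold sin_weight. assert (0 < Rabs (sin t)) by now apply Rabs_pos_lt.
  apply Rinv_le_contravar; [now apply sqrt_lt_R0|]. apply sqrt_le_1_alt.
  rewrite <- sqrt_Rsqr_abs. apply sqrt_le_1_alt. unfold Rsqr. nra.
Qed.

Lemma sin_weight_ge k t : 0 < k ->
  / sqrt (Rmax (Rabs (sin t)) k) <= 2 * sin_weight k t.
Proof.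
  intros Hk. unfold sin_weight. set (m := Rmax (Rabs (sin t)) k).
  assert (Hm1 : Rabs (sin t) <= m) by apply Rmax_l. assert (Hm2 : k <= m) by apply Rmax_r.
  assert (H0 : 0 <= Rabs (sin t)) by apply Rabs_pos.
  assert (Hs : sin t ^ 2 = Rabs (sin t) ^ 2) by (now rewrite pow2_abs).
  assert (Hd : 0 < sin t ^ 2 + k ^ 2) by (rewrite Hs; nra).
  replace 2 with (/ / 2) by field. rewrite <- Rinv_mult. apply Rinv_le_contravar.
  - apply Rmult_lt_0_compat; [lra|]. now apply sqrt_lt_R0, sqrt_lt_R0.
  - apply Rle_trans with (/ 2 * sqrt (4 * m)).
    + apply Rmult_le_compat_l; [lra|]. apply sqrt_le_1_alt.
      rewrite <- (sqrt_Rsqr (4 * m)) by lra. apply sqrt_le_1_alt. rewrite Hs.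
      unfold Rsqr. nra.
    + rewrite sqrt_mult by lra. replace (sqrt 4) with 2; [lra|].
      replace 4 with (2 * 2) by ring. now rewrite sqrt_square by lra.
Qed.

(** Inside a half period the weight is at most 2/sqrt (x - a) + 2/sqrt (a + PI - x), whose primitive
    increases by 8 sqrt PI. As this majorant is unbounded at the ends, it is not integrated: the
    mean value theorem is applied to the difference of the primitives. *)
Lemma sin_weight_half_period a k : 0 < k -> (forall x, sin x ^ 2 = sin (x - a) ^ 2) ->
  RInt (sin_weight k) a (a + PI) <= 8 * sqrt PI.
Proof.
  intros Hk Ha. assert (Hpi := PI_RGT_0).
  assert (Hcont : forall t, continuous (sin_weight k) t).
  { intros t. now apply (ex_derive_continuous (V := R_NormedModule)), sin_weight_derive. }
  set (Q x := RInt (sin_weight k) a x).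
  assert (HQ : forall x, is_derive Q x (sin_weight k x)).
  { intros x. apply (is_derive_RInt (V := R_NormedModule) (sin_weight k) Q a); [|apply Hcont].
    exists (mkposreal 1 Rlt_0_1). intros y _. apply (RInt_correct (V := R_CompleteNormedModule)).
    apply (ex_RInt_continuous (V := R_CompleteNormedModule)). intros; apply Hcont. }
  assert (Hinv : forall u v, 0 < u -> u / 3 <= v -> / sqrt v <= 2 / sqrt u).
  { intros u v Hu Hv. assert (0 < sqrt u) by now apply sqrt_lt_R0.
    replace (2 / sqrt u) with (/ (sqrt u / 2)) by (field; lra).
    apply Rinv_le_contravar; [lra|]. apply Rle_trans with (sqrt (u / 4)).
    - rewrite sqrt_div by lra. replace 4 with (2 * 2) by ring. rewrite sqrt_square; lra.
    - apply sqrt_le_1_alt. lra. }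
  assert (Hle : forall x, a < x < a + PI ->
    sin_weight k x <= 2 / sqrt (x - a) + 2 / sqrt (a + PI - x)).
  { intros x Hx. assert (Hs : 0 < sin (x - a)) by (apply sin_gt_0; lra).
    assert (Habs : Rabs (sin x) = sin (x - a)).
    { rewrite <- (Rabs_pos_eq (sin (x - a))) by lra. apply Rsqr_eq_abs_0.
      generalize (Ha x). rewrite <- !Rsqr_pow2. easy. }
    apply Rle_trans with (/ sqrt (Rabs (sin x))).
    { apply sin_weight_le; [easy|]. intros H0. rewrite H0, Rabs_R0 in Habs. lra. }
    rewrite Habs.
    assert (0 < 2 / sqrt (x - a)) by (apply Rdiv_lt_0_compat; [lra|apply sqrt_lt_R0; lra]).
    assert (0 < 2 / sqrt (a + PI - x)) by (apply Rdiv_lt_0_compat; [lra|apply sqrt_lt_R0; lra]).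
    destruct (Rle_dec (x - a) (PI / 2)).
    - assert (H1 := sin_ge_third (x - a) ltac:(lra)). apply Hinv in H1; lra.
    - assert (H1 := sin_ge_third (a + PI - x) ltac:(lra)).
      replace (sin (a + PI - x)) with (sin (x - a)) in H1.
      2:{ rewrite <- (sin_PI_x (x - a)). f_equal. ring. }
      apply Hinv in H1; lra. }
  destruct (MVT_gen (fun x => Q x - (4 * sqrt (x - a) - 4 * sqrt (a + PI - x))) a (a + PI)
    (fun x => Rmin 0 (sin_weight k x - (2 / sqrt (x - a) + 2 / sqrt (a + PI - x)))))
    as (c & Hc & E).
  - rewrite Rmin_left, Rmax_right by lra. intros x Hx.
    assert (0 < sqrt (x - a)) by (apply sqrt_lt_R0; lra).
    assert (0 < sqrt (a + PI - x)) by (apply sqrt_lt_R0; lra).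
    rewrite Rmin_right by (generalize (Hle x Hx); lra).
    apply (is_derive_minus (V := R_NormedModule)); [apply HQ|].
    auto_derive; [lra|]. change (x + - a) with (x - a).
    change (a + PI + - x) with (a + PI - x). field. lra.
  - rewrite Rmin_left, Rmax_right by lra. intros x Hx.
    apply continuity_pt_minus.
    + apply derivable_continuous_pt. exists (sin_weight k x). now apply is_derive_Reals.
    + apply continuity_pt_minus; apply continuity_pt_mult;
        try (apply continuity_pt_const; now intros ? ?);
        apply (continuity_pt_comp (fun x => _) sqrt);
        try (apply continuity_pt_sqrt; lra).
      * apply derivable_continuous_pt. apply ex_derive_Reals_0. now auto_derive.
      * apply derivable_continuous_pt. apply ex_derive_Reals_0. now auto_derive.
  - rewrite Rmin_left, Rmax_right in Hc by lra.
    assert (HPI : sqrt (a + PI - a) = sqrt PI) by (f_equal; ring).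
    replace (a + PI - (a + PI)) with 0 in E by ring.
    replace (a - a) with 0 in E by ring.
    rewrite HPI, sqrt_0 in E.
    replace (a + PI - a) with PI in E by ring.
    assert (HQa : Q a = 0) by apply (RInt_point (V := R_CompleteNormedModule)).
    rewrite HQa in E. fold (Q (a + PI)).
    match type of E with _ = ?m * _ => assert (Hm : m <= 0) by apply Rmin_l end.
    assert (H0 : Rmin 0 (sin_weight k c - (2 / sqrt (c - a) + 2 / sqrt (a + PI - c))) * PI <= 0)
      by nra.
    change (RInt (sin_weight k) a (a + PI)) with (Q (a + PI)). lra.
Qed.

Lemma sin_weight_integral k : 0 < k ->
  exists H, is_RInt (sin_weight k) 0 (2 * PI) H /\ H <= 32.
Proof.
  intros Hk.
  assert (Hcont : forall t, continuous (sin_weight k) t).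
  { intros t. now apply (ex_derive_continuous (V := R_NormedModule)), sin_weight_derive. }
  assert (Hex : forall a b, ex_RInt (sin_weight k) a b).
  { intros a b. apply (ex_RInt_continuous (V := R_CompleteNormedModule)).
    intros; apply Hcont. }
  exists (RInt (sin_weight k) 0 (2 * PI)). split.
  { now apply (RInt_correct (V := R_CompleteNormedModule)). }
  rewrite <- (RInt_Chasles (V := R_CompleteNormedModule) _ 0 PI) by easy.
  assert (H1 := sin_weight_half_period 0 k Hk ltac:(intros; now rewrite Rminus_0_r)).
  assert (H2 : RInt (sin_weight k) PI (PI + PI) <= 8 * sqrt PI).
  { apply sin_weight_half_period; [easy|]. intros x.
    replace x with ((x - PI) + PI) at 1 by ring. rewrite neg_sin. ring. }
  rewrite Rplus_0_l in H1. replace (2 * PI) with (PI + PI) by ring.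
  (* Each half period contributes at most 8 sqrt PI <= 16, whence 32. *)
  assert (sqrt PI <= 2).
  { replace 2 with (sqrt (2 * 2)) by (apply sqrt_square; lra).
    apply sqrt_le_1_alt. generalize PI_4. lra. }
  unfold plus; simpl. lra.
Qed.

Lemma amul_linear_r (A : alt_star_algebra) (x : A) : is_linear (fun y : A => x ** y).
Proof.
  split.
  - intros; apply amul_plus_r.
  - intros; apply amul_scal_r.
  - destruct (product_bounded A) as (M & HM & Hb).
    exists (M * norm x + 1). assert (0 <= M * norm x).
    { apply Rmult_le_pos; [lra | apply norm_ge_0]. }
    split; [lra|]. intros y. eapply Rle_trans; [apply Hb|].
    generalize (norm_ge_0 y). nra.
Qed.

Lemma inC_act_linear (A : alt_star_algebra) (J x : A) :
  is_linear (U := C_R_NormedModule) (fun z => inC J z ** x).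
Proof.
  split.
  - intros u v. rewrite !inC_act.
    change (Re (plus u v)) with (Re u + Re v). change (Im (plus u v)) with (Im u + Im v).
    module.
  - intros k u. rewrite !inC_act.
    change (Re (scal k u)) with (k * Re u). change (Im (scal k u)) with (k * Im u). module.
  - exists (norm x + norm (J ** x) + 1). assert (H1 := norm_ge_0 x). assert (H2 := norm_ge_0 (J ** x)).
    split; [lra|]. intros a. rewrite inC_act, norm_C.
    assert (Ha := Rmax_Cmod a). assert (H3 := Rmax_l (Rabs (fst a)) (Rabs (snd a))).
    assert (H4 := Rmax_r (Rabs (fst a)) (Rabs (snd a))).
    eapply Rle_trans; [apply norm_triangle_le; apply norm_scal_le|]. unfold Re, Im.
    generalize (Rabs_pos (fst a)) (Rabs_pos (snd a)). nra.
Qed.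

Lemma lemn_shift w z : lemn w z = ((z - RtoC (Re w)) * (z - RtoC (Re w)) + RtoC (Im w ^ 2))%C.
Proof. unfold lemn. apply injective_projections; simpl; unfold Re, Im; ring. Qed.

(** * Coefficient bounds from Fourier series on the circle *)

Section CoefficientBound.
Variable A : alt_star_algebra.
Hypothesis hnorm : norm_compatible A.
Variable M : R.
Hypothesis HM1 : 1 <= M.
Hypothesis HM : forall x y : A, norm (x ** y) <= M * norm x * norm y.

Lemma norm_act (J : A) z x : imag_sphere J -> norm (inC J z ** x) <= M * Cmod z * norm x.
Proof. intros HJ. rewrite <- (norm_inC A hnorm J) by easy. apply HM. Qed.

(** Multiplying by the conjugate of [cis t ^ m] and integrating isolates the m-th Fourier
    coefficient. The majorant h may vary with t, as needed for the odd part, which has no good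
    uniform bound. *)
Lemma circle_coef_bound (J : A) (c : nat -> A) (b : nat -> R) (f : R -> A) (h : R -> R) H m :
  imag_sphere J -> (forall k, norm (c k) <= b k) -> ex_series b ->
  (forall t, is_series (fun k => inC J (cis t ^ k)%C ** c k) (f t)) ->
  (forall t, norm (f t) <= h t) -> is_RInt h 0 (2 * PI) H ->
  2 * PI * norm (c m) <= M * H.
Proof.
  intros HJ Hc [B HB] Hf Hh HH. assert (Hpi := PI_RGT_0).
  set (e t := Cconj (cis t ^ m)%C).
  assert (He : forall t, Cmod (e t) = 1).
  { intros t. unfold e. now rewrite Cmod_conj, Cmod_pow, Cmod_cis, pow1. }
  assert (Hek : forall t k, (e t * cis t ^ k)%C = cis ((INR k - INR m) * t)).
  { intros t k. replace ((INR k - INR m) * t) with (INR k * t + - (INR m * t)) by ring.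
    rewrite cis_plus, cis_INR. unfold e. rewrite <- cis_INR.
    replace (cis (- (INR m * t))) with (Cconj (cis (INR m * t))); [ring|].
    unfold cis. now rewrite cos_neg, sin_neg. }
  destruct (is_RInt_series A (fun k t => inC J (cis ((INR k - INR m) * t)) ** c k)
    (fun t => inC J (e t) ** f t) 0 (2 * PI)
    (fun k => inC J (if Nat.eqb k m then RtoC (2 * PI) else RtoC 0) ** c k)
    (fun k => M * b k)) as [L [HL1 HL2]].
  - lra.
  - intros k. apply (is_RInt_linear C_R_NormedModule A (fun z => inC J z ** c k)).
    + apply inC_act_linear.
    + apply is_RInt_cis.
  - intros k t _. eapply Rle_trans; [now apply norm_act|].
    rewrite Cmod_cis, Rmult_1_r. apply Rmult_le_compat_l; [lra | apply Hc].
  - exists (M * B). now apply (is_series_scal (K := R_AbsRing) (V := R_NormedModule)).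
  - intros t _. apply is_series_ext with (fun k => inC J (e t) ** (inC J (cis t ^ k)%C ** c k)).
    { intros k. rewrite inC_mul_act by easy. now rewrite Hek. }
    apply (is_series_linear A A (fun y => inC J (e t) ** y)); [apply amul_linear_r | apply Hf].
  - assert (E : L = scal (2 * PI) (c m)).
    { apply (is_series_unique_V A _ _ _ HL1). apply is_series_eps. intros eps Heps.
      exists m. intros n Hn.
      assert (E : sum_n (fun k => inC J (if Nat.eqb k m then RtoC (2 * PI) else RtoC 0) ** c k) n
        = scal (2 * PI) (c m)).
      { assert (E0 : forall n, (n < m)%nat ->
          sum_n (fun k => inC J (if Nat.eqb k m then RtoC (2 * PI) else RtoC 0) ** c k) n = zero).
        { intros n0. induction n0 as [|n0 IH]; intros H0.
          - rewrite sum_O. destruct (Nat.eqb_spec 0 m); [lia|].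
            now rewrite inC_zero, amul_zero_l.
          - rewrite sum_Sn, IH by lia. destruct (Nat.eqb_spec (S n0) m); [lia|].
            rewrite inC_zero, amul_zero_l. module. }
        induction Hn as [|n Hn IH].
        - destruct m as [|m'].
          + rewrite sum_O, Nat.eqb_refl, inC_RtoC, areal_mul_l. easy.
          + rewrite sum_Sn, E0 by lia. rewrite Nat.eqb_refl, inC_RtoC, areal_mul_l. module.
        - rewrite sum_Sn, IH. destruct (Nat.eqb_spec (S n) m); [lia|].
          rewrite inC_zero, amul_zero_l. module. }
      eapply Rle_lt_trans; [right; exact (f_equal (fun v => norm (minus v (scal (2 * PI) (c m)))) E)|].
      eapply Rle_lt_trans; [right | exact Heps].
      transitivity (norm (zero : A)); [f_equal; module | exact norm_zero]. }
    assert (Hn : norm L <= M * H).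
    { apply (norm_RInt_le (V := A) (fun t => inC J (e t) ** f t) (fun t => M * h t) 0 (2 * PI)).
      - lra.
      - intros t _. eapply Rle_trans; [now apply norm_act|].
        rewrite He, Rmult_1_r. apply Rmult_le_compat_l; [lra | apply Hh].
      - exact HL2.
      - now apply (is_RInt_scal (V := R_NormedModule)). }
    rewrite E in Hn. eapply Rle_trans; [|exact Hn].
    apply Rmult_le_reg_l with (/ (2 * PI)).
    { apply Rinv_0_lt_compat; lra. }
    rewrite <- Rmult_assoc, Rinv_l, Rmult_1_l by lra.
    replace (c m) with (scal (/ (2 * PI)) (scal (2 * PI) (c m))) at 1 by (module; field; lra).
    eapply Rle_trans; [apply norm_scal_le|].
    rewrite Rabs_pos_eq; [lra|]. left. apply Rinv_0_lt_compat; lra.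
Qed.

Lemma scal_inC_act (J : A) (a : R) z (x : A) :
  inC J (RtoC a * z)%C ** x = inC J z ** scal a x.
Proof. rewrite inC_scal, amul_scal_l, amul_scal_r. reflexivity. Qed.

(** Coefficients of even index cost M + 128 M^3: M for the even part, 128 M^2 for |Im w| times the
    odd part, and one factor M for the product with xi - w. Those of odd index cost 64 M^2. *)
Definition coef_cst : R := M + 128 * M ^ 2 * (1 + M).

(* Writing t = lemn w z, the two preimages of t are Re w +- h with
   h^2 = t - (Im w)^2, and the series splits as sum t^k (u_k +- h v_k).  The
   even part is bounded by S and the odd part by S / |h|, which is integrable
   on the circle |t| = r^2 uniformly in w. *)
Lemma coef_bound (J : A) w (s : nat -> A) (g : C -> A) r R1 B S :
  imag_sphere J -> 0 < r < R1 -> (forall n, norm (s n) <= B / R1 ^ n) -> 0 < S ->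
  (forall z, Cmod (lemn w z) = r ^ 2 ->
     is_series (fun n => inC J (newton w n z) ** s n) (g z) /\ norm (g z) <= S) ->
  forall n, norm (s n) <= coef_cst * S / r ^ n.
Proof.
  intros HJ Hr Hs HS Hg. assert (Hpi := PI_RGT_0).
  set (eta := Im w). set (xi := RtoC (Re w)).
  set (v k := s (Datatypes.S (2 * k))).
  (* Recentring at the real point xi: s_(2k) + (z - w) s_(2k+1) = u_k + (z - xi) v_k, and z - xi is
     one of the two roots +- h. *)
  set (u k := plus (s (2 * k)%nat) (inC J (xi - w)%C ** v k)).
  set (c k := scal ((r ^ 2) ^ k) (u k)). set (d k := scal ((r ^ 2) ^ k) (v k)).
  assert (HB : 0 <= B).
  { specialize (Hs 0%nat). simpl in Hs. generalize (norm_ge_0 (s 0%nat)). lra. }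
  assert (Hxw : Cmod (xi - w)%C = Rabs eta).
  { unfold xi, eta. replace (RtoC (Re w) - w)%C with (RtoC (- Im w) * Ci)%C
      by (apply injective_projections; simpl; unfold Re, Im; ring).
    rewrite Cmod_mult, Cmod_Ci, Cmod_R, Rabs_Ropp. ring. }
  set (q := (r / R1) ^ 2).
  assert (Hq0 : 0 <= r / R1 < 1).
  { split; [apply Rdiv_le_0_compat; lra|]. apply Rlt_div_l; lra. }
  assert (Hq : 0 <= q < 1) by (unfold q; nra).
  assert (Hr2 : forall k, 0 < (r ^ 2) ^ k) by (intros; now apply pow_lt, pow_lt).
  assert (Hqk : forall k, (r ^ 2) ^ k / R1 ^ (2 * k) = q ^ k).
  { intros k. unfold q. rewrite <- !pow_mult. unfold Rdiv. rewrite Rpow_mult_distr, pow_inv.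
    easy. }
  assert (Hd : forall k, norm (d k) <= B / R1 * q ^ k).
  { intros k. unfold d. eapply Rle_trans; [apply norm_scal_le|].
    rewrite Rabs_pos_eq by (left; apply Hr2).
    apply Rle_trans with ((r ^ 2) ^ k * (B / R1 ^ (Datatypes.S (2 * k)))).
    - apply Rmult_le_compat_l; [left; apply Hr2 | apply Hs].
    - right. rewrite <- Hqk.
      change (R1 ^ Datatypes.S (2 * k)) with (R1 * R1 ^ (2 * k)).
      generalize ((r ^ 2) ^ k). intros p. field.
      split; [apply pow_nonzero; lra | lra]. }
  assert (Hc : forall k, norm (c k) <= (B + M * Rabs eta * (B / R1)) * q ^ k).
  { intros k. unfold c, u.
    replace (scal ((r ^ 2) ^ k) (plus (s (2 * k)%nat) (inC J (xi - w)%C ** v k))) with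
      (plus (scal ((r ^ 2) ^ k) (s (2 * k)%nat)) (inC J (xi - w)%C ** d k))
      by (unfold d; rewrite amul_scal_r; module).
    rewrite Rmult_plus_distr_r. apply norm_triangle_le.
    - eapply Rle_trans; [apply norm_scal_le|]. rewrite Rabs_pos_eq by (left; apply Hr2).
      apply Rle_trans with ((r ^ 2) ^ k * (B / R1 ^ (2 * k))).
      + apply Rmult_le_compat_l; [left; apply Hr2 | apply Hs].
      + right. rewrite <- Hqk. generalize ((r ^ 2) ^ k). intros p. field. apply pow_nonzero; lra.
    - eapply Rle_trans; [now apply norm_act|]. rewrite Hxw.
      rewrite !Rmult_assoc. apply Rmult_le_compat_l; [lra|].
      apply Rmult_le_compat_l; [apply Rabs_pos|]. apply Hd. }
  set (t a := (RtoC (r ^ 2) * cis a)%C).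
  set (h a := Csqrt (t a - RtoC (eta ^ 2))%C).
  assert (Hh : forall a, (h a * h a)%C = (t a - RtoC (eta ^ 2))%C) by (intros; apply Csqrt_mul).
  assert (Ht : forall a, Cmod (t a) = r ^ 2).
  { intros a. unfold t. rewrite Cmod_mult, Cmod_cis, Cmod_R, Rabs_pos_eq by nra. ring. }
  assert (Hlp : forall a, lemn w (xi + h a)%C = t a).
  { intros a. rewrite lemn_shift. fold xi eta.
    replace (xi + h a - xi)%C with (h a) by ring. rewrite Hh. ring. }
  assert (Hlm : forall a, lemn w (xi - h a)%C = t a).
  { intros a. rewrite lemn_shift. fold xi eta.
    replace ((xi - h a - xi) * (xi - h a - xi))%C with (h a * h a)%C by ring. rewrite Hh. ring. }
  assert (Hgp : forall a, norm (g (xi + h a)%C) <= S) by (intros; apply Hg; now rewrite Hlp).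
  assert (Hgm : forall a, norm (g (xi - h a)%C) <= S) by (intros; apply Hg; now rewrite Hlm).
  assert (Hpair : forall a z k, lemn w z = t a ->
    plus (inC J (newton w (2 * k) z) ** s (2 * k)%nat)
         (inC J (newton w (Datatypes.S (2 * k)) z) ** s (Datatypes.S (2 * k))) =
    plus (inC J (cis a ^ k)%C ** c k) (inC J (z - xi)%C ** (inC J (cis a ^ k)%C ** d k))).
  { intros a z k Hz. rewrite newton_even, newton_odd, Hz. fold (v k).
    unfold c, d, u. rewrite <- !scal_inC_act.
    rewrite !inC_mul_act, amul_plus_r, inC_mul_act by easy.
    replace (t a ^ k)%C with (RtoC ((r ^ 2) ^ k) * cis a ^ k)%C
      by (unfold t; rewrite Cpow_mult_l, <- RtoC_pow; easy).
    set (T := (RtoC ((r ^ 2) ^ k) * cis a ^ k)%C).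
    replace (T * (z - w))%C with (T * (xi - w) + (z - xi) * T)%C by ring.
    rewrite inC_plus, amul_plus_l. module. }
  set (gp a := g (xi + h a)%C). set (gm a := g (xi - h a)%C).
  assert (Hsp : forall a, is_series (fun k => plus (inC J (cis a ^ k)%C ** c k)
      (inC J (h a) ** (inC J (cis a ^ k)%C ** d k))) (gp a)).
  { intros a. destruct (Hg (xi + h a)%C ltac:(now rewrite Hlp)) as [H1 _].
    apply is_series_pairs in H1. revert H1. apply is_series_ext. intros k.
    rewrite (Hpair a) by easy. do 3 f_equal. ring. }
  assert (Hsm : forall a, is_series (fun k => minus (inC J (cis a ^ k)%C ** c k)
      (inC J (h a) ** (inC J (cis a ^ k)%C ** d k))) (gm a)).
  { intros a. destruct (Hg (xi - h a)%C ltac:(now rewrite Hlm)) as [H1 _].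
    apply is_series_pairs in H1. revert H1. apply is_series_ext. intros k.
    rewrite (Hpair a) by easy. replace (xi - h a - xi)%C with (- h a)%C by ring.
    rewrite inC_opp, amul_opp_l. easy. }
  assert (HE : forall a, is_series (fun k => inC J (cis a ^ k)%C ** c k)
      (scal (/ 2) (plus (gp a) (gm a)))).
  { intros a. assert (H1 := is_series_plus _ _ _ _ (Hsp a) (Hsm a)).
    apply (is_series_scal (/ 2)) in H1. revert H1. apply is_series_ext. intros k.
    module. field. }
  assert (HO : forall a, is_series (fun k => inC J (h a) ** (inC J (cis a ^ k)%C ** d k))
      (scal (/ 2) (minus (gp a) (gm a)))).
  { intros a. assert (H1 := is_series_minus _ _ _ _ (Hsp a) (Hsm a)).
    apply (is_series_scal (/ 2)) in H1. revert H1. apply is_series_ext. intros k.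
    module; field. }
  assert (Hhalf : forall x y : A, norm x <= S -> norm y <= S ->
    norm (scal (/ 2) (plus x y)) <= S /\ norm (scal (/ 2) (minus x y)) <= S).
  { intros x y Hx Hy. split; (eapply Rle_trans; [apply norm_scal_le|]);
    rewrite Rabs_pos_eq by lra;
    [assert (norm (plus x y) <= S + S) by now apply norm_triangle_le
    |assert (norm (minus x y) <= S + S) by now apply norm_minus_le]; lra. }
  assert (Hcm : forall m, norm (c m) <= M * S).
  { intros m.
    assert (H1 := circle_coef_bound J c (fun k => (B + M * Rabs eta * (B / R1)) * q ^ k)
      _ (fun _ => S) (scal (2 * PI - 0) S) m HJ Hc (ex_intro _ _ (is_series_geom_scal _ q Hq)) HE
      (fun a => proj1 (Hhalf _ _ (Hgp a) (Hgm a))) (is_RInt_const (V := R_NormedModule) _ _ _)).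
    unfold scal in H1; simpl in H1. unfold mult in H1; simpl in H1. nra. }
  assert (Hdq : forall a k, norm (inC J (cis a ^ k)%C ** d k) <= M * (B / R1) * q ^ k).
  { intros a k. eapply Rle_trans; [now apply norm_act|].
    rewrite Cmod_pow, Cmod_cis, pow1, Rmult_1_r, Rmult_assoc.
    apply Rmult_le_compat_l; [lra | apply Hd]. }
  assert (HexO : forall a, exists o : A, is_series (fun k => inC J (cis a ^ k)%C ** d k) o).
  { intros a. apply (ex_series_le (V := A) _ (fun k => M * (B / R1) * q ^ k)).
    - apply Hdq.
    - eexists. now apply is_series_geom_scal. }
  (* [O a] stands for the odd part divided by [h a]. It is defined by its series and not as a
     quotient, so that it makes sense where [h a] = 0. *)
  set (O a := proj1_sig (constructive_indefinite_description _ (HexO a))).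
  assert (HOs : forall a, is_series (fun k => inC J (cis a ^ k)%C ** d k) (O a)).
  { intros a. unfold O. now destruct (constructive_indefinite_description _ (HexO a)). }
  assert (HOh : forall a, inC J (h a) ** O a = scal (/ 2) (minus (gp a) (gm a))).
  { intros a. apply (is_series_unique_V A _ _ _
      (is_series_linear A A (fun y => inC J (h a) ** y) _ _ (amul_linear_r A _) (HOs a)) (HO a)). }
  assert (HOb : forall a, h a <> 0%C -> norm (O a) <= M * S / Cmod (h a)).
  { intros a Ha. rewrite <- (inC_inv_act A J HJ (h a) (O a) Ha), HOh.
    eapply Rle_trans; [now apply norm_act|]. rewrite Cmod_inv by easy.
    assert (Hp := proj1 (Cmod_gt_0 _) Ha). unfold Rdiv.
    replace (M * S * / Cmod (h a)) with (M * / Cmod (h a) * S) by ring.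
    apply Rmult_le_compat_l; [|apply Hhalf; [apply Hgp | apply Hgm]].
    apply Rmult_le_pos; [lra|]. left; now apply Rinv_0_lt_compat. }
  assert (Hhm : forall a, Cmod (h a) * Cmod (h a) = Cmod (t a - RtoC (eta ^ 2))%C).
  { intros a. now rewrite <- Cmod_mult, Hh. }
  assert (Hdex : ex_series (fun k => B / R1 * q ^ k)).
  { eexists. now apply is_series_geom_scal. }
  assert (Hd1 : forall m, norm (d m) <= 64 * M ^ 2 * S / r).
  (* B0 is a crude bound on O that depends on all the data. It serves only where |sin a| < k = e^2,
     with e chosen so that M S / (r e) = B0. The final estimate is free of B0 because the integral
     of [sin_weight k] is at most 32 for every k. *)
  { intros m. set (B0 := M * (B / R1) / (1 - q) + 1).
    assert (HB0 : 0 < B0).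
    { assert (0 <= M * (B / R1) / (1 - q)); [|unfold B0; lra].
      apply Rdiv_le_0_compat; [|lra]. apply Rmult_le_pos; [lra|].
      apply Rdiv_le_0_compat; lra. }
    assert (HOB : forall a, norm (O a) <= B0).
    { intros a. apply Rle_trans with (M * (B / R1) / (1 - q)); [|unfold B0; lra].
      apply (series_norm_le A _ _ _ _ (Hdq a) (HOs a)). now apply is_series_geom_scal. }
    set (e := M * S / (r * B0)).
    assert (He : 0 < e).
    { unfold e. apply Rdiv_lt_0_compat; apply Rmult_lt_0_compat; lra. }
    set (k := e * e). assert (Hk : 0 < k) by (unfold k; nra).
    destruct (sin_weight_integral k Hk) as [H [HH1 HH2]].
    assert (Hw : forall a, norm (O a) <= 2 * M * S / r * sin_weight k a).
    { intros a. apply Rle_trans with (M * S / r * / sqrt (Rmax (Rabs (sin a)) k)).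
      - destruct (Rle_dec k (Rabs (sin a))) as [Hka|Hka].
        + rewrite Rmax_left by easy.
          assert (Hsa : 0 < sqrt (Rabs (sin a))) by (apply sqrt_lt_R0; lra).
          (* Since eta^2 is real, |h a|^2 = |t a - eta^2| >= |Im (t a)| = r^2 |sin a|. *)
          assert (Hrs : r * sqrt (Rabs (sin a)) <= Cmod (h a)).
          { apply Rsqr_incr_0_var; [|apply Cmod_ge_0]. unfold Rsqr. rewrite Hhm.
            replace (r * sqrt (Rabs (sin a)) * (r * sqrt (Rabs (sin a)))) with
              (r * r * (sqrt (Rabs (sin a)) * sqrt (Rabs (sin a)))) by ring.
            rewrite sqrt_sqrt by lra.
            eapply Rle_trans; [|apply Rmax_Cmod]. eapply Rle_trans; [|apply Rmax_r].
            simpl. rewrite <- (Rabs_pos_eq (r * r)) by nra. rewrite <- Rabs_mult.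
            right. f_equal. ring. }
          assert (0 < r * sqrt (Rabs (sin a))) by (apply Rmult_lt_0_compat; lra).
          eapply Rle_trans; [apply HOb|].
          * intros Hz. rewrite Hz, Cmod_0 in Hrs. lra.
          * replace (M * S / r * / sqrt (Rabs (sin a))) with
              (M * S * / (r * sqrt (Rabs (sin a)))) by (field; lra).
            apply Rmult_le_compat_l; [nra|]. now apply Rinv_le_contravar.
        + rewrite Rmax_right by lra. unfold k. rewrite sqrt_square by lra.
          eapply Rle_trans; [apply HOB|]. right. unfold e. field. lra.
      - assert (H1 := sin_weight_ge k a Hk).
        replace (2 * M * S / r * sin_weight k a) with (M * S / r * (2 * sin_weight k a))
          by (field; lra).
        apply Rmult_le_compat_l; [|easy]. apply Rdiv_le_0_compat; nra. }
    assert (H1 := circle_coef_bound J d _ O _ _ m HJ Hd Hdex HOs Hw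
       (is_RInt_scal (V := R_NormedModule) _ _ _ (2 * M * S / r) _ HH1)).
    unfold scal in H1; simpl in H1. unfold mult in H1; simpl in H1.
    assert (Hpi2 := PI2_1).
    assert (0 <= M * S / r) by (apply Rdiv_le_0_compat; nra).
    assert (HX : M * (2 * M * S / r * H) <= 64 * M ^ 2 * S / r).
    { replace (64 * M ^ 2 * S / r) with (2 * M * (M * S / r) * 32) by (field; lra).
      replace (M * (2 * M * S / r * H)) with (2 * M * (M * S / r) * H) by (field; lra).
      apply Rmult_le_compat_l; [nra | easy]. }
    assert (norm (d m) <= 2 * PI * norm (d m)).
    { generalize (norm_ge_0 (d m)). nra. }
    lra. }
  assert (Hd2 : forall m, Rabs eta * norm (d m) <= 128 * M ^ 2 * S).
  (* For |eta| <= 2 r the previous bound is enough. For larger |eta| the circle |t| = r^2 keeps away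
     from eta^2, so that |h a| >= |eta| / 2 and O is bounded by a multiple of S / |eta|. *)
  { intros m. destruct (Rle_dec (Rabs eta) (2 * r)) as [Hle|Hgt].
    - apply Rle_trans with (2 * r * (64 * M ^ 2 * S / r)).
      + apply Rmult_le_compat; [apply Rabs_pos | apply norm_ge_0 | easy | apply Hd1].
      + right. field. lra.
    - assert (Heta : 0 < Rabs eta) by lra.
      assert (Hhe : forall a, Rabs eta / 2 <= Cmod (h a)).
      { intros a. apply Rsqr_incr_0_var; [|apply Cmod_ge_0]. unfold Rsqr. rewrite Hhm.
        assert (H1 := Cmod_triangle (RtoC (eta ^ 2) - t a)%C (t a)).
        replace (RtoC (eta ^ 2) - t a + t a)%C with (RtoC (eta ^ 2)) in H1 by ring.
        rewrite Cmod_R, Ht, <- Cmod_opp in H1.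
        replace (- (RtoC (eta ^ 2) - t a))%C with (t a - RtoC (eta ^ 2))%C in H1 by ring.
        rewrite Rabs_pos_eq in H1 by apply pow2_ge_0.
        assert (He2 := pow2_abs eta).
        assert (r * r <= Rabs eta / 2 * (Rabs eta / 2)) by (apply Rmult_le_compat; lra).
        assert (He3 := pow2_ge_0 eta). lra. }
      assert (HOe : forall a, norm (O a) <= 2 * M * S / Rabs eta).
      { intros a. specialize (Hhe a). eapply Rle_trans; [apply HOb|].
        - intros Hz. rewrite Hz, Cmod_0 in Hhe. lra.
        - replace (2 * M * S / Rabs eta) with (M * S * / (Rabs eta / 2)) by (field; lra).
          apply Rmult_le_compat_l; [nra|]. apply Rinv_le_contravar; lra. }
      assert (H1 := circle_coef_bound J d _ O (fun _ => 2 * M * S / Rabs eta)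
        (scal (2 * PI - 0) (2 * M * S / Rabs eta)) m HJ Hd Hdex HOs HOe
        (is_RInt_const (V := R_NormedModule) _ _ _)).
      unfold scal in H1; simpl in H1. unfold mult in H1; simpl in H1.
      assert (H2 : norm (d m) <= 2 * M ^ 2 * S / Rabs eta).
      { apply Rmult_le_reg_l with (2 * PI); [lra|]. eapply Rle_trans; [apply H1|].
        right. field. lra. }
      apply Rle_trans with (Rabs eta * (2 * M ^ 2 * S / Rabs eta)).
      + apply Rmult_le_compat_l; lra.
      + replace (Rabs eta * (2 * M ^ 2 * S / Rabs eta)) with (2 * M ^ 2 * S) by (field; lra).
        nra. }
  assert (Hrk : forall k, r ^ (2 * k) = (r ^ 2) ^ k) by (intros; apply pow_mult).
  assert (HM2 : 1 <= M ^ 2) by nra.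
  intros n. destruct (even_or_odd_div2 n) as [[_ E]|[_ E]]; rewrite E; set (k := Nat.div2 n).
  - apply Rle_div_r; [now apply pow_lt|]. rewrite Hrk.
    apply Rle_trans with (norm (minus (c k) (inC J (xi - w)%C ** d k))).
    + replace (s (2 * k)%nat) with (scal (/ (r ^ 2) ^ k) (minus (c k) (inC J (xi - w)%C ** d k))).
      2:{ unfold c, d, u. rewrite amul_scal_r. specialize (Hr2 k). module; field; lra. }
      apply Rle_trans with (/ (r ^ 2) ^ k * norm (minus (c k) (inC J (xi - w)%C ** d k)) * (r ^ 2) ^ k).
      * apply Rmult_le_compat_r; [left; apply Hr2|]. eapply Rle_trans; [apply norm_scal_le|].
        rewrite Rabs_pos_eq; [lra|]. left; now apply Rinv_0_lt_compat.
      * right. field. specialize (Hr2 k); lra.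
    + eapply Rle_trans; [apply norm_minus_le; [apply Hcm | now apply norm_act]|].
      rewrite Hxw. specialize (Hd2 k). unfold coef_cst. nra.
  - fold (v k). apply Rle_div_r; [now apply pow_lt|].
    replace (v k) with (scal (/ (r ^ 2) ^ k) (d k))
      by (unfold d; specialize (Hr2 k); module; field; lra).
    change (r ^ Datatypes.S (2 * k)) with (r * r ^ (2 * k)). rewrite Hrk.
    apply Rle_trans with (/ (r ^ 2) ^ k * norm (d k) * (r * (r ^ 2) ^ k)).
    + apply Rmult_le_compat_r; [specialize (Hr2 k); nra|]. eapply Rle_trans; [apply norm_scal_le|].
      rewrite Rabs_pos_eq; [lra|]. left; now apply Rinv_0_lt_compat.
    + replace (/ (r ^ 2) ^ k * norm (d k) * (r * (r ^ 2) ^ k)) with (r * norm (d k))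
        by (field; specialize (Hr2 k); lra).
      apply Rle_trans with (r * (64 * M ^ 2 * S / r)).
      * apply Rmult_le_compat_l; [lra | apply Hd1].
      * replace (r * (64 * M ^ 2 * S / r)) with (64 * M ^ 2 * S) by (field; lra).
        apply Rmult_le_compat_r; [lra|]. unfold coef_cst.
        assert (0 <= M ^ 2 * M) by (apply Rmult_le_pos; lra).
        replace (128 * M ^ 2 * (1 + M)) with (128 * M ^ 2 + 128 * (M ^ 2 * M)) by ring. lra.
Qed.

End CoefficientBound.

(** * Complex derivatives *)

Lemma continuous_eps (U : UniformSpace) (V : NormedModule R_AbsRing) (f : U -> V) x :
  continuous f x <->
  forall eps, 0 < eps -> locally x (fun y => norm (minus (f y) (f x)) < eps).
Proof.
  unfold continuous. etransitivity; [apply (filterlim_locally_ball_norm f (f x))|]. split.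
  - intros H eps He. apply (H (mkposreal eps He)).
  - intros H eps. apply (H eps (cond_pos eps)).
Qed.

Lemma locally_C_eps (z : C) (P : C -> Prop) :
  locally z P <-> exists d, 0 < d /\ forall y, Cmod (y - z) < d -> P y.
Proof.
  split.
  - intros [d Hd]. exists d. split; [apply cond_pos|]. intros y Hy. apply Hd.
    assert (H := Rmax_Cmod (y - z)%C).
    split; (eapply Rle_lt_trans; [|exact Hy]); (eapply Rle_trans; [|exact H]);
      [apply Rmax_l | apply Rmax_r].
  - intros (d & Hd & H). exists (mkposreal (d / 2) ltac:(lra)). intros y [H1 H2].
    apply H. eapply Rle_lt_trans; [apply Cmod_2Rmax|].
    change (Rabs (fst y - fst z) < d / 2) in H1. change (Rabs (snd y - snd z) < d / 2) in H2.
    assert (H3 : Rmax (Rabs (fst (y - z)%C)) (Rabs (snd (y - z)%C)) < d / 2)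
      by (apply Rmax_lub_lt; easy).
    assert (H4 : sqrt 2 <= 2).
    { replace 2 with (sqrt (2 * 2)) at 2 by (apply sqrt_square; lra). apply sqrt_le_1_alt; lra. }
    assert (0 <= Rmax (Rabs (fst (y - z)%C)) (Rabs (snd (y - z)%C))).
    { eapply Rle_trans; [apply Rabs_pos | apply Rmax_l]. }
    assert (0 <= sqrt 2) by apply sqrt_pos. nra.
Qed.

Lemma locally_R_eps (x : R) (P : R -> Prop) :
  locally x P <-> exists d, 0 < d /\ forall y, Rabs (y - x) < d -> P y.
Proof.
  split.
  - intros [d Hd]. exists d. split; [apply cond_pos | exact Hd].
  - intros (d & Hd & H). exists (mkposreal d Hd). exact H.
Qed.

Lemma continuous_C_eps (V : NormedModule R_AbsRing) (f : C -> V) z :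
  continuous f z <->
  forall eps, 0 < eps -> exists d, 0 < d /\
    forall y, Cmod (y - z) < d -> norm (minus (f y) (f z)) < eps.
Proof.
  rewrite continuous_eps. split; intros H eps He.
  - now apply locally_C_eps, H.
  - now apply locally_C_eps, H.
Qed.

Section ComplexContinuity.
Variable U : UniformSpace.
Implicit Types f g : U -> C.

Lemma continuous_C_pair f x :
  continuous (fun u => fst (f u)) x -> continuous (fun u => snd (f u)) x -> continuous f x.
Proof.
  intros H1 H2. apply continuous_ext with (fun u => (fst (f u), snd (f u))).
  { intros u. now destruct (f u). }
  apply (continuous_comp_2 (fun u => fst (f u)) (fun u => snd (f u)) (fun a b => (a, b)));
    [easy | easy |].
  apply continuous_ext with (fun z => z); [now intros []|]. apply continuous_id.
Qed.

Lemma continuous_C_fst f x : continuous f x -> continuous (fun u => fst (f u)) x.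
Proof. intros H. apply (continuous_comp f fst); [easy | apply continuous_fst]. Qed.

Lemma continuous_C_snd f x : continuous f x -> continuous (fun u => snd (f u)) x.
Proof. intros H. apply (continuous_comp f snd); [easy | apply continuous_snd]. Qed.

Lemma continuous_Cplus f g x : continuous f x -> continuous g x ->
  continuous (fun u => f u + g u)%C x.
Proof.
  intros Hf Hg. apply continuous_C_pair; simpl.
  - apply (continuous_plus (V := R_NormedModule)); now apply continuous_C_fst.
  - apply (continuous_plus (V := R_NormedModule)); now apply continuous_C_snd.
Qed.

Lemma continuous_Copp f x : continuous f x -> continuous (fun u => - f u)%C x.
Proof.
  intros Hf. apply continuous_C_pair; simpl.
  - apply (continuous_opp (V := R_NormedModule)); now apply continuous_C_fst.
  - apply (continuous_opp (V := R_NormedModule)); now apply continuous_C_snd.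
Qed.

Lemma continuous_Cminus f g x : continuous f x -> continuous g x ->
  continuous (fun u => f u - g u)%C x.
Proof. intros Hf Hg. apply continuous_Cplus; [easy | now apply continuous_Copp]. Qed.

Lemma continuous_Cmult f g x : continuous f x -> continuous g x ->
  continuous (fun u => f u * g u)%C x.
Proof.
  intros Hf Hg. apply continuous_C_pair; simpl.
  - apply (continuous_minus (V := R_NormedModule)); apply (continuous_mult (K := R_AbsRing));
      now apply continuous_C_fst || apply continuous_C_snd.
  - apply (continuous_plus (V := R_NormedModule)); apply (continuous_mult (K := R_AbsRing));
      now apply continuous_C_fst || apply continuous_C_snd.
Qed.

Lemma continuous_Cinv f x : continuous f x -> f x <> 0%C -> continuous (fun u => / f u)%C x.
Proof.
  intros Hf H0.
  assert (Hn : fst (f x) * (fst (f x) * 1) + snd (f x) * (snd (f x) * 1) <> 0).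
  { intros H. apply H0. apply injective_projections; simpl; nra. }
  assert (Hd : continuous (fun u : U => / (fst (f u) * (fst (f u) * 1) + snd (f u) * (snd (f u) * 1))) x).
  { apply (continuous_comp (fun u : U => fst (f u) * (fst (f u) * 1) + snd (f u) * (snd (f u) * 1))
      Rinv); [|now apply continuous_Rinv].
    apply (continuous_plus (V := R_NormedModule));
    repeat apply (continuous_mult (K := R_AbsRing));
      try apply continuous_const; now apply continuous_C_fst || apply continuous_C_snd. }
  apply continuous_C_pair; simpl; apply (continuous_mult (K := R_AbsRing)); try easy.
  - now apply continuous_C_fst.
  - apply (continuous_opp (V := R_NormedModule)); now apply continuous_C_snd.
Qed.

Lemma continuous_Cpow f n x : continuous f x -> continuous (fun u => f u ^ n)%C x.
Proof.
  intros Hf. induction n as [|n IH]; [apply continuous_const|].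
  now apply continuous_Cmult.
Qed.

End ComplexContinuity.

(* Complex differentiability, in the form of Caratheodory. *)
Definition C_deriv (f : C -> C) (z l : C) : Prop :=
  exists q : C -> C, continuous q z /\ q z = l /\
    forall y, (f y - f z = q y * (y - z))%C.

Lemma C_deriv_continuous f z l : C_deriv f z l -> continuous f z.
Proof.
  intros (q & Hq & _ & H).
  apply continuous_ext with (fun y => f z + q y * (y - z))%C.
  { intros y. assert (E : (f z + q y * (y - z))%C = f y) by (rewrite <- H; ring). exact E. }
  apply continuous_Cplus; [apply continuous_const|]. apply continuous_Cmult; [easy|].
  apply continuous_Cminus; [apply continuous_id | apply continuous_const].
Qed.

Lemma C_deriv_const c z : C_deriv (fun _ => c) z 0%C.
Proof.
  exists (fun _ => 0%C). split; [apply continuous_const|]. split; [easy|]. intros; ring.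
Qed.

Lemma C_deriv_id z : C_deriv (fun y => y) z 1%C.
Proof.
  exists (fun _ => 1%C). split; [apply continuous_const|]. split; [easy|]. intros; ring.
Qed.

Lemma C_deriv_plus f g z l m : C_deriv f z l -> C_deriv g z m ->
  C_deriv (fun y => f y + g y)%C z (l + m)%C.
Proof.
  intros (p & Hp & <- & Hf) (q & Hq & <- & Hg). exists (fun y => p y + q y)%C.
  split; [now apply continuous_Cplus|]. split; [easy|]. intros y.
  replace (f y + g y - (f z + g z))%C with ((f y - f z) + (g y - g z))%C by ring.
  rewrite Hf, Hg. ring.
Qed.

Lemma C_deriv_mult f g z l m : C_deriv f z l -> C_deriv g z m ->
  C_deriv (fun y => f y * g y)%C z (l * g z + f z * m)%C.
Proof.
  intros Hf' Hg'. pose proof (C_deriv_continuous _ _ _ Hg') as Hgc.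
  destruct Hf' as (p & Hp & <- & Hf). destruct Hg' as (q & Hq & <- & Hg).
  exists (fun y => p y * g y + f z * q y)%C. split; [|split; [easy|]].
  - apply continuous_Cplus; apply continuous_Cmult; try easy. apply continuous_const.
  - intros y. replace (f y * g y - f z * g z)%C with
      ((f y - f z) * g y + f z * (g y - g z))%C by ring. rewrite Hf, Hg. ring.
Qed.

Lemma C_deriv_ext f g z l : (forall y, f y = g y) -> C_deriv f z l -> C_deriv g z l.
Proof.
  intros H (q & Hq & Hl & Hf). exists q. split; [easy|]. split; [easy|].
  intros y. now rewrite <- !H.
Qed.

Lemma C_deriv_inv f z l : C_deriv f z l -> f z <> 0%C ->
  C_deriv (fun y => / f y)%C z (- l / (f z * f z))%C.
Proof.
  intros Hf' H0. pose proof (C_deriv_continuous _ _ _ Hf') as Hfc.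
  destruct Hf' as (q & Hq & <- & Hf).
  (* The factorization in [C_deriv] is demanded at every y, also far from z; where f y = 0 the plain
     difference quotient is taken. *)
  exists (fun y => if Ceq_dec (f y) 0%C then (/ f y - / f z) / (y - z)
                   else - q y / (f y * f z))%C.
  split; [|split].
  - assert (Hne : locally z (fun y => f y <> 0%C)).
    { apply locally_C_eps.
      destruct (proj1 (continuous_C_eps C_R_NormedModule f z) Hfc (Cmod (f z))) as (d & Hd & H).
      { now apply Cmod_gt_0. }
      exists d. split; [easy|]. intros y Hy Hfy. specialize (H y Hy).
      change (norm (minus (f y) (f z))) with (norm (f y - f z : C_R_NormedModule)%C) in H.
      rewrite norm_C, Hfy in H.
      replace (0 - f z)%C with (- f z)%C in H by ring. rewrite Cmod_opp in H. lra. }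
    apply continuous_ext_loc with (fun y => - q y / (f y * f z))%C.
    { revert Hne. apply filter_imp. intros y Hy. now destruct (Ceq_dec (f y) 0%C). }
    apply continuous_Cmult; [now apply continuous_Copp|].
    apply continuous_Cinv; [|now apply Cmult_neq_0].
    apply continuous_Cmult; [easy | apply continuous_const].
  - now destruct (Ceq_dec (f z) 0%C).
  - intros y. destruct (Ceq_dec (f y) 0%C) as [Hy|Hy].
    + unfold Cdiv. rewrite <- Cmult_assoc, Cinv_l, Cmult_1_r; [easy|].
      intros H. apply Ceq_minus in H. now subst.
    + replace (/ f y - / f z)%C with (- (f y - f z) / (f y * f z))%C by (field; easy).
      rewrite Hf. field. easy.
Qed.

Lemma C_deriv_comp f g z l m : C_deriv f (g z) l -> C_deriv g z m ->
  C_deriv (fun y => f (g y)) z (l * m)%C.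
Proof.
  intros (p & Hp & <- & Hf) Hg'. pose proof (C_deriv_continuous _ _ _ Hg') as Hgc.
  destruct Hg' as (q & Hq & <- & Hg).
  exists (fun y => p (g y) * q y)%C. split; [|split; [easy|]].
  - apply continuous_Cmult; [|easy]. now apply (continuous_comp g p).
  - intros y. rewrite Hf, Hg. ring.
Qed.

Lemma C_deriv_pow f z l n : C_deriv f z l ->
  C_deriv (fun y => f y ^ S n)%C z (RtoC (INR (S n)) * f z ^ n * l)%C.
Proof.
  intros Hf. induction n as [|n IH].
  - apply C_deriv_ext with f; [intros; simpl; ring|]. simpl.
    replace (1 * 1 * l)%C with l by ring. easy.
  - assert (H := C_deriv_mult _ _ _ _ _ Hf IH).
    replace (RtoC (INR (S (S n))) * f z ^ S n * l)%C with
      (l * f z ^ S n + f z * (RtoC (INR (S n)) * f z ^ n * l))%C; [exact H|].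
    rewrite (S_INR (S n)), RtoC_plus. simpl Cpow. ring.
Qed.

Lemma is_derive_eps (V : NormedModule R_AbsRing) (f : R -> V) t l :
  is_derive f t l <->
  forall eps, 0 < eps -> locally t (fun u =>
    norm (minus (minus (f u) (f t)) (scal (u - t) l)) <= eps * Rabs (u - t)).
Proof.
  split.
  - intros [_ H] eps He. exact (H t (fun P HP => HP) (mkposreal eps He)).
  - intros H. split; [apply is_linear_scal_l|]. intros y Hy.
    apply (is_filter_lim_locally_unique (V := R_NormedModule)) in Hy. rewrite <- Hy.
    intros eps. exact (H eps (cond_pos eps)).
Qed.

Lemma C_deriv_curve h (g : R -> C) t l (g' : C_R_NormedModule) : C_deriv h (g t) l ->
  is_derive (V := C_R_NormedModule) g t g' ->
  is_derive (V := C_R_NormedModule) (fun u => h (g u)) t (l * g')%C.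
Proof.
  intros (q & Hq & <- & Hh) Hg.
  assert (Hgc : continuous g t).
  { apply (ex_derive_continuous (V := C_R_NormedModule)). now exists g'. }
  assert (Hqg : continuous (fun u => q (g u)) t) by now apply (continuous_comp g q).
  apply is_derive_eps. intros eps He.
  set (K := Cmod (q (g t)) + 1 + Cmod g').
  assert (HK : 0 < K).
  { unfold K. generalize (Cmod_ge_0 (q (g t))) (Cmod_ge_0 g'). lra. }
  assert (He' : 0 < eps / (2 * K)) by (apply Rdiv_lt_0_compat; lra).
  assert (H1 := proj1 (continuous_eps _ C_R_NormedModule (fun u => q (g u)) t) Hqg
    (Rmin 1 (eps / (2 * K))) ltac:(apply Rmin_glb_lt; lra)).
  assert (H2 := proj1 (is_derive_eps C_R_NormedModule g t g') Hg _ He').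
  generalize (filter_and _ _ H1 H2). apply filter_imp. intros u [Hu1 Hu2].
  change (norm (minus (q (g u)) (q (g t)))) with (norm (q (g u) - q (g t) : C_R_NormedModule)%C) in Hu1.
  rewrite norm_C in Hu1.
  assert (E2 : minus (minus (g u) (g t)) (scal (u - t) g') =
    (g u - g t - RtoC (u - t) * g' : C_R_NormedModule)%C).
  { rewrite scal_R_Cmult. reflexivity. }
  apply (eq_ind _ (fun v : C_R_NormedModule => norm v <= _) Hu2) in E2. clear Hu2.
  rewrite norm_C in E2.
  assert (E : minus (minus (h (g u)) (h (g t))) (scal (u - t) (q (g t) * g')%C) =
    (q (g u) * (g u - g t - RtoC (u - t) * g') + (q (g u) - q (g t)) * (RtoC (u - t) * g') : C_R_NormedModule)%C).
  { rewrite scal_R_Cmult.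
    assert (E : (h (g u) - h (g t) - RtoC (u - t) * (q (g t) * g') =
      q (g u) * (g u - g t - RtoC (u - t) * g') +
      (q (g u) - q (g t)) * (RtoC (u - t) * g'))%C) by (rewrite Hh; ring).
    exact E. }
  symmetry in E. refine (eq_ind _ (fun v : C_R_NormedModule => norm v <= _) _ _ E). clear E.
  rewrite norm_C.
  assert (Hqu : Cmod (q (g u)) <= Cmod (q (g t)) + 1).
  { replace (q (g u)) with (q (g t) + (q (g u) - q (g t)))%C by ring.
    eapply Rle_trans; [apply Cmod_triangle|]. generalize (Rmin_l 1 (eps / (2 * K))). lra. }
  assert (Hm := Rmin_r 1 (eps / (2 * K))).
  eapply Rle_trans; [apply Cmod_triangle|]. rewrite !Cmod_mult, Cmod_R.
  assert (H0 := Rabs_pos (u - t)). assert (H3 := Cmod_ge_0 (q (g u))). assert (H4 := Cmod_ge_0 g').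
  apply Rle_trans with (K * (eps / (2 * K) * Rabs (u - t)) + eps / (2 * K) * (Rabs (u - t) * K)).
  - apply Rplus_le_compat.
    + apply Rmult_le_compat; try easy; [apply Cmod_ge_0 | unfold K; lra].
    + apply Rmult_le_compat; [apply Cmod_ge_0 | nra | lra |].
      apply Rmult_le_compat_l; [easy|]. unfold K. generalize (Cmod_ge_0 (q (g t))). lra.
  - right. field. lra.
Qed.

Lemma curve_derive (g : R -> C) t :
  ex_derive (fun u => fst (g u)) t -> ex_derive (fun u => snd (g u)) t ->
  is_derive (V := C_R_NormedModule) g t (velocity g t).
Proof.
  intros H1 H2. apply Derive_correct in H1. apply Derive_correct in H2.
  apply is_derive_eps. intros eps He.
  assert (He2 : 0 < eps / 2) by lra.
  assert (K1 := proj1 (is_derive_eps R_NormedModule _ _ _) H1 _ He2).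
  assert (K2 := proj1 (is_derive_eps R_NormedModule _ _ _) H2 _ He2).
  generalize (filter_and _ _ K1 K2). apply filter_imp. intros u [Hu1 Hu2].
  rewrite norm_C. eapply Rle_trans; [apply Cmod_2Rmax|].
  match type of Hu1 with norm ?x <= _ => change (norm x) with (Rabs x) in Hu1 end.
  match type of Hu2 with norm ?x <= _ => change (norm x) with (Rabs x) in Hu2 end.
  assert (H4 : sqrt 2 <= 2).
  { replace 2 with (sqrt (2 * 2)) at 2 by (apply sqrt_square; lra). apply sqrt_le_1_alt; lra. }
  apply Rle_trans with (2 * (eps / 2 * Rabs (u - t))); [|right; field].
  apply Rmult_le_compat; [apply sqrt_pos | | easy |].
  - eapply Rle_trans; [apply Rabs_pos | apply Rmax_l].
  - apply Rmax_lub; easy.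
Qed.

(** * Cauchy integrals over cycles *)

Section ContourSums.
Variable V : CompleteNormedModule R_AbsRing.
Implicit Types (c : list (R -> C)) (F G : (R -> C) -> R -> V).

(** The relational form of the contour integral carries integrability along, so linear maps, sums
    and series pass through without separate existence proofs. F sees the arc as well as the
    parameter, so that the velocity is at hand. *)
Fixpoint is_cint c F (L : V) : Prop :=
  match c with
  | [] => L = zero
  | g :: c => exists L1 L2, is_RInt (F g) 0 1 L1 /\ is_cint c F L2 /\ L = plus L1 L2
  end.

Lemma is_cint_contour_int c (H : C -> C -> V) L :
  is_cint c (fun g t => H (g t) (velocity g t)) L -> contour_int c H = L.
Proof.
  revert L. induction c as [|g c IH]; intros L; simpl; [now intros ->|].
  intros (L1 & L2 & H1 & H2 & ->). rewrite <- (IH _ H2), <- (is_RInt_unique _ _ _ _ H1).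
  reflexivity.
Qed.

Lemma is_cint_unique c F L L' : is_cint c F L -> is_cint c F L' -> L = L'.
Proof.
  revert L L'. induction c as [|g c IH]; intros L L'; simpl; [now intros -> ->|].
  intros (L1 & L2 & H1 & H2 & ->) (L1' & L2' & H1' & H2' & ->).
  rewrite (IH _ _ H2 H2'). f_equal.
  rewrite <- (is_RInt_unique _ _ _ _ H1). now apply is_RInt_unique.
Qed.

Lemma is_cint_ext c F G L :
  (forall g t, In g c -> 0 <= t <= 1 -> F g t = G g t) -> is_cint c F L -> is_cint c G L.
Proof.
  revert L. induction c as [|g c IH]; intros L H; simpl; [easy|].
  intros (L1 & L2 & H1 & H2 & ->). exists L1, L2. split; [|split; [|easy]].
  - revert H1. apply is_RInt_ext. intros t. rewrite Rmin_left, Rmax_right by lra.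
    intros Ht. apply H; [now left | lra].
  - apply IH; [|easy]. intros; apply H; [now right | easy].
Qed.

Lemma is_cint_plus c F G L L' : is_cint c F L -> is_cint c G L' ->
  is_cint c (fun g t => plus (F g t) (G g t)) (plus L L').
Proof.
  revert L L'. induction c as [|g c IH]; intros L L'; simpl.
  - intros -> ->. module.
  - intros (L1 & L2 & H1 & H2 & ->) (L1' & L2' & H1' & H2' & ->).
    exists (plus L1 L1'), (plus L2 L2'). split; [now apply (is_RInt_plus (V := V))|].
    split; [now apply IH | module].
Qed.

Lemma is_cint_series c (F : nat -> (R -> C) -> R -> V) G (l : nat -> V) (M : nat -> R) :
  (forall k, is_cint c (F k) (l k)) ->
  (forall k g t, In g c -> 0 <= t <= 1 -> norm (F k g t) <= M k) -> ex_series M ->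
  (forall g t, In g c -> 0 <= t <= 1 -> is_series (fun k => F k g t) (G g t)) ->
  exists L, is_series l L /\ is_cint c G L.
Proof.
  intros Hl HM HB HG. revert l Hl HM HG. induction c as [|g c IH]; intros l Hl HM HG; simpl.
  - exists zero. split; [|easy]. apply is_series_eps. intros eps He. exists 0%nat. intros n _.
    eapply Rle_lt_trans; [|exact He]. right. transitivity (norm (zero : V)); [|exact norm_zero].
    f_equal. assert (E : sum_n l n = zero).
    { induction n as [|n IHn]; [rewrite sum_O; apply (Hl 0%nat)|].
      rewrite sum_Sn, IHn. rewrite (Hl (S n)). module. }
    etransitivity; [exact (f_equal (fun v => minus v zero) E) | module].
  - simpl in Hl.
    set (l1 k := proj1_sig (constructive_indefinite_description _ (Hl k))).
    assert (Hl1 : forall k, exists L2, is_RInt (F k g) 0 1 (l1 k) /\ is_cint c (F k) L2 /\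
      l k = plus (l1 k) L2).
    { intros k. unfold l1. now destruct (constructive_indefinite_description _ (Hl k)). }
    set (l2 k := proj1_sig (constructive_indefinite_description _ (Hl1 k))).
    assert (Hl2 : forall k, is_RInt (F k g) 0 1 (l1 k) /\ is_cint c (F k) (l2 k) /\
      l k = plus (l1 k) (l2 k)).
    { intros k. unfold l2. now destruct (constructive_indefinite_description _ (Hl1 k)). }
    destruct (is_RInt_series V (fun k => F k g) (G g) 0 1 l1 M) as [L1 [H1 H1']].
    + lra.
    + intros k; apply Hl2.
    + intros k t Ht. apply HM; [now left | easy].
    + easy.
    + intros t Ht. apply HG; [now left | easy].
    + destruct (IH l2) as [L2 [H2 H2']].
      * intros k; apply Hl2.
      * intros k h t Hh Ht. apply HM; [now right | easy].
      * intros h t Hh Ht. apply HG; [now right | easy].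
      * exists (plus L1 L2). split.
        -- apply is_series_ext with (fun k => plus (l1 k) (l2 k)).
           { intros k. symmetry; apply Hl2. }
           exact (is_series_plus _ _ _ _ H1 H2).
        -- exists L1, L2. easy.
Qed.

End ContourSums.
Arguments is_cint {V} c F L.

Lemma is_cint_linear (V W : CompleteNormedModule R_AbsRing) (f : V -> W) c F L :
  is_linear f -> is_cint c F L -> is_cint c (fun g t => f (F g t)) (f L).
Proof.
  intros Hf. revert L. induction c as [|g c IH]; intros L; simpl.
  - intros ->. exact (linear_zero _ Hf).
  - intros (L1 & L2 & H1 & H2 & ->). exists (f L1), (f L2).
    split; [now apply is_RInt_linear|]. split; [now apply IH|]. exact (linear_plus _ Hf _ _).
Qed.

Lemma Cmult_linear (a : C) : is_linear (U := C_R_NormedModule) (V := C_R_NormedModule) (fun z => a * z)%C.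
Proof.
  split.
  - intros x y. exact (Cmult_plus_distr_l a x y).
  - intros k x. rewrite !scal_R_Cmult.
    assert (E : (a * (RtoC k * x) = RtoC k * (a * x))%C) by ring. exact E.
  - exists (Cmod a + 1). split; [generalize (Cmod_ge_0 a); lra|]. intros x.
    rewrite !norm_C, Cmod_mult. generalize (Cmod_ge_0 x). nra.
Qed.

Lemma winding_int_cint c z L :
  is_cint (V := C_R_CompleteNormedModule) c (fun g t => velocity g t / (g t - z))%C L ->
  winding_int c z = L.
Proof.
  intros H. unfold winding_int, contour_int2. apply injective_projections; simpl.
  - apply is_cint_contour_int.
    apply (is_cint_linear C_R_CompleteNormedModule R_CompleteNormedModule fst) in H; [exact H|].
    apply (is_linear_fst (U := R_NormedModule) (V := R_NormedModule)).
  - apply is_cint_contour_int.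
    apply (is_cint_linear C_R_CompleteNormedModule R_CompleteNormedModule snd) in H; [exact H|].
    apply (is_linear_snd (U := R_NormedModule) (V := R_NormedModule)).
Qed.

(** * Polynomial and rational integrands on a cycle *)

Definition prodl (l : list C) (z : C) : C := fold_right (fun a p => (z - a) * p)%C (RtoC 1) l.

Lemma prodl_app l l' z : prodl (l ++ l') z = (prodl l z * prodl l' z)%C.
Proof.
  unfold prodl. induction l as [|a l IH]; simpl; [ring|]. rewrite IH. ring.
Qed.

Lemma newton_prodl w n z : newton w n z = prodl (map (node w) (seq 0 n)) z.
Proof.
  induction n as [|n IH]; [easy|].
  rewrite seq_S, map_app, prodl_app, <- IH. simpl. ring.
Qed.

Lemma prodl_continuous l z : continuous (prodl l) z.
Proof.
  unfold prodl. induction l as [|a l IH]; simpl; [apply continuous_const|].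
  apply continuous_Cmult; [|easy].
  apply continuous_Cminus; [apply continuous_id | apply continuous_const].
Qed.

Section Cycle.
Variables (c : list (R -> C)).
Hypothesis Hc1 : forall g, In g c -> C1_arc g.
Hypothesis Hcl : Permutation (map (fun g => g 0) c) (map (fun g => g 1) c).

Definition cycle_int (p : C -> C) (L : C) : Prop :=
  is_cint (V := C_R_CompleteNormedModule) c (fun g t => p (g t) * velocity g t)%C L.

Definition on_trace (P : C -> Prop) : Prop := forall g t, In g c -> 0 <= t <= 1 -> P (g t).

Lemma arc_derive g t : In g c -> 0 <= t <= 1 ->
  is_derive (V := C_R_NormedModule) g t (velocity g t) /\ continuous (velocity g) t /\ continuous g t.
Proof.
  intros Hg Ht. destruct (Hc1 g Hg t Ht) as (H1 & H2 & H3).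
  assert (H := curve_derive g t H1 H2). split; [easy|]. split; [easy|].
  apply (ex_derive_continuous (V := C_R_NormedModule)). now exists (velocity g t).
Qed.

Lemma cauchy_ext p q L : on_trace (fun z => p z = q z) -> cycle_int p L -> cycle_int q L.
Proof. intros H. apply is_cint_ext. intros g t Hg Ht. now rewrite (H g t). Qed.

Lemma cauchy_lin a p b q L L' : cycle_int p L -> cycle_int q L' ->
  cycle_int (fun z => a * p z + b * q z)%C (a * L + b * L')%C.
Proof.
  intros Hp Hq.
  apply (is_cint_linear C_R_CompleteNormedModule C_R_CompleteNormedModule _ _ _ _ (Cmult_linear a)) in Hp.
  apply (is_cint_linear C_R_CompleteNormedModule C_R_CompleteNormedModule _ _ _ _ (Cmult_linear b)) in Hq.
  assert (H := is_cint_plus _ _ _ _ _ _ Hp Hq). revert H. apply is_cint_ext.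
  intros g t _ _.
  assert (E : (a * (p (g t) * velocity g t) + b * (q (g t) * velocity g t) =
    (a * p (g t) + b * q (g t)) * velocity g t)%C) by ring. exact E.
Qed.

Lemma cauchy_exists p : on_trace (continuous p) -> exists L, cycle_int p L.
Proof.
  intros Hp.
  assert (H : forall c', (forall g, In g c' -> In g c) -> exists L,
    is_cint (V := C_R_CompleteNormedModule) c' (fun g t => p (g t) * velocity g t)%C L).
  { induction c' as [|g c' IH]; intros Hi; [now exists zero|].
    destruct IH as [L2 H2]; [intros; apply Hi; now right|].
    destruct (ex_RInt_continuous (V := C_R_CompleteNormedModule)
      (fun t => p (g t) * velocity g t)%C 0 1) as [L1 H1].
    { rewrite Rmin_left, Rmax_right by lra. intros t Ht.
      destruct (arc_derive g t (Hi g ltac:(now left)) Ht) as (_ & Hv & Hg).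
      apply continuous_Cmult; [|easy]. apply (continuous_comp g p); [easy|].
      apply Hp; [apply Hi; now left | easy]. }
    exists (plus L1 L2), L1, L2. easy. }
  now apply H.
Qed.

(** Each arc contributes P (g 1) - P (g 0). The sum over the arcs vanishes because final and initial
    points agree up to a permutation. *)
Lemma cauchy_primitive P p :
  on_trace (fun z => C_deriv P z (p z)) -> on_trace (continuous p) -> cycle_int p 0%C.
Proof.
  intros HP Hp.
  set (csum := fold_right Cplus (RtoC 0)).
  assert (Hs : forall l l', Permutation l l' -> csum l = csum l').
  { intros l l' H. induction H; simpl; try congruence. ring. }
  assert (H : forall c', (forall g, In g c' -> In g c) ->
    is_cint (V := C_R_CompleteNormedModule) c' (fun g t => p (g t) * velocity g t)%C
      (csum (map P (map (fun g => g 1) c')) - csum (map P (map (fun g => g 0) c')))%C).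
  { induction c' as [|g c' IH]; intros Hi; simpl.
    { assert (E : (0 - 0)%C = 0%C) by ring. exact E. }
    eexists (P (g 1) - P (g 0))%C, _. split; [|split; [apply IH; intros; apply Hi; now right|]].
    - apply (is_RInt_derive (V := C_R_CompleteNormedModule) (fun t => P (g t))).
      + rewrite Rmin_left, Rmax_right by lra. intros t Ht.
        apply C_deriv_curve; [apply HP; [apply Hi; now left | easy]|].
        apply arc_derive; [apply Hi; now left | easy].
      + rewrite Rmin_left, Rmax_right by lra. intros t Ht.
        destruct (arc_derive g t (Hi g ltac:(now left)) Ht) as (_ & Hv & Hg).
        apply continuous_Cmult; [|easy]. apply (continuous_comp g p); [easy|].
        apply Hp; [apply Hi; now left | easy].
    - assert (E : forall a b u v : C, (a + u - (b + v) = (a - b) + (u - v))%C) by (intros; ring).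
      apply E. }
  specialize (H c (fun g Hg => Hg)).
  rewrite (Hs _ _ (Permutation_map P Hcl)) in H.
  refine (eq_ind _ (cycle_int p) H _ _). ring.
Qed.

Lemma C_deriv_shift a z : C_deriv (fun y => y - a)%C z 1%C.
Proof.
  replace (RtoC 1) with (RtoC 1 + RtoC 0)%C by ring.
  apply C_deriv_plus; [apply C_deriv_id | apply C_deriv_const].
Qed.

Lemma continuous_shift (a z : C) : continuous (fun y : C => y - a)%C z.
Proof. apply continuous_Cminus; [apply continuous_id | apply continuous_const]. Qed.

Lemma cauchy_pow a n : cycle_int (fun z => (z - a) ^ n)%C 0%C.
Proof.
  apply cauchy_primitive with (fun z => / RtoC (INR (S n)) * (z - a) ^ S n)%C.
  - intros g t _ _. set (z := g t).
    assert (H := C_deriv_mult _ _ _ _ _ (C_deriv_const (/ RtoC (INR (S n)))%C z)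
      (C_deriv_pow _ _ _ n (C_deriv_shift a z))). simpl in H.
    match type of H with C_deriv _ _ ?m => replace m with ((z - a) ^ n)%C in H end; [exact H|].
    field. intros E. apply RtoC_inj in E. change (INR (S n) = 0) in E.
    generalize (lt_0_INR (S n) ltac:(lia)). lra.
  - intros g t _ _. apply continuous_Cpow, continuous_shift.
Qed.

(** To avoid expanding the product, the induction carries a free power of z in front: a factor z - b
    either raises this power or multiplies by - b. *)
Lemma cauchy_prodl l : cycle_int (prodl l) 0%C.
Proof.
  assert (H : forall l n, cycle_int (fun z => (z - 0) ^ n * prodl l z)%C 0%C).
  { clear l. induction l as [|b l IH]; intros n.
    - apply (cauchy_ext (fun z => (z - 0) ^ n)%C); [|apply cauchy_pow].
      intros g t _ _. unfold prodl; simpl. ring.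
    - assert (H := cauchy_lin 1 _ (- b) _ _ _ (IH (S n)) (IH n)).
      replace (RtoC 1 * 0 + - b * 0)%C with (RtoC 0) in H by ring.
      revert H. apply cauchy_ext. intros g t _ _. unfold prodl; simpl. ring. }
  apply (cauchy_ext (fun z => (z - 0) ^ 0 * prodl l z)%C); [|apply H].
  intros g t _ _. simpl. ring.
Qed.

Section Inside.
Variable inside : C -> Prop.
Hypothesis Hin : forall z, inside z -> winding_int c z = (2 * PI * Ci)%C.
Hypothesis Htr : on_trace (fun z => ~ inside z).

Lemma trace_minus z g t : inside z -> In g c -> 0 <= t <= 1 -> (g t - z)%C <> 0%C.
Proof.
  intros Hz Hg Ht H. apply Ceq_minus in H. apply (Htr g t Hg Ht). now rewrite H.
Qed.

Lemma cauchy_winding z : inside z -> cycle_int (fun y => / (y - z))%C (2 * PI * Ci)%C.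
Proof.
  intros Hz. destruct (cauchy_exists (fun y => / (y - z))%C) as [L HL].
  - intros g t Hg Ht. apply continuous_Cinv; [apply continuous_shift|].
    now apply trace_minus.
  - rewrite <- (Hin z Hz). rewrite (winding_int_cint c z L); [easy|].
    revert HL. apply is_cint_ext. intros g t _ _. apply Cmult_comm.
Qed.

(** Cauchy's formula for polynomials, root by root: (y - b)/(y - z) = 1 + (z - b)/(y - z), where the
    first term leaves a polynomial. *)
Lemma cauchy_prodl_pole l z : inside z ->
  cycle_int (fun y => prodl l y / (y - z))%C (2 * PI * Ci * prodl l z)%C.
Proof.
  intros Hz. induction l as [|b l IH].
  - replace (2 * PI * Ci * prodl [] z)%C with (2 * PI * Ci)%C by (unfold prodl; simpl; ring).
    apply (cauchy_ext (fun y => / (y - z))%C); [|now apply cauchy_winding].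
    intros g t _ _. unfold prodl, Cdiv; simpl. ring.
  - assert (H := cauchy_lin 1 _ (z - b) _ _ _ (cauchy_prodl l) IH).
    replace (RtoC 1 * 0 + (z - b) * (2 * PI * Ci * prodl l z))%C with
      (2 * PI * Ci * prodl (b :: l) z)%C in H by (unfold prodl; simpl; ring).
    revert H. apply cauchy_ext. intros g t Hg Ht. unfold prodl; simpl. field.
    now apply trace_minus.
Qed.

Lemma prodl_trace_neq0 l g t : (forall a, In a l -> inside a) -> In g c -> 0 <= t <= 1 ->
  prodl l (g t) <> 0%C.
Proof.
  intros Hl Hg Ht. unfold prodl. induction l as [|a l IH]; simpl; [apply C1_nz|].
  apply Cmult_neq_0.
  - apply trace_minus; [apply Hl; now left | easy | easy].
  - apply IH. intros; apply Hl; now right.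
Qed.

Lemma cauchy_inv_pow a n : inside a -> cycle_int (fun z => (/ (z - a)) ^ S (S n))%C 0%C.
Proof.
  intros Ha.
  assert (Hne : forall g t, In g c -> 0 <= t <= 1 -> (g t - a)%C <> 0%C)
    by (intros; now apply trace_minus).
  apply cauchy_primitive with (fun z => - / RtoC (INR (S n)) * (/ (z - a)) ^ S n)%C.
  - intros g t Hg Ht. specialize (Hne g t Hg Ht). set (z := g t) in *.
    assert (H := C_deriv_mult _ _ _ _ _ (C_deriv_const (- / RtoC (INR (S n)))%C z)
      (C_deriv_pow _ _ _ n (C_deriv_inv _ _ _ (C_deriv_shift a z) Hne))).
    cbv beta in H.
    match type of H with C_deriv _ _ ?m =>
      replace m with ((/ (z - a)) ^ S (S n))%C in H; [exact H|] end.
    simpl Cpow. field. split; [easy|].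
    intros E. apply RtoC_inj in E. generalize (lt_0_INR (S n) ltac:(lia)). lra.
  - intros g t Hg Ht. apply continuous_Cpow, continuous_Cinv; [apply continuous_shift|].
    now apply Hne.
Qed.

(* By partial fractions: the poles have the same winding number and the residues add up to 0. *)
Lemma cauchy_inv_prodl a b l : inside a -> inside b -> (forall e, In e l -> inside e) ->
  cycle_int (fun z => / prodl (a :: b :: l) z)%C 0%C.
Proof.
  (* The pole a is kept apart with its multiplicity. A factor b = a raises the power; for b <> a,
     1/((z - a)(z - b)) = (1/(z - a) - 1/(z - b))/(a - b) either removes b or lowers the power. The
     last condition says that the total order of the poles is at least 2. *)
  assert (H : forall l a n, inside a -> (forall e, In e l -> inside e) -> (1 <= n + length l)%nat ->
    cycle_int (fun z => (/ (z - a)) ^ S n * / prodl l z)%C 0%C).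
  { clear a b l. induction l as [|b l IH]; intros a n Ha Hl Hn.
    - destruct n as [|n]; [simpl in Hn; lia|].
      apply (cauchy_ext (fun z => (/ (z - a)) ^ S (S n))%C); [|now apply cauchy_inv_pow].
      intros g t _ _. unfold prodl; simpl fold_right.
      rewrite <- (RtoC_inv 1), Rinv_1 by lra. ring.
    - assert (Hb : inside b) by (apply Hl; now left).
      assert (Hl' : forall e, In e l -> inside e) by (intros; apply Hl; now right).
      destruct (Ceq_dec b a) as [->|Hba].
      { apply (cauchy_ext (fun z => (/ (z - a)) ^ S (S n) * / prodl l z)%C).
        - intros g t Hg Ht. assert (H1 := trace_minus a g t Ha Hg Ht).
          assert (H2 := prodl_trace_neq0 l g t Hl' Hg Ht).
          rewrite (Cpow_S _ (S n)). change (prodl (a :: l) (g t)) with ((g t - a) * prodl l (g t))%C.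
          generalize ((/ (g t - a)) ^ S n)%C. intros X. field. easy.
        - apply IH; [easy | easy | lia]. }
      assert (Hab : (a - b)%C <> 0%C) by (intros E; apply Hba; symmetry; now apply Ceq_minus).
      induction n as [|n IHn].
      (* It suffices that the integrals with a and with b agree: both are 2 pi i if no other factor
         is left, and 0 by induction otherwise. *)
      + assert (H1 : exists L, cycle_int (fun z => (/ (z - a)) ^ 1 * / prodl l z)%C L /\
          cycle_int (fun z => (/ (z - b)) ^ 1 * / prodl l z)%C L).
        { destruct l as [|e l].
          - exists (2 * PI * Ci)%C.
            split; [apply (cauchy_ext (fun z => / (z - a))%C); [|now apply cauchy_winding]
                   |apply (cauchy_ext (fun z => / (z - b))%C); [|now apply cauchy_winding]];
            intros g t _ _; unfold prodl; simpl fold_right;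
            rewrite <- (RtoC_inv 1), Rinv_1 by lra; ring.
          - exists 0%C. split; apply IH; easy || (simpl; lia). }
        destruct H1 as (L & H1 & H2).
        assert (H := cauchy_lin (/ (a - b)) _ (- / (a - b)) _ _ _ H1 H2).
        replace (/ (a - b) * L + - / (a - b) * L)%C with (RtoC 0) in H by ring.
        revert H. apply cauchy_ext. intros g t Hg Ht.
        assert (K1 := trace_minus a g t Ha Hg Ht). assert (K2 := trace_minus b g t Hb Hg Ht).
        assert (K3 := prodl_trace_neq0 l g t Hl' Hg Ht).
        change (prodl (b :: l) (g t)) with ((g t - b) * prodl l (g t))%C. simpl Cpow. field. easy.
      + assert (H1 := IH a (S n) Ha Hl' ltac:(lia)). assert (H2 := IHn ltac:(simpl; lia)).
        assert (H := cauchy_lin (/ (a - b)) _ (- / (a - b)) _ _ _ H1 H2).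
        replace (/ (a - b) * 0 + - / (a - b) * 0)%C with (RtoC 0) in H by ring.
        revert H. apply cauchy_ext. intros g t Hg Ht.
        assert (K1 := trace_minus a g t Ha Hg Ht). assert (K2 := trace_minus b g t Hb Hg Ht).
        assert (K3 := prodl_trace_neq0 l g t Hl' Hg Ht).
        change (prodl (b :: l) (g t)) with ((g t - b) * prodl l (g t))%C.
        rewrite (Cpow_S _ (S n)). generalize ((/ (g t - a)) ^ S n)%C. intros X. field. easy. }
  intros Ha Hb Hl. apply (cauchy_ext (fun z => (/ (z - a)) ^ 1 * / prodl (b :: l) z)%C).
  - intros g t Hg Ht.
    assert (Hbl : forall e, In e (b :: l) -> inside e) by (intros e [<-|He]; auto).
    assert (K1 := trace_minus a g t Ha Hg Ht).
    assert (K3 := prodl_trace_neq0 (b :: l) g t Hbl Hg Ht).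
    change (prodl (a :: b :: l) (g t)) with ((g t - a) * prodl (b :: l) (g t))%C.
    revert K3. generalize (prodl (b :: l) (g t)). intros P HP. simpl Cpow. field. easy.
  - apply H; [easy | | simpl; lia]. intros e [<-|He]; auto.
Qed.

End Inside.
End Cycle.

(** The two nodes are 2 |Im w| apart: a point farther than u + 2 |Im w| from w is farther than u
    from conj w, and the product of the distances exceeds u^2. *)
Lemma dist_node_le w z u : 0 <= u -> Cmod (lemn w z) <= u ^ 2 ->
  Cmod (z - w)%C <= u + 2 * Rabs (Im w).
Proof.
  intros Hu H. unfold lemn in H. rewrite Cmod_mult in H.
  apply Rnot_lt_le. intros Hlt.
  assert (H1 : Cmod (z - w)%C <= Cmod (z - Cconj w)%C + 2 * Rabs (Im w)).
  { replace (z - w)%C with ((z - Cconj w) + RtoC (-2 * Im w) * Ci)%C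
      by (apply injective_projections; simpl; unfold Im; ring).
    eapply Rle_trans; [apply Cmod_triangle|].
    rewrite Cmod_mult, Cmod_Ci, Cmod_R, Rabs_mult, (Rabs_left (-2)) by lra. lra. }
  assert (H0 := Rabs_pos (Im w)). nra.
Qed.

(** The extra factor u on the left treats both parities alike without dividing by u, which may be
    0. *)
Lemma newton_bound w n z u : 0 <= u -> Cmod (lemn w z) <= u ^ 2 ->
  Cmod (newton w n z) * u <= u ^ n * (u + 2 * Rabs (Im w)).
Proof.
  intros Hu H. assert (H1 := dist_node_le w z u Hu H). assert (H0 := Rabs_pos (Im w)).
  assert (Hp : forall m, Cmod (lemn w z ^ m)%C <= u ^ (2 * m)).
  { intros m. rewrite Cmod_pow, pow_mult. apply pow_incr. split; [apply Cmod_ge_0 | easy]. }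
  destruct (even_or_odd_div2 n) as [[_ E]|[_ E]]; rewrite E.
  - rewrite newton_even. apply Rmult_le_compat; [apply Cmod_ge_0 | easy | apply Hp | lra].
  - rewrite newton_odd, Cmod_mult.
    change (u ^ S (2 * Nat.div2 n)) with (u * u ^ (2 * Nat.div2 n)).
    replace (u * u ^ (2 * Nat.div2 n) * (u + 2 * Rabs (Im w))) with
      (u ^ (2 * Nat.div2 n) * (u + 2 * Rabs (Im w)) * u) by ring.
    apply Rmult_le_compat_r; [easy|].
    apply Rmult_le_compat; [apply Cmod_ge_0 | apply Cmod_ge_0 | apply Hp | easy].
Qed.

Lemma node_lemn w i : lemn w (node w i) = 0%C.
Proof. unfold lemn, node. destruct (Nat.even i); ring. Qed.

(** * Algebra-valued integrals along the boundary of a lemniscate domain *)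

Section VectorCauchy.
Variable A : alt_star_algebra.
Hypothesis hnorm : norm_compatible A.
Variable J : A.
Hypothesis HJ : imag_sphere J.
Variables (w : C) (r R1 B : R) (s : nat -> A) (g : C -> A).
Hypothesis Hr : 0 < r < R1.
Hypothesis Hs : forall n, norm (s n) <= B / R1 ^ n.
Hypothesis Hg : forall z, Cmod (lemn w z) <= r ^ 2 ->
  is_series (fun n => inC J (newton w n z) ** s n) (g z).
Variable c : list (R -> C).
Hypothesis Hc1 : forall h, In h c -> C1_arc h.
Hypothesis Hcl : Permutation (map (fun h => h 0) c) (map (fun h => h 1) c).
Hypothesis Htr : on_trace c (fun z => Cmod (lemn w z) = r ^ 2).
Hypothesis Hin : forall z, Cmod (lemn w z) < r ^ 2 -> winding_int c z = (2 * PI * Ci)%C.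

Let inside (z : C) : Prop := Cmod (lemn w z) < r ^ 2.

Lemma trace_not_inside : on_trace c (fun z => ~ inside z).
Proof. intros h t Hh Ht H. unfold inside in H. rewrite (Htr h t Hh Ht) in H. lra. Qed.

Lemma inside_node i : inside (node w i).
Proof. unfold inside. rewrite node_lemn, Cmod_0. apply pow_lt. lra. Qed.

Lemma inside_nodes l e : In e (map (node w) l) -> inside e.
Proof. intros H. apply in_map_iff in H. destruct H as (i & <- & _). apply inside_node. Qed.

Lemma newton_trace_neq0 n : on_trace c (fun z => newton w n z <> 0%C).
Proof.
  intros h t Hh Ht. rewrite newton_prodl.
  apply (prodl_trace_neq0 c inside trace_not_inside); [|easy|easy].
  intros e He. now apply inside_nodes in He.
Qed.

(** The form p(z) dz is kept as a single complex factor, so that all products inside [C_J] are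
    computed in C before they act on g. *)
Definition vcauchy (p : C -> C) (L : A) : Prop :=
  is_cint c (fun h t => inC J (p (h t) * velocity h t)%C ** g (h t)) L.

Lemma vcauchy_ext p q L : on_trace c (fun z => p z = q z) -> vcauchy p L -> vcauchy q L.
Proof. intros H. apply is_cint_ext. intros h t Hh Ht. now rewrite (H h t). Qed.

Lemma vcauchy_lin a p b q L L' : vcauchy p L -> vcauchy q L' ->
  vcauchy (fun z => a * p z + b * q z)%C (plus (inC J a ** L) (inC J b ** L')).
Proof.
  intros Hp Hq.
  apply (is_cint_linear A A _ _ _ _ (amul_linear_r A (inC J a))) in Hp.
  apply (is_cint_linear A A _ _ _ _ (amul_linear_r A (inC J b))) in Hq.
  assert (H := is_cint_plus _ _ _ _ _ _ Hp Hq). revert H. apply is_cint_ext.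
  intros h t _ _. rewrite !inC_mul_act, <- amul_plus_l, <- inC_plus by easy.
  do 2 f_equal. ring.
Qed.

Lemma vcauchy_unique p L L' : vcauchy p L -> vcauchy p L' -> L = L'.
Proof. apply is_cint_unique. Qed.

Lemma trace_bounded p : on_trace c (continuous p) -> exists Q, 0 <= Q /\
  forall h t, In h c -> 0 <= t <= 1 -> Cmod (p (h t) * velocity h t)%C <= Q.
Proof.
  intros Hp.
  assert (H : forall c', (forall h, In h c' -> In h c) -> exists Q, 0 <= Q /\
    forall h t, In h c' -> 0 <= t <= 1 -> Cmod (p (h t) * velocity h t)%C <= Q).
  { induction c' as [|h c' IH]; intros Hi; [now exists 0; split; [lra|]|].
    destruct IH as [Q [HQ0 HQ]]; [intros; apply Hi; now right|].
    destruct (bounded_continuity (V := C_R_NormedModule)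
      (fun t => p (h t) * velocity h t)%C 0 1) as [Q' HQ'].
    { intros t Ht. destruct (arc_derive c Hc1 h t (Hi h ltac:(now left)) Ht) as (_ & Hv & Hh).
      apply (continuous_Cmult R_UniformSpace (fun t => p (h t)) (velocity h)); [|easy].
      apply (continuous_comp h p); [easy|]. apply Hp; [apply Hi; now left | easy]. }
    exists (Rmax Q Q'). split; [eapply Rle_trans; [exact HQ0 | apply Rmax_l]|].
    intros h' t [<-|Hh'] Ht.
    - eapply Rle_trans; [|apply Rmax_r]. rewrite <- norm_C. left; now apply HQ'.
    - eapply Rle_trans; [|apply Rmax_l]. now apply HQ. }
  now apply H.
Qed.

(** The gap r < R1 makes the series of g converge normally on the trace, with ratio r / R1.
    Integrals of g thus reduce to scalar integrals against Newton polynomials. *)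
Lemma vcauchy_series p l : on_trace c (continuous p) ->
  (forall k, cycle_int c (fun z => p z * newton w k z)%C (l k)) ->
  exists L, is_series (fun k => inC J (l k) ** s k) L /\ vcauchy p L.
Proof.
  intros Hp Hl. destruct (trace_bounded p Hp) as (Q & HQ0 & HQ).
  destruct (product_bounded A) as (M & HM1 & HM).
  set (K := (r + 2 * Rabs (Im w)) / r).
  assert (HK : 0 <= K).
  { apply Rdiv_le_0_compat; [|lra]. generalize (Rabs_pos (Im w)). lra. }
  assert (Hq : 0 <= r / R1 < 1).
  { split; [apply Rdiv_le_0_compat; lra|]. apply Rlt_div_l; lra. }
  apply (is_cint_series A c
    (fun k h t => inC J (p (h t) * newton w k (h t) * velocity h t)%C ** s k)
    _ (fun k => inC J (l k) ** s k) (fun k => M * Q * K * B * (r / R1) ^ k)).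
  - intros k. exact (is_cint_linear C_R_CompleteNormedModule A (fun z => inC J z ** s k) _ _ _
      (inC_act_linear A J (s k)) (Hl k)).
  - intros k h t Hh Ht. eapply Rle_trans; [apply (norm_act A hnorm M HM J); easy|].
    replace (p (h t) * newton w k (h t) * velocity h t)%C with
      (p (h t) * velocity h t * newton w k (h t))%C by ring. rewrite Cmod_mult.
    assert (H1 : Cmod (newton w k (h t)) <= r ^ k * K).
    { unfold K. apply Rmult_le_reg_r with r; [lra|].
      eapply Rle_trans; [apply newton_bound; [lra | right; now apply Htr]|].
      right. field. lra. }
    assert (Hrk : 0 < r ^ k) by (apply pow_lt; lra).
    assert (HRk : 0 < R1 ^ k) by (apply pow_lt; lra).
    apply Rle_trans with (M * (Q * (r ^ k * K)) * (B / R1 ^ k)).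
    + apply Rmult_le_compat; [|apply norm_ge_0| |apply Hs].
      * apply Rmult_le_pos; [lra|]. apply Rmult_le_pos; apply Cmod_ge_0.
      * apply Rmult_le_compat_l; [lra|].
        apply Rmult_le_compat; [apply Cmod_ge_0 | apply Cmod_ge_0 | now apply HQ | easy].
    + right. unfold Rdiv. rewrite Rpow_mult_distr, pow_inv. field. lra.
  - eexists. now apply is_series_geom_scal.
  - intros h t Hh Ht.
    apply is_series_ext with
      (fun k => inC J (p (h t) * velocity h t)%C ** (inC J (newton w k (h t)) ** s k)).
    { intros k. rewrite inC_mul_act by easy. do 2 f_equal. ring. }
    apply (is_series_linear A A (fun y => inC J (p (h t) * velocity h t)%C ** y));
      [apply amul_linear_r|]. apply Hg. right. now apply Htr.
Qed.

Lemma newton_continuous n z : continuous (newton w n) z.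
Proof.
  apply continuous_ext with (prodl (map (node w) (seq 0 n))).
  { intros y. symmetry. apply newton_prodl. }
  apply prodl_continuous.
Qed.

(** Biorthogonality of Newton polynomials. After cancellation the quotient is a polynomial for k >
    n, a single simple pole for k = n, and the inverse of a product of at least two factors for k <
    n. *)
Lemma cauchy_newton_quotient k n :
  cycle_int c (fun z => / newton w (S n) z * newton w k z)%C
    (if Nat.eqb k n then 2 * PI * Ci else RtoC 0)%C.
Proof.
  assert (Hti := trace_not_inside).
  assert (Hlt : forall m d, on_trace c (fun z => prodl (map (node w) (seq m d)) z <> 0%C)).
  { intros m d h t Hh Ht. apply (prodl_trace_neq0 c inside Hti); try easy.
    intros e He. now apply inside_nodes in He. }
  destruct (le_lt_dec k n) as [Hkn|Hkn].
  - assert (E : S n = (k + S (n - k))%nat) by lia.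
    apply (cauchy_ext c (fun z => / prodl (map (node w) (seq k (S (n - k)))) z)%C).
    { intros h t Hh Ht. rewrite E, !newton_prodl, seq_app, map_app, prodl_app.
      simpl Nat.add at 1. replace (k + S (n - k))%nat with (S n) by lia. simpl (0 + k)%nat.
      field. split; apply Hlt; easy. }
    destruct (Nat.eqb_spec k n) as [->|Hne].
    + rewrite Nat.sub_diag. apply (cauchy_ext c (fun z => / (z - node w n))%C).
      * intros h t Hh Ht. unfold prodl; simpl fold_right. f_equal. ring.
      * apply (cauchy_winding c Hc1 inside Hin Hti), inside_node.
    + destruct (n - k)%nat as [|m] eqn:Em; [lia|]. simpl seq. simpl map.
      apply (cauchy_inv_prodl c Hc1 Hcl inside Hin Hti); try apply inside_node.
      intros e He. now apply inside_nodes in He.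
  - replace (Nat.eqb k n) with false by (symmetry; apply Nat.eqb_neq; lia).
    assert (E : k = (S n + (k - S n))%nat) by lia.
    apply (cauchy_ext c (prodl (map (node w) (seq (S n) (k - S n))))).
    + intros h t Hh Ht. rewrite E at 2. rewrite !newton_prodl, seq_app, map_app, prodl_app.
      change (0 + S n)%nat with (S n). field. now apply Hlt.
    + now apply cauchy_prodl.
Qed.

Lemma vcauchy_coef n : vcauchy (fun z => / newton w (S n) z)%C (inC J (2 * PI * Ci)%C ** s n).
Proof.
  destruct (vcauchy_series (fun z => / newton w (S n) z)%C
    (fun k => if Nat.eqb k n then (2 * PI * Ci)%C else RtoC 0)) as (L & HL & HL').
  - intros h t Hh Ht. apply continuous_Cinv; [apply newton_continuous|].
    now apply newton_trace_neq0.
  - intros k. apply cauchy_newton_quotient.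
  - replace (inC J (2 * PI * Ci)%C ** s n) with L; [easy|].
    apply (is_series_unique_V A _ _ _ HL). apply is_series_eps. intros eps He.
    exists n. intros m Hm. eapply Rle_lt_trans; [|exact He]. right.
    transitivity (norm (zero : A)); [|exact norm_zero]. f_equal.
    assert (E0 : forall m, (m < n)%nat ->
      sum_n (fun k => inC J (if Nat.eqb k n then (2 * PI * Ci)%C else RtoC 0) ** s k) m = zero).
    { clear m Hm. induction m as [|m IH]; intros Hm.
      - rewrite sum_O. destruct (Nat.eqb_spec 0 n); [lia|]. now rewrite inC_zero, amul_zero_l.
      - rewrite sum_Sn, IH by lia. destruct (Nat.eqb_spec (S m) n); [lia|].
        rewrite inC_zero, amul_zero_l. module. }
    assert (E : sum_n (fun k => inC J (if Nat.eqb k n then (2 * PI * Ci)%C else RtoC 0) ** s k) m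
      = inC J (2 * PI * Ci)%C ** s n).
    { induction Hm as [|m Hm IH].
      - destruct n as [|n'].
        + now rewrite sum_O, Nat.eqb_refl.
        + rewrite sum_Sn, E0 by lia. rewrite Nat.eqb_refl. module.
      - rewrite sum_Sn, IH. destruct (Nat.eqb_spec (S m) n); [lia|].
        rewrite inC_zero, amul_zero_l. module. }
    etransitivity; [exact (f_equal (fun v => minus v (inC J (2 * PI * Ci)%C ** s n)) E)|].
    module.
Qed.

(** Cauchy's formula holds for every Newton polynomial by [cauchy_prodl_pole]; summing over the
    terms gives it for g. *)
Lemma vcauchy_value z : inside z -> vcauchy (fun y => / (y - z))%C (inC J (2 * PI * Ci)%C ** g z).
Proof.
  intros Hz. assert (Hti := trace_not_inside).
  destruct (vcauchy_series (fun y => / (y - z))%C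
    (fun k => 2 * PI * Ci * newton w k z)%C) as (L & HL & HL').
  - intros h t Hh Ht. apply continuous_Cinv; [apply continuous_shift|].
    now apply (trace_minus c inside Hti).
  - intros k. rewrite newton_prodl.
    eapply cauchy_ext; [|apply (cauchy_prodl_pole c Hc1 Hcl inside Hin Hti); exact Hz].
    intros h t Hh Ht. cbv beta. rewrite newton_prodl. unfold Cdiv. ring.
  - replace (inC J (2 * PI * Ci)%C ** g z) with L; [easy|].
    apply (is_series_unique_V A _ _ _ HL).
    apply is_series_ext with (fun k => inC J (2 * PI * Ci)%C ** (inC J (newton w k z) ** s k)).
    { intros k. now rewrite inC_mul_act. }
    apply (is_series_linear A A (fun y => inC J (2 * PI * Ci)%C ** y)); [apply amul_linear_r|].
    apply Hg. left. exact Hz.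
Qed.

(* Newton's form of the interpolation remainder:
   1/(y-z) = sum_(k<n) N_k(z)/N_(k+1)(y) + N_n(z)/(N_n(y)(y-z)). *)
Lemma vcauchy_remainder z n : inside z ->
  vcauchy (fun y => newton w (S n) z * (/ newton w (S n) y * / (y - z)))%C
    (inC J (2 * PI * Ci)%C ** minus (g z) (sum_n (fun k => inC J (newton w k z) ** s k) n)).
Proof.
  intros Hz. assert (Hti := trace_not_inside).
  assert (Hstep : forall n L,
    vcauchy (fun y => newton w n z * (/ newton w n y * / (y - z)))%C (inC J (2 * PI * Ci)%C ** L) ->
    vcauchy (fun y => newton w (S n) z * (/ newton w (S n) y * / (y - z)))%C
      (inC J (2 * PI * Ci)%C ** minus L (inC J (newton w n z) ** s n))).
  { intros m L H.
    assert (K := vcauchy_lin 1 _ (- newton w m z) _ _ _ H (vcauchy_coef m)).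
    replace (inC J (2 * PI * Ci)%C ** minus L (inC J (newton w m z) ** s m)) with
      (plus (inC J 1 ** (inC J (2 * PI * Ci)%C ** L))
       (inC J (- newton w m z) ** (inC J (2 * PI * Ci)%C ** s m))).
    2:{ rewrite inC_one, amul_one_l, amul_minus_r, !inC_mul_act by easy.
        replace (- newton w m z * (2 * PI * Ci))%C with (- (2 * PI * Ci * newton w m z))%C by ring.
        rewrite inC_opp, amul_opp_l. module. }
    revert K. apply vcauchy_ext. intros h t Hh Ht.
    assert (H1 := newton_trace_neq0 m h t Hh Ht).
    assert (H2 := trace_minus c inside Hti z h t Hz Hh Ht).
    assert (H3 := trace_minus c inside Hti (node w m) h t (inside_node m) Hh Ht).
    cbn [newton]. field. easy. }
  induction n as [|n IH].
  - rewrite sum_O. apply Hstep. revert Hz. intros Hz.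
    generalize (vcauchy_value z Hz). apply vcauchy_ext. intros h t Hh Ht.
    assert (H2 := trace_minus c inside Hti z h t Hz Hh Ht).
    simpl newton. field. easy.
  - apply Hstep in IH. rewrite sum_Sn.
    replace (minus (g z) (plus (sum_n (fun k => inC J (newton w k z) ** s k) n)
      (inC J (newton w (S n) z) ** s (S n)))) with
     (minus (minus (g z) (sum_n (fun k => inC J (newton w k z) ** s k) n))
       (inC J (newton w (S n) z) ** s (S n))) by module.
    exact IH.
Qed.

Lemma vcauchy_exists p : on_trace c (continuous p) -> exists L, vcauchy p L.
Proof.
  intros Hp.
  assert (Hl : forall k, exists l, cycle_int c (fun z => p z * newton w k z)%C l).
  { intros k. apply (cauchy_exists c Hc1). intros h t Hh Ht.
    apply continuous_Cmult; [now apply Hp | apply newton_continuous]. }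
  set (l k := proj1_sig (constructive_indefinite_description _ (Hl k))).
  destruct (vcauchy_series p l Hp) as (L & _ & HL).
  { intros k. unfold l. now destruct (constructive_indefinite_description _ (Hl k)). }
  now exists L.
Qed.

(** K depends on the contour and on g. It is meant for limit arguments in z only and does not enter
    the constants of the theorem. *)
Lemma vcauchy_bound : exists K, 0 <= K /\ forall p m L, 0 <= m ->
  on_trace c (fun z => Cmod (p z) <= m) -> vcauchy p L -> norm L <= K * m.
Proof.
  destruct (product_bounded A) as (M & HM1 & HM).
  destruct (trace_bounded (fun _ => RtoC 1)) as (Q & HQ0 & HQ).
  { intros h t _ _. apply continuous_const. }
  assert (HG : exists G, 0 <= G /\ forall z, Cmod (lemn w z) = r ^ 2 -> norm (g z) <= G).
  { set (K := (r + 2 * Rabs (Im w)) / r).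
    assert (HK : 0 <= K).
    { apply Rdiv_le_0_compat; [|lra]. generalize (Rabs_pos (Im w)). lra. }
    assert (Hq : 0 <= r / R1 < 1).
    { split; [apply Rdiv_le_0_compat; lra|]. apply Rlt_div_l; lra. }
    assert (HB : 0 <= B).
    { specialize (Hs 0%nat). simpl in Hs. generalize (norm_ge_0 (s 0%nat)). lra. }
    exists (M * K * B / (1 - r / R1)). split.
    { apply Rdiv_le_0_compat; [|lra]. apply Rmult_le_pos; [apply Rmult_le_pos; lra | lra]. }
    intros z Hz. refine (series_norm_le A _ (fun k => M * K * B * (r / R1) ^ k) _ _ _
      (Hg z ltac:(lra)) (is_series_geom_scal _ _ Hq)).
    intros k. eapply Rle_trans; [apply (norm_act A hnorm M HM J); easy|].
    assert (H1 : Cmod (newton w k z) <= r ^ k * K).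
    { unfold K. apply Rmult_le_reg_r with r; [lra|].
      eapply Rle_trans; [apply newton_bound; [lra | now right]|]. right. field. lra. }
    assert (Hrk : 0 < r ^ k) by (apply pow_lt; lra).
    assert (HRk : 0 < R1 ^ k) by (apply pow_lt; lra).
    apply Rle_trans with (M * (r ^ k * K) * (B / R1 ^ k)).
    - apply Rmult_le_compat; [|apply norm_ge_0| |apply Hs].
      + apply Rmult_le_pos; [lra | apply Cmod_ge_0].
      + apply Rmult_le_compat_l; [lra | easy].
    - right. unfold Rdiv. rewrite Rpow_mult_distr, pow_inv. field. lra. }
  destruct HG as (G & HG0 & HG).
  exists (M * Q * G * INR (length c)). split.
  { repeat apply Rmult_le_pos; try easy; try lra. apply pos_INR. }
  intros p m L Hm Hp HL.
  assert (H : forall c' L, (forall h, In h c' -> In h c) ->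
    is_cint c' (fun h t => inC J (p (h t) * velocity h t)%C ** g (h t)) L ->
    norm L <= M * Q * G * INR (length c') * m).
  { clear HL L. induction c' as [|h c' IH]; intros L Hi; simpl is_cint.
    - intros ->. eapply Rle_trans; [right; exact norm_zero|]. simpl. lra.
    - intros (L1 & L2 & H1 & H2 & ->). change (length (h :: c')) with (S (length c')).
      rewrite S_INR.
      replace (M * Q * G * (INR (length c') + 1) * m) with
        (M * Q * G * m + M * Q * G * INR (length c') * m) by ring.
      apply norm_triangle_le; [|apply IH; [intros; apply Hi; now right | easy]].
      assert (Hh : In h c) by (apply Hi; now left).
      assert (Hi1 := norm_RInt_le (V := A)
        (fun t => inC J (p (h t) * velocity h t)%C ** g (h t)) (fun _ => M * Q * G * m) 0 1 L1
        (scal (1 - 0) (M * Q * G * m)) ltac:(lra)).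
      eapply Rle_trans; [apply Hi1|].
      + intros t Ht. eapply Rle_trans; [apply (norm_act A hnorm M HM J); easy|].
        rewrite Cmod_mult. specialize (HQ h t Hh Ht). rewrite Cmult_1_l in HQ.
        specialize (Hp h t Hh Ht). simpl in Hp. specialize (HG (h t) (Htr h t Hh Ht)).
        replace (M * Q * G * m) with (M * (m * Q) * G) by ring.
        apply Rmult_le_compat; [|apply norm_ge_0| |easy].
        * apply Rmult_le_pos; [lra|]. apply Rmult_le_pos; apply Cmod_ge_0.
        * apply Rmult_le_compat_l; [lra|].
          apply Rmult_le_compat; try apply Cmod_ge_0; easy.
      + exact H1.
      + apply (is_RInt_const (V := R_NormedModule)).
      + right. unfold scal; simpl. unfold mult; simpl. ring. }
  now apply H.
Qed.

Lemma inside_distance z : inside z -> exists d, 0 < d /\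
  (forall y, Cmod (y - z)%C < d -> inside y) /\ on_trace c (fun y => d <= Cmod (y - z)%C).
Proof.
  intros Hz.
  assert (Hc : continuous (lemn w) z).
  { unfold lemn. apply continuous_Cmult; apply continuous_shift. }
  destruct (proj1 (continuous_C_eps C_R_NormedModule (lemn w) z) Hc (r ^ 2 - Cmod (lemn w z)))
    as (d & Hd & H).
  { unfold inside in Hz. lra. }
  assert (Hi : forall y, Cmod (y - z)%C < d -> inside y).
  { intros y Hy. specialize (H y Hy).
    change (norm (lemn w y - lemn w z : C_R_NormedModule)%C < r ^ 2 - Cmod (lemn w z)) in H.
    rewrite norm_C in H. unfold inside.
    replace (lemn w y) with ((lemn w y - lemn w z) + lemn w z)%C by ring.
    eapply Rle_lt_trans; [apply Cmod_triangle|]. lra. }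
  exists d. split; [easy|]. split; [easy|]. intros h t Hh Ht. apply Rnot_lt_le. intros Hlt.
  apply (trace_not_inside h t Hh Ht). now apply Hi.
Qed.

(** The derivative is the integral with kernel 1/(y - z)^2, since 1/(y - z') - 1/(y - z) - (z' -
    z)/(y - z)^2 = (z' - z)^2/((y - z)^2 (y - z')). For z' near z all these kernels are bounded on
    the trace, and [vcauchy_bound] turns this into the two limits. *)
Lemma cauchy_type_derivative p : on_trace c (continuous p) ->
  exists Phi Phi' : C -> A, forall z, inside z ->
    vcauchy (fun y => p y * / (y - z))%C (Phi z) /\
    (forall eps, 0 < eps -> exists d, 0 < d /\ forall z', Cmod (z' - z)%C < d ->
       norm (minus (minus (Phi z') (Phi z)) (inC J (z' - z)%C ** Phi' z)) <= eps * Cmod (z' - z)%C) /\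
    (forall eps, 0 < eps -> exists d, 0 < d /\ forall z', Cmod (z' - z)%C < d ->
       norm (minus (Phi' z') (Phi' z)) < eps).
Proof.
  intros Hp. assert (Hti := trace_not_inside).
  assert (Hi : forall z, inside z -> on_trace c (continuous (fun y => / (y - z))%C)).
  { intros z Hz h t Hh Ht. apply continuous_Cinv; [apply continuous_shift|].
    now apply (trace_minus c inside Hti). }
  assert (H1 : forall z, exists L, inside z -> vcauchy (fun y => p y * / (y - z))%C L).
  { intros z. destruct (classic (inside z)) as [Hz|Hz]; [|now exists zero].
    destruct (vcauchy_exists (fun y => p y * / (y - z))%C) as [L HL]; [|now exists L].
    intros h t Hh Ht. apply continuous_Cmult; [now apply Hp | now apply Hi]. }
  assert (H2 : forall z, exists L, inside z -> vcauchy (fun y => p y * (/ (y - z) * / (y - z)))%C L).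
  { intros z. destruct (classic (inside z)) as [Hz|Hz]; [|now exists zero].
    destruct (vcauchy_exists (fun y => p y * (/ (y - z) * / (y - z)))%C) as [L HL]; [|now exists L].
    intros h t Hh Ht. apply continuous_Cmult; [now apply Hp|].
    apply continuous_Cmult; now apply Hi. }
  set (F1 z := proj1_sig (constructive_indefinite_description _ (H1 z))).
  set (F2 z := proj1_sig (constructive_indefinite_description _ (H2 z))).
  assert (HF1 : forall z, inside z -> vcauchy (fun y => p y * / (y - z))%C (F1 z)).
  { intros z. unfold F1. now destruct (constructive_indefinite_description _ (H1 z)). }
  assert (HF2 : forall z, inside z -> vcauchy (fun y => p y * (/ (y - z) * / (y - z)))%C (F2 z)).
  { intros z. unfold F2. now destruct (constructive_indefinite_description _ (H2 z)). }
  exists F1, F2. intros z Hz. split; [now apply HF1|].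
  destruct (inside_distance z Hz) as (d & Hd & Hdi & Hdt).
  destruct vcauchy_bound as (K & HK0 & HK).
  assert (HPb : exists P, 0 <= P /\ on_trace c (fun y => Cmod (p y) <= P)).
  { assert (H : forall c', (forall h, In h c' -> In h c) -> exists P, 0 <= P /\
      forall h t, In h c' -> 0 <= t <= 1 -> Cmod (p (h t)) <= P).
    { induction c' as [|h c' IH]; intros Hsub; [now exists 0; split; [lra|]|].
      destruct IH as [P [HP0 HP]]; [intros; apply Hsub; now right|].
      destruct (bounded_continuity (V := C_R_NormedModule) (fun t => p (h t)) 0 1) as [P' HP'].
      { intros t Ht. destruct (arc_derive c Hc1 h t (Hsub h ltac:(now left)) Ht) as (_ & _ & Hh).
        apply (continuous_comp h p); [easy|]. apply Hp; [apply Hsub; now left | easy]. }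
      exists (Rmax P P'). split; [eapply Rle_trans; [exact HP0 | apply Rmax_l]|].
      intros h' t [<-|Hh'] Ht.
      - eapply Rle_trans; [|apply Rmax_r]. rewrite <- norm_C. left; now apply HP'.
      - eapply Rle_trans; [|apply Rmax_l]. now apply HP. }
    destruct (H c (fun h Hh => Hh)) as (P & HP0 & HP). now exists P. }
  destruct HPb as (P & HP0 & HP).
  assert (Hnear : forall z', Cmod (z' - z)%C < d / 2 -> inside z' /\
    forall h t, In h c -> 0 <= t <= 1 ->
      (h t - z')%C <> 0%C /\ (h t - z)%C <> 0%C /\
      Cmod (/ (h t - z'))%C <= 2 / d /\ Cmod (/ (h t - z))%C <= 2 / d).
  { intros z' Hz'. split; [apply Hdi; lra|]. intros h t Hh Ht.
    assert (K1 := Hdt h t Hh Ht). simpl in K1.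
    assert (K2 : d / 2 <= Cmod (h t - z')%C).
    { assert (K3 := Cmod_triangle (h t - z')%C (z' - z)%C).
      replace (h t - z' + (z' - z))%C with (h t - z)%C in K3 by ring. lra. }
    assert (N1 : (h t - z')%C <> 0%C) by (intros E; rewrite E, Cmod_0 in K2; lra).
    assert (N2 : (h t - z)%C <> 0%C) by (intros E; rewrite E, Cmod_0 in K1; lra).
    rewrite !Cmod_inv by easy. replace (2 / d) with (/ (d / 2)) by (field; lra).
    repeat split; try easy; apply Rinv_le_contravar; lra. }
  assert (Hd2 : 0 < 2 / d) by (apply Rdiv_lt_0_compat; lra).
  split.
  - intros eps He.
    set (C0 := K * (P * (2 / d * (2 / d) * (2 / d))) + 1).
    assert (HC0 : 0 < C0).
    { assert (0 <= K * (P * (2 / d * (2 / d) * (2 / d)))).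
      { apply Rmult_le_pos; [easy|]. apply Rmult_le_pos; [easy|].
        repeat apply Rmult_le_pos; lra. } unfold C0; lra. }
    exists (Rmin (d / 2) (eps / C0)). split.
    { apply Rmin_glb_lt; [lra|]. now apply Rdiv_lt_0_compat. }
    intros z' Hz'.
    assert (Hz1 : Cmod (z' - z)%C < d / 2) by (eapply Rlt_le_trans; [exact Hz' | apply Rmin_l]).
    assert (Hz2 : Cmod (z' - z)%C < eps / C0) by (eapply Rlt_le_trans; [exact Hz' | apply Rmin_r]).
    destruct (Hnear z' Hz1) as [Hiz' Hn].
    assert (HL := vcauchy_lin 1 _ (- (z' - z)) _ _ _
      (vcauchy_lin 1 _ (- (1)) _ _ _ (HF1 z' Hiz') (HF1 z Hz)) (HF2 z Hz)).
    rewrite !inC_opp, !inC_one, !amul_opp_l, !amul_one_l in HL.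
    replace (minus (minus (F1 z') (F1 z)) (inC J (z' - z)%C ** F2 z)) with
      (plus (plus (F1 z') (opp (F1 z))) (opp (inC J (z' - z)%C ** F2 z))) by module.
    set (dz := Cmod (z' - z)%C) in *. assert (Hdz : 0 <= dz) by apply Cmod_ge_0.
    eapply Rle_trans; [apply (HK _ (P * (2 / d * (2 / d) * (2 / d)) * (dz * dz)) _) in HL; [exact HL| |]|].
    + repeat apply Rmult_le_pos; lra.
    + intros h t Hh Ht. destruct (Hn h t Hh Ht) as (N1 & N2 & B1 & B2).
      match goal with |- Cmod ?e <= _ => replace e with
        (p (h t) * (/ (h t - z) * / (h t - z) * / (h t - z')) * ((z' - z) * (z' - z)))%C
        by (field; easy) end.
      rewrite !Cmod_mult. fold dz.
      assert (A1 := Cmod_ge_0 (/ (h t - z))%C). assert (A2 := Cmod_ge_0 (/ (h t - z'))%C).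
      apply Rmult_le_compat_r; [nra|]. apply Rmult_le_compat; [apply Cmod_ge_0 | | now apply HP |].
      * repeat apply Rmult_le_pos; easy.
      * apply Rmult_le_compat; [nra | easy | | easy]. apply Rmult_le_compat; easy.
    + apply Rle_trans with (C0 * dz * dz); [unfold C0; nra|].
      apply Rmult_le_compat_r; [easy|]. apply Rlt_le.
      apply Rlt_div_r in Hz2; [lra | easy].
  - intros eps He.
    set (C0 := K * (P * (2 / d * (2 / d) * (2 / d + 2 / d))) + 1).
    assert (HC0 : 0 < C0).
    { assert (0 <= K * (P * (2 / d * (2 / d) * (2 / d + 2 / d)))).
      { apply Rmult_le_pos; [easy|]. apply Rmult_le_pos; [easy|].
        repeat apply Rmult_le_pos; lra. } unfold C0; lra. }
    exists (Rmin (d / 2) (eps / C0)). split.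
    { apply Rmin_glb_lt; [lra|]. now apply Rdiv_lt_0_compat. }
    intros z' Hz'.
    assert (Hz1 : Cmod (z' - z)%C < d / 2) by (eapply Rlt_le_trans; [exact Hz' | apply Rmin_l]).
    assert (Hz2 : Cmod (z' - z)%C < eps / C0) by (eapply Rlt_le_trans; [exact Hz' | apply Rmin_r]).
    destruct (Hnear z' Hz1) as [Hiz' Hn].
    assert (HL := vcauchy_lin 1 _ (- (1)) _ _ _ (HF2 z' Hiz') (HF2 z Hz)).
    rewrite !inC_opp, !inC_one, !amul_opp_l, !amul_one_l in HL.
    set (dz := Cmod (z' - z)%C) in *. assert (Hdz : 0 <= dz) by apply Cmod_ge_0.
    apply Rle_lt_trans with (C0 * dz).
    2:{ apply Rlt_div_r in Hz2; [lra | easy]. }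
    eapply Rle_trans; [apply (HK _ (P * (2 / d * (2 / d) * (2 / d + 2 / d)) * dz) _) in HL; [exact HL| |]|].
    + repeat apply Rmult_le_pos; lra.
    + intros h t Hh Ht. destruct (Hn h t Hh Ht) as (N1 & N2 & B1 & B2).
      match goal with |- Cmod ?e <= _ => replace e with
        (p (h t) * (/ (h t - z') * / (h t - z) * (/ (h t - z') + / (h t - z))) * (z' - z))%C
        by (field; easy) end.
      rewrite !Cmod_mult. fold dz.
      assert (A1 := Cmod_ge_0 (/ (h t - z))%C). assert (A2 := Cmod_ge_0 (/ (h t - z'))%C).
      assert (A3 := Cmod_ge_0 (/ (h t - z') + / (h t - z))%C).
      apply Rmult_le_compat_r; [easy|]. apply Rmult_le_compat; [apply Cmod_ge_0 | | now apply HP |].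
      * repeat apply Rmult_le_pos; easy.
      * apply Rmult_le_compat; [nra | easy | |]. { apply Rmult_le_compat; easy. }
        eapply Rle_trans; [apply Cmod_triangle|]. lra.
    + unfold C0. nra.
Qed.

End VectorCauchy.

(** * Expansion of holomorphic functions on a lemniscate domain *)

Lemma C_deriv_of_eps f z l :
  (forall eps, 0 < eps -> exists d, 0 < d /\ forall y, Cmod (y - z)%C < d ->
     Cmod (f y - f z - l * (y - z))%C <= eps * Cmod (y - z)%C) -> C_deriv f z l.
Proof.
  intros H. exists (fun y => if Ceq_dec y z then l else ((f y - f z) / (y - z))%C).
  split; [|split].
  - apply (continuous_C_eps C_R_NormedModule). intros eps He.
    destruct (H (eps / 2) ltac:(lra)) as (d & Hd & Hf). exists d. split; [easy|].
    intros y Hy. destruct (Ceq_dec z z) as [_|n]; [|easy].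
    destruct (Ceq_dec y z) as [->|Hne].
    + eapply Rle_lt_trans; [|exact He]. right.
      transitivity (norm (zero : C_R_NormedModule)); [|exact norm_zero]. f_equal.
      assert (E : (l - l)%C = 0%C) by ring. exact E.
    + change (norm ((f y - f z) / (y - z) - l : C_R_NormedModule)%C < eps). rewrite norm_C.
      assert (Hyz : (y - z)%C <> 0%C) by (intros E; apply Hne; now apply Ceq_minus).
      assert (Hp := proj1 (Cmod_gt_0 _) Hyz).
      replace ((f y - f z) / (y - z) - l)%C with ((f y - f z - l * (y - z)) / (y - z))%C
        by (field; easy).
      rewrite Cmod_div by easy. apply Rlt_div_l; [easy|].
      eapply Rle_lt_trans; [now apply Hf|]. nra.
  - now destruct (Ceq_dec z z).
  - intros y. destruct (Ceq_dec y z) as [->|Hne]; [ring|]. field.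
    intros E; apply Hne; now apply Ceq_minus.
Qed.

Lemma C_deriv_ext_loc f g z l : locally z (fun y => f y = g y) -> C_deriv f z l -> C_deriv g z l.
Proof.
  intros Hloc (q & Hq & Hl & Hf). assert (Hz := locally_singleton _ _ Hloc).
  exists (fun y => if Ceq_dec y z then l else ((g y - g z) / (y - z))%C).
  split; [|split].
  - apply continuous_ext_loc with q; [|easy]. revert Hloc. apply filter_imp. intros y Hy.
    destruct (Ceq_dec y z) as [->|Hne]; [easy|]. rewrite <- Hy, <- Hz, Hf.
    assert (E : q y = (q y * (y - z) / (y - z))%C); [|exact E].
    field. intros E; apply Hne; now apply Ceq_minus.
  - now destruct (Ceq_dec z z).
  - intros y. destruct (Ceq_dec y z) as [->|Hne]; [ring|]. field.
    intros E; apply Hne; now apply Ceq_minus.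
Qed.

Lemma C_derive_fst (f : R -> C) t l : is_derive (V := C_R_NormedModule) f t l ->
  is_derive (fun u => fst (f u)) t (fst l).
Proof.
  intros H. apply (is_derive_eps R_NormedModule). intros eps He.
  generalize (proj1 (is_derive_eps C_R_NormedModule f t l) H eps He). apply filter_imp.
  intros u Hu. eapply Rle_trans; [|exact Hu]. rewrite norm_C.
  eapply Rle_trans; [|apply Rmax_Cmod]. apply Rmax_l.
Qed.

Lemma C_derive_snd (f : R -> C) t l : is_derive (V := C_R_NormedModule) f t l ->
  is_derive (fun u => snd (f u)) t (snd l).
Proof.
  intros H. apply (is_derive_eps R_NormedModule). intros eps He.
  generalize (proj1 (is_derive_eps C_R_NormedModule f t l) H eps He). apply filter_imp.
  intros u Hu. eapply Rle_trans; [|exact Hu]. rewrite norm_C.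
  eapply Rle_trans; [|apply Rmax_Cmod]. apply Rmax_r.
Qed.

Lemma cis_derive t : is_derive (V := C_R_NormedModule) cis t (Ci * cis t)%C.
Proof.
  assert (H := curve_derive cis t ltac:(apply ex_derive_Reals_1, derivable_pt_cos)
    ltac:(apply ex_derive_Reals_1, derivable_pt_sin)).
  replace (velocity cis t) with (Ci * cis t)%C in H; [exact H|].
  unfold velocity, cis; simpl.
  replace (Derive (fun u => cos u) t) with (- sin t)
    by (symmetry; apply is_derive_unique; auto_derive; [easy | ring]).
  replace (Derive (fun u => sin u) t) with (cos t)
    by (symmetry; apply is_derive_unique; auto_derive; [easy | ring]).
  apply injective_projections; simpl; ring.
Qed.

Lemma line_derive (a b : C) t : is_derive (V := C_R_NormedModule) (fun u => a + RtoC u * b)%C t b.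
Proof.
  apply (is_derive_eps C_R_NormedModule). intros eps He.
  apply locally_R_eps. exists 1. split; [lra|]. intros u _.
  assert (E : minus (minus (a + RtoC u * b)%C (a + RtoC t * b)%C) (scal (u - t) b) =
    (RtoC 0 : C_R_NormedModule)).
  { rewrite scal_R_Cmult.
    assert (E : (a + RtoC u * b - (a + RtoC t * b) - RtoC (u - t) * b = 0)%C)
      by (rewrite RtoC_minus; ring).
    exact E. }
  eapply Rle_trans; [right; exact (f_equal (fun v : C_R_NormedModule => norm v) E)|].
  rewrite norm_C, Cmod_0.
  apply Rmult_le_pos; [lra | apply Rabs_pos].
Qed.

Lemma cis_continuous t : continuous cis t.
Proof. apply (ex_derive_continuous (V := C_R_NormedModule)). eexists. apply cis_derive. Qed.

Lemma continuous_RtoC x : continuous RtoC x.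
Proof.
  apply continuous_C_pair; simpl; [apply continuous_id | apply continuous_const].
Qed.

(* Cauchy's formula, by shrinking the circle to z along the segments [pt]: the
   integral [psi l] of h over the circle shrunk by the factor [l], against the
   kernel [kap], does not depend on [l].  The point [t0], where h is only assumed
   continuous, is met for at most one value of [l]. *)
Section CauchyDisc.
Variables (h h' : C -> C) (R0 rho : R) (t0 : C).
Hypothesis Hrho : 0 < rho < R0.
Hypothesis Hh : forall t, Cmod t < R0 -> continuous h t.
Hypothesis Hh' : forall t, Cmod t < R0 -> t <> t0 -> C_deriv h t (h' t) /\ continuous h' t.

Variable z : C.
Hypothesis Hz : Cmod z < rho.

Let pt (l t : R) : C := (z + RtoC l * (RtoC rho * cis t - z))%C.
Let kap (t : R) : C := (RtoC rho * cis t / (RtoC rho * cis t - z))%C.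
(** How far l may leave [0, 1]: with this choice (1 + 2 dl) rho is the midpoint of rho and R0, so
    the points [pt l t] stay in the disc where h is continuous. *)
Let dl : R := (R0 - rho) / (4 * rho).

Lemma circle_neq t : (RtoC rho * cis t - z)%C <> 0%C.
Proof.
  intros E. apply Ceq_minus in E. rewrite <- E in Hz.
  rewrite Cmod_mult, Cmod_cis, Cmod_R, Rabs_pos_eq in Hz; lra.
Qed.

Lemma pt_in l t : - dl < l < 1 + dl -> Cmod (pt l t) < R0.
Proof.
  intros Hl. unfold pt.
  replace (z + RtoC l * (RtoC rho * cis t - z))%C with
    (RtoC (1 - l) * z + RtoC l * (RtoC rho * cis t))%C by (rewrite RtoC_minus; ring).
  eapply Rle_lt_trans; [apply Cmod_triangle|].
  rewrite !Cmod_mult, Cmod_cis, !Cmod_R, (Rabs_pos_eq rho) by lra.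
  assert (Hdl : 0 < dl) by (apply Rdiv_lt_0_compat; lra).
  assert (H1 : Rabs (1 - l) + Rabs l <= 1 + 2 * dl) by (split_Rabs; lra).
  apply Rle_lt_trans with ((Rabs (1 - l) + Rabs l) * rho).
  - assert (H2 := Rabs_pos (1 - l)). assert (H3 := Cmod_ge_0 z). nra.
  - apply Rle_lt_trans with ((1 + 2 * dl) * rho); [nra|].
    unfold dl. replace ((1 + 2 * ((R0 - rho) / (4 * rho))) * rho) with ((R0 + rho) / 2)
      by (field; lra). lra.
Qed.

(** The circles shrunk towards z by different factors are disjoint. Otherwise a point of the full
    circle would be a convex combination of another point of the circle and of z, with positive
    weight on z, and its modulus would be less than rho. *)
Lemma pt_exception : exists ls, forall l t, 0 < l -> l <> ls -> pt l t <> t0.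
Proof.
  destruct (classic (exists l t, 0 < l /\ pt l t = t0)) as [(l1 & t1 & Hl1 & E1)|Hn].
  2:{ exists 0. intros l t Hl _ E. apply Hn. now exists l, t. }
  exists l1. intros l2 t2 Hl2 Hne E2. unfold pt in *.
  assert (Hlt : forall l l' t t', 0 < l < l' ->
    (z + RtoC l * (RtoC rho * cis t - z) = z + RtoC l' * (RtoC rho * cis t' - z))%C -> False).
  { clear - Hrho Hz. intros l l' t t' Hl E.
    assert (E' : (RtoC rho * cis t')%C = (RtoC (1 - l / l') * z + RtoC (l / l') * (RtoC rho * cis t))%C).
    { assert (Hl' : RtoC l' <> 0%C) by (intros H; apply RtoC_inj in H; lra).
      assert (E2 : (RtoC l' * (RtoC rho * cis t' - z) = RtoC l * (RtoC rho * cis t - z))%C).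
      { replace (RtoC l' * (RtoC rho * cis t' - z))%C with
          (z + RtoC l' * (RtoC rho * cis t' - z) - z)%C by ring. rewrite <- E. ring. }
      rewrite RtoC_minus, RtoC_div by lra.
      replace (RtoC rho * cis t')%C with (z + (RtoC l' * (RtoC rho * cis t' - z)) / RtoC l')%C
        by (field; easy).
      rewrite E2. field. easy. }
    assert (Hm : Cmod (RtoC rho * cis t')%C = rho).
    { rewrite Cmod_mult, Cmod_cis, Cmod_R, Rabs_pos_eq; lra. }
    assert (Hq : 0 < l / l' < 1).
    { split; [apply Rdiv_lt_0_compat; lra|]. apply Rlt_div_l; lra. }
    assert (H := Cmod_triangle (RtoC (1 - l / l') * z)%C (RtoC (l / l') * (RtoC rho * cis t))%C).
    rewrite <- E', Hm, !Cmod_mult, Cmod_cis, !Cmod_R, !Rabs_pos_eq in H by lra.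
    nra. }
  destruct (Rtotal_order l1 l2) as [H|[H|H]].
  - apply (Hlt l1 l2 t1 t2); [lra | congruence].
  - now apply Hne.
  - apply (Hlt l2 l1 t2 t1); [lra | congruence].
Qed.

Lemma pt_continuous (l t : R) : continuous (fun u : R * R => pt (fst u) (snd u)) (l, t).
Proof.
  unfold pt. apply continuous_Cplus; [apply continuous_const|].
  assert (H : continuous (fun u : R * R => cis (snd u)) (l, t)).
  { apply (continuous_comp snd cis); [apply continuous_snd | apply cis_continuous]. }
  apply continuous_Cmult.
  - apply (continuous_comp fst RtoC); [apply continuous_fst | apply continuous_RtoC].
  - apply continuous_Cminus; [|apply continuous_const].
    apply continuous_Cmult; [apply continuous_const | exact H].
Qed.

Lemma kap_continuous t : continuous kap t.
Proof.
  unfold kap. apply continuous_Cmult.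
  - apply continuous_Cmult; [apply continuous_const | apply cis_continuous].
  - apply continuous_Cinv; [|apply circle_neq]. apply continuous_Cminus; [|apply continuous_const].
    apply continuous_Cmult; [apply continuous_const | apply cis_continuous].
Qed.

Section Part.
(** The real or the imaginary part: differentiation under the integral and the mean value theorem
    are applied to real functions. *)
Variable part : C -> R.
Hypothesis part_cont : forall (U : UniformSpace) (f : U -> C) x,
  continuous f x -> continuous (fun u => part (f u)) x.
Hypothesis part_derive : forall (f : R -> C) t l, is_derive (V := C_R_NormedModule) f t l ->
  is_derive (fun u => part (f u)) t (part l).
Hypothesis part_int : forall (f : R -> C) a b l,
  is_RInt (V := C_R_NormedModule) f a b l -> is_RInt (fun u => part (f u)) a b (part l).
Hypothesis part0 : part 0%C = 0.

Let G (l t : R) : R := part (h (pt l t) * kap t)%C.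
Let psi (l : R) : R := RInt (G l) 0 (2 * PI).

Lemma G_continuous l t : - dl < l < 1 + dl -> continuity_2d_pt G l t.
Proof.
  intros Hl. apply continuity_2d_pt_filterlim.
  assert (K1 : continuous (fun u : R * R => h (pt (fst u) (snd u))) (l, t)).
  { apply (continuous_comp (fun u : R * R => pt (fst u) (snd u)) h).
    - apply pt_continuous.
    - now apply Hh, pt_in. }
  assert (K2 : continuous (fun u : R * R => kap (snd u)) (l, t)).
  { apply (continuous_comp snd kap); [apply continuous_snd | apply kap_continuous]. }
  exact (part_cont _ _ _ (continuous_Cmult _ _ _ _ K1 K2)).
Qed.

Lemma G_ex_RInt l : - dl < l < 1 + dl -> ex_RInt (G l) 0 (2 * PI).
Proof.
  intros Hl. apply (ex_RInt_continuous (V := R_CompleteNormedModule)). intros t _.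
  apply (continuous_comp_2 (fun _ : R => l) (fun t : R => t) G).
  - apply continuous_const.
  - apply continuous_id.
  - apply continuity_2d_pt_filterlim. now apply G_continuous.
Qed.

Lemma psi_continuous l : 0 <= l <= 1 -> continuity_pt psi l.
Proof.
  intros Hl. assert (Hpi := PI_RGT_0).
  assert (Hdl : 0 < dl) by (apply Rdiv_lt_0_compat; lra).
  apply continuity_pt_locally. intros eps.
  assert (He : 0 < eps / (4 * PI)) by (apply Rdiv_lt_0_compat; [apply cond_pos | lra]).
  destruct (uniform_continuity_2d G (- dl / 2) (1 + dl / 2) 0 (2 * PI)
    (fun x y Hx _ => G_continuous x y ltac:(lra)) (mkposreal _ He)) as [d Hd].
  apply locally_R_eps. exists (Rmin d (dl / 2)). split.
  { apply Rmin_glb_lt; [apply cond_pos | lra]. }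
  intros y Hy.
  assert (Hy1 : Rabs (y - l) < d) by (eapply Rlt_le_trans; [exact Hy | apply Rmin_l]).
  assert (Hy2 : Rabs (y - l) < dl / 2) by (eapply Rlt_le_trans; [exact Hy | apply Rmin_r]).
  apply Rabs_def2 in Hy2.
  unfold psi.
  assert (I1 := RInt_correct (V := R_CompleteNormedModule) _ _ _ (G_ex_RInt y ltac:(lra))).
  assert (I2 := RInt_correct (V := R_CompleteNormedModule) _ _ _ (G_ex_RInt l ltac:(lra))).
  assert (I := is_RInt_minus (V := R_NormedModule) _ _ _ _ _ _ I1 I2).
  assert (B := norm_RInt_le (V := R_NormedModule) _ (fun _ => eps / (4 * PI)) 0 (2 * PI) _ _
    ltac:(lra)
    (fun t Ht => Rlt_le _ _ (Hd l t y t ltac:(lra) Ht ltac:(lra) Ht Hy1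
       ltac:(rewrite Rminus_diag, Rabs_R0; apply cond_pos))) I
    (is_RInt_const (V := R_NormedModule) 0 (2 * PI) (eps / (4 * PI)))).
  eapply Rle_lt_trans; [exact B|]. unfold scal; simpl. unfold mult; simpl.
  replace ((2 * PI - 0) * (eps / (4 * PI))) with (eps / 2) by (field; lra).
  generalize (cond_pos eps). lra.
Qed.

(** The kernel is chosen so that the l-derivative of the integrand is h'(pt) rho cis t. In t this
    has the primitive h(pt)/(l i), which takes the same value at 0 and at 2 PI. *)
Lemma psi_derive ls l : (forall l t, 0 < l -> l <> ls -> pt l t <> t0) ->
  0 < l < 1 -> l <> ls -> is_derive psi l 0.
Proof.
  intros Hls Hl Hne. assert (Hpi := PI_RGT_0).
  assert (Hdl : 0 < dl) by (apply Rdiv_lt_0_compat; lra).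
  set (DG l t := part (h' (pt l t) * (RtoC rho * cis t))%C).
  assert (Hnear : locally l (fun u => 0 < u < 1 /\ u <> ls)).
  { apply locally_R_eps. exists (Rmin (Rmin l (1 - l)) (Rabs (l - ls))). split.
    { apply Rmin_glb_lt; [apply Rmin_glb_lt; lra|]. apply Rabs_pos_lt. lra. }
    intros u Hu.
    assert (H1 : Rabs (u - l) < Rmin l (1 - l)) by (eapply Rlt_le_trans; [exact Hu | apply Rmin_l]).
    assert (H2 : Rabs (u - l) < Rabs (l - ls)) by (eapply Rlt_le_trans; [exact Hu | apply Rmin_r]).
    assert (H3 := Rmin_l l (1 - l)). assert (H4 := Rmin_r l (1 - l)).
    apply Rabs_def2 in H1. split; [lra|]. intros ->. rewrite Rabs_minus_sym in H2. lra. }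
  assert (Hpt : forall u t, 0 < u < 1 -> u <> ls -> Cmod (pt u t) < R0 /\ pt u t <> t0).
  { intros u t Hu Hun. split; [apply pt_in; lra | apply Hls; lra]. }
  assert (Hder : forall u t, 0 < u < 1 -> u <> ls -> is_derive (fun v => G v t) u (DG u t)).
  { intros u t Hu Hun. destruct (Hpt u t Hu Hun) as [P1 P2].
    apply part_derive.
    assert (H := C_deriv_curve (fun y => h y * kap t)%C (fun v => pt v t) u _ _
      (C_deriv_mult _ _ _ _ _ (proj1 (Hh' _ P1 P2)) (C_deriv_const (kap t) _))
      (line_derive z (RtoC rho * cis t - z)%C u)).
    cbv beta in H.
    match type of H with is_derive _ _ ?m =>
      replace m with (h' (pt u t) * (RtoC rho * cis t))%C in H; [exact H|] end.
    unfold kap. field. apply circle_neq. }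
  assert (HDc : forall u t, 0 < u < 1 -> u <> ls -> continuity_2d_pt DG u t).
  { intros u t Hu Hun. destruct (Hpt u t Hu Hun) as [P1 P2].
    apply continuity_2d_pt_filterlim.
    assert (K1 : continuous (fun v : R * R => h' (pt (fst v) (snd v))) (u, t)).
    { apply (continuous_comp (fun v : R * R => pt (fst v) (snd v)) h').
      - apply pt_continuous.
      - now apply Hh'. }
    assert (K2 : continuous (fun v : R * R => cis (snd v)) (u, t)).
    { apply (continuous_comp snd cis); [apply continuous_snd | apply cis_continuous]. }
    exact (part_cont _ _ _ (continuous_Cmult _ _ _ _ K1
      (continuous_Cmult _ _ _ _ (continuous_const _ _) K2))). }
  assert (HD : is_derive psi l (RInt (fun t => Derive (fun u => G u t) l) 0 (2 * PI))).
  { apply is_derive_RInt_param.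
    - revert Hnear. apply filter_imp. intros u [Hu Hun] t _. eexists. now apply Hder.
    - intros t _. apply continuity_2d_pt_ext_loc with DG; [|now apply HDc].
      apply locally_2d_locally.
      destruct (proj1 (locally_R_eps _ _) Hnear) as (d & Hd & H).
      exists (mkposreal d Hd). intros [u v] [Hu _]. simpl.
      destruct (H u Hu) as [H1 H2]. symmetry. apply is_derive_unique. now apply Hder.
    - revert Hnear. apply filter_imp. intros u [Hu _]. apply G_ex_RInt. lra. }
  assert (E : RInt (fun t => Derive (fun u => G u t) l) 0 (2 * PI) = 0); [|now rewrite E in HD].
  rewrite (RInt_ext (V := R_CompleteNormedModule) _ (DG l)).
  2:{ intros t _. apply is_derive_unique. now apply Hder. }
  apply (is_RInt_unique (V := R_CompleteNormedModule)).
  replace (0 : R_CompleteNormedModule) with (part 0%C) at 2.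
  apply part_int.
  assert (Hl0 : RtoC l <> 0%C) by (intros H; apply RtoC_inj in H; lra).
  set (P t := (h (pt l t) * / (RtoC l * Ci))%C).
  apply is_RInt_val with (minus (P (2 * PI)) (P 0)).
  - apply (is_RInt_derive (V := C_R_CompleteNormedModule) P).
    + intros t _. destruct (Hpt l t Hl Hne) as [P1 P2].
      assert (Hcurve : is_derive (V := C_R_NormedModule) (fun t => pt l t) t
        (RtoC l * (RtoC rho * (Ci * cis t)))%C).
      { assert (H0 : C_deriv (fun y => z + RtoC l * (RtoC rho * y - z))%C (cis t)
          (RtoC l * RtoC rho)%C).
        { exists (fun _ => RtoC l * RtoC rho)%C.
          split; [apply continuous_const | split; [reflexivity | intros; ring]]. }
        assert (H2 := C_deriv_curve _ cis t _ _ H0 (cis_derive t)).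
        replace (RtoC l * (RtoC rho * (Ci * cis t)))%C with
          (RtoC l * RtoC rho * (Ci * cis t))%C by ring. exact H2. }
      assert (H := C_deriv_curve (fun y => h y * / (RtoC l * Ci))%C (fun t => pt l t) t _ _
        (C_deriv_mult _ _ _ _ _ (proj1 (Hh' _ P1 P2)) (C_deriv_const (/ (RtoC l * Ci))%C _)) Hcurve).
      cbv beta in H.
    match type of H with is_derive _ _ ?m =>
        replace m with (h' (pt l t) * (RtoC rho * cis t))%C in H; [exact H|] end.
      field. split; [exact Ci_nz | exact Hl0].
    + intros t _. destruct (Hpt l t Hl Hne) as [P1 P2]. apply continuous_Cmult.
      * apply (continuous_comp (fun t => pt l t) h'); [|now apply Hh'].
        apply (continuous_comp_2 (fun _ : R => l) (fun t : R => t) pt);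
          [apply continuous_const | apply continuous_id | apply pt_continuous].
      * apply continuous_Cmult; [apply continuous_const | apply cis_continuous].
  - assert (E : pt l (2 * PI) = pt l 0).
    { unfold pt, cis. now rewrite cos_2PI, sin_2PI, cos_0, sin_0. }
    unfold P. rewrite E.
    assert (E2 : forall a : C, (a - a)%C = 0%C) by (intros; ring). apply E2.
Qed.

Lemma psi_const : psi 1 = psi 0.
Proof.
  destruct pt_exception as [ls Hls].
  assert (H : forall a b, 0 <= a <= b -> b <= 1 -> (forall x, a < x < b -> x <> ls) -> psi a = psi b).
  { intros a b Hab Hb Hx. destruct (MVT_gen psi a b (fun _ => 0)) as (x & _ & E).
    - rewrite Rmin_left, Rmax_right by lra. intros x Hax.
      apply (psi_derive ls); [easy | lra | now apply Hx].
    - rewrite Rmin_left, Rmax_right by lra. intros x Hax. apply psi_continuous. lra.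
    - lra. }
  (* psi is constant on either side of the exceptional value, and its continuity joins the two
     sides. *)
  destruct (Rlt_dec 0 ls) as [H0|H0]; [destruct (Rlt_dec ls 1) as [H1|H1]|].
  - rewrite <- (H ls 1), <- (H 0 ls); try lra; intros x Hx; lra.
  - symmetry. apply H; try lra. intros x Hx; lra.
  - symmetry. apply H; try lra. intros x Hx; lra.
Qed.

Lemma cauchy_part : RInt (fun t => part (h (RtoC rho * cis t) * kap t)%C) 0 (2 * PI) =
  RInt (fun t => part (h z * kap t)%C) 0 (2 * PI).
Proof.
  assert (H := psi_const). unfold psi, G in H.
  rewrite (RInt_ext (V := R_CompleteNormedModule) _
    (fun t => part (h (pt 1 t) * kap t)%C)), H.
  - apply (RInt_ext (V := R_CompleteNormedModule)). intros t _. do 3 f_equal. unfold pt. ring.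
  - intros t _. do 3 f_equal. unfold pt. ring.
Qed.

End Part.
End CauchyDisc.

(** * Power series on a disc *)

Lemma is_series_C_geom q : Cmod q < 1 ->
  is_series (V := C_R_NormedModule) (fun k => q ^ k)%C (/ (1 - q))%C.
Proof.
  intros Hq. assert (H1 : (1 - q)%C <> 0%C).
  { intros E. apply Ceq_minus in E. rewrite <- E, Cmod_1 in Hq. lra. }
  assert (Hp := proj1 (Cmod_gt_0 _) H1).
  apply (is_series_eps C_R_NormedModule). intros eps He.
  assert (E : forall n, sum_n (fun k => q ^ k : C_R_NormedModule)%C n = ((1 - q ^ S n) / (1 - q))%C).
  { induction n as [|n IH].
    - rewrite sum_O. simpl. field. easy.
    - rewrite sum_Sn, IH.
      assert (E : ((1 - q ^ S n) / (1 - q) + q ^ S n = (1 - q ^ S (S n)) / (1 - q))%C)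
        by (rewrite (Cpow_S q (S n)); field; easy).
      exact E. }
  destruct (pow_lt_1_zero (Cmod q) ltac:(rewrite Rabs_pos_eq; [easy | apply Cmod_ge_0])
    (eps * Cmod (1 - q)%C) ltac:(apply Rmult_lt_0_compat; lra)) as [N HN].
  exists N. intros n Hn.
  eapply Rle_lt_trans; [right; exact (f_equal (fun v : C_R_NormedModule => norm (minus v (/ (1 - q))%C)) (E n))|].
  change (norm ((1 - q ^ S n) / (1 - q) - / (1 - q) : C_R_NormedModule)%C < eps). rewrite norm_C.
  replace ((1 - q ^ S n) / (1 - q) - / (1 - q))%C with (- (q ^ S n) / (1 - q))%C by (field; easy).
  rewrite Cmod_div, Cmod_opp, Cmod_pow by easy. apply Rlt_div_l; [easy|].
  specialize (HN (S n) ltac:(lia)). rewrite Rabs_pos_eq in HN; [easy|].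
  apply pow_le, Cmod_ge_0.
Qed.

Lemma circle_kernel_series (v : R -> C) rho z H (m : nat -> C) :
  0 < rho -> Cmod z < rho ->
  (forall t, 0 <= t <= 2 * PI -> Cmod (v t) <= H) ->
  (forall k, is_RInt (V := C_R_NormedModule) (fun t => v t * (/ (RtoC rho * cis t)) ^ k)%C 0 (2 * PI) (m k)) ->
  exists L, is_series (V := C_R_NormedModule) (fun k => z ^ k * m k)%C L /\
    is_RInt (V := C_R_NormedModule)
      (fun t => v t * (RtoC rho * cis t / (RtoC rho * cis t - z)))%C 0 (2 * PI) L.
Proof.
  intros Hrho Hz HH Hm. assert (Hpi := PI_RGT_0).
  assert (Hmod : forall t, Cmod (RtoC rho * cis t)%C = rho).
  { intros t. rewrite Cmod_mult, Cmod_cis, Cmod_R, Rabs_pos_eq; lra. }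
  assert (Hne : forall t, (RtoC rho * cis t)%C <> 0%C).
  { intros t E. specialize (Hmod t). rewrite E, Cmod_0 in Hmod. lra. }
  assert (Hq : 0 <= Cmod z / rho < 1).
  { split; [apply Rdiv_le_0_compat; [apply Cmod_ge_0 | lra]|]. apply Rlt_div_l; lra. }
  apply (is_RInt_series C_R_CompleteNormedModule
    (fun k t => z ^ k * (v t * (/ (RtoC rho * cis t)) ^ k))%C _ 0 (2 * PI)
    (fun k => z ^ k * m k)%C (fun k => H * (Cmod z / rho) ^ k)).
  - lra.
  - intros k. apply (is_RInt_linear C_R_NormedModule C_R_NormedModule (fun y => z ^ k * y)%C);
      [apply Cmult_linear | apply Hm].
  - intros k t Ht. eapply Rle_trans; [right; apply norm_C|].
    rewrite !Cmod_mult, !Cmod_pow, Cmod_inv, Hmod by easy.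
    unfold Rdiv. rewrite Rpow_mult_distr.
    replace (Cmod z ^ k * (Cmod (v t) * (/ rho) ^ k)) with
      (Cmod (v t) * (Cmod z ^ k * (/ rho) ^ k)) by ring.
    apply Rmult_le_compat_r; [|now apply HH].
    apply Rmult_le_pos; apply pow_le; [apply Cmod_ge_0|].
    left; now apply Rinv_0_lt_compat.
  - eexists. now apply is_series_geom_scal.
  - intros t Ht.
    assert (Hzq : Cmod (z / (RtoC rho * cis t))%C < 1).
    { rewrite Cmod_div, Hmod by easy. apply Hq. }
    assert (HS := is_series_linear C_R_NormedModule C_R_NormedModule (fun y => v t * y)%C _ _
      (Cmult_linear (v t)) (is_series_C_geom _ Hzq)).
    assert (E : (RtoC rho * cis t / (RtoC rho * cis t - z))%C = (/ (1 - z / (RtoC rho * cis t)))%C).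
    { assert (H0 : (RtoC rho * cis t - z)%C <> 0%C).
      { intros E. apply Ceq_minus in E. rewrite <- E, Hmod in Hz. lra. }
      generalize (Hne t) H0. generalize (RtoC rho * cis t)%C. intros X HX HXz.
      field. easy. }
    rewrite E. revert HS. apply is_series_ext. intros k.
    assert (E2 : (v t * (z / (RtoC rho * cis t)) ^ k = z ^ k * (v t * (/ (RtoC rho * cis t)) ^ k))%C).
    { unfold Cdiv. rewrite Cpow_mult_l. ring. }
    exact E2.
Qed.

Lemma disc_expansion (h h' : C -> C) (R0 rho : R) (t0 : C) :
  0 < rho < R0 -> (forall t, Cmod t < R0 -> continuous h t) ->
  (forall t, Cmod t < R0 -> t <> t0 -> C_deriv h t (h' t) /\ continuous h' t) ->
  exists (a : nat -> C) (M : R), (forall k, Cmod (a k) <= M / rho ^ k) /\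
    forall z, Cmod z < rho ->
      is_series (V := C_R_NormedModule) (fun k => z ^ k * a k)%C (h z).
Proof.
  intros Hrho Hh Hh'. assert (Hpi := PI_RGT_0).
  assert (Hmod : forall t, Cmod (RtoC rho * cis t)%C = rho).
  { intros t. rewrite Cmod_mult, Cmod_cis, Cmod_R, Rabs_pos_eq; lra. }
  assert (Hne : forall t, (RtoC rho * cis t)%C <> 0%C).
  { intros t E. specialize (Hmod t). rewrite E, Cmod_0 in Hmod. lra. }
  assert (Hcc : forall t : R, continuous (fun t => RtoC rho * cis t)%C t).
  { intros t. apply continuous_Cmult; [apply continuous_const | apply cis_continuous]. }
  assert (Hci : forall (t : R) k, continuous (fun t => (/ (RtoC rho * cis t)) ^ k)%C t).
  { intros t k. apply continuous_Cpow, continuous_Cinv; [apply Hcc | apply Hne]. }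
  set (v t := h (RtoC rho * cis t)%C).
  assert (Hv : forall t, continuous v t).
  { intros t. apply (continuous_comp (fun t => RtoC rho * cis t)%C h); [apply Hcc|].
    apply Hh. rewrite Hmod. lra. }
  destruct (bounded_continuity (V := C_R_NormedModule) v 0 (2 * PI) (fun t _ => Hv t)) as [H HH].
  assert (HH' : forall t, 0 <= t <= 2 * PI -> Cmod (v t) <= H).
  { intros t Ht. rewrite <- norm_C. left. now apply HH. }
  assert (Hm : forall k, exists m, is_RInt (V := C_R_NormedModule)
    (fun t => v t * (/ (RtoC rho * cis t)) ^ k)%C 0 (2 * PI) m).
  { intros k. apply (ex_RInt_continuous (V := C_R_CompleteNormedModule)). intros t _.
    apply continuous_Cmult; [apply Hv | apply Hci]. }
  set (m k := proj1_sig (constructive_indefinite_description _ (Hm k))).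
  assert (Hmk : forall k, is_RInt (V := C_R_NormedModule)
    (fun t => v t * (/ (RtoC rho * cis t)) ^ k)%C 0 (2 * PI) (m k)).
  { intros k. unfold m. now destruct (constructive_indefinite_description _ (Hm k)). }
  assert (H2pi : RtoC (2 * PI) <> 0%C) by (intros E; apply RtoC_inj in E; lra).
  exists (fun k => / RtoC (2 * PI) * m k)%C, H. split.
  - intros k. rewrite Cmod_mult, Cmod_inv, Cmod_R, Rabs_pos_eq by (easy || lra).
    assert (B := norm_RInt_le (V := C_R_NormedModule)
      (fun t => v t * (/ (RtoC rho * cis t)) ^ k)%C (fun _ => H / rho ^ k) 0 (2 * PI) (m k)
      (scal (2 * PI - 0) (H / rho ^ k)) ltac:(lra)).
    rewrite <- norm_C. apply Rmult_le_reg_l with (2 * PI); [lra|].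
    rewrite <- Rmult_assoc, Rinv_r, Rmult_1_l by lra.
    eapply Rle_trans; [apply B|].
    + intros t Ht. rewrite norm_C, Cmod_mult, Cmod_pow, Cmod_inv, Hmod, pow_inv by easy.
      apply Rmult_le_compat_r; [|now apply HH'].
      left. apply Rinv_0_lt_compat, pow_lt. lra.
    + apply Hmk.
    + apply (is_RInt_const (V := R_NormedModule)).
    + right. unfold scal; simpl. unfold mult; simpl. ring.
  - intros z Hz.
    destruct (circle_kernel_series v rho z H m) as (L1 & S1 & I1);
      [lra | easy | easy | easy |].
    (* The same expansion with h z in place of the boundary values: only k = 0 contributes, so this
       side of [cauchy_part] equals 2 pi h z. *)
    destruct (circle_kernel_series (fun _ => h z) rho z (Cmod (h z))
      (fun k => h z * (RtoC (/ rho) ^ k * (if Nat.eqb 0 k then RtoC (2 * PI) else RtoC 0)))%C)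
      as (L2 & S2 & I2); [lra | easy | intros; apply Rle_refl | |].
    { intros k.
      apply (is_RInt_ext (V := C_R_NormedModule))
        with (fun t => h z * (RtoC (/ rho) ^ k * cis ((INR 0 - INR k) * t)))%C.
      { intros t _. f_equal.
        rewrite Cpow_inv, Cpow_mult_l by easy. rewrite RtoC_inv, Cpow_inv by
          (try (intros E; apply RtoC_inj in E); lra).
        assert (Ec : (cis ((INR 0 - INR k) * t) * cis t ^ k = 1)%C).
        { rewrite <- cis_INR, <- cis_plus. replace ((INR 0 - INR k) * t + INR k * t) with 0
            by (simpl; ring). unfold cis. now rewrite cos_0, sin_0. }
        assert (Hc : (cis t ^ k)%C <> 0%C).
        { apply Cpow_nz. intros E. apply (Hne t). rewrite E. ring. }
        assert (Hr : (RtoC rho ^ k)%C <> 0%C).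
        { apply Cpow_nz. intros E. apply RtoC_inj in E. lra. }
        replace (cis ((INR 0 - INR k) * t)) with
          ((cis ((INR 0 - INR k) * t) * cis t ^ k) * / (cis t ^ k))%C by (field; easy).
        rewrite Ec. field. easy. }
      apply (is_RInt_linear C_R_NormedModule C_R_NormedModule (fun y => h z * y)%C);
        [apply Cmult_linear|].
      apply (is_RInt_linear C_R_NormedModule C_R_NormedModule (fun y => RtoC (/ rho) ^ k * y)%C);
        [apply Cmult_linear|].
      apply is_RInt_cis. }
    assert (E2 : L2 = (RtoC (2 * PI) * h z)%C).
    { apply (is_series_unique_V C_R_NormedModule _ _ _ S2).
      apply (is_series_eps C_R_NormedModule). intros eps He. exists 0%nat. intros n _.
      eapply Rle_lt_trans; [|exact He]. right.
      transitivity (norm (zero : C_R_NormedModule)); [|exact norm_zero].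
      assert (E : sum_n (fun k => z ^ k * (h z * (RtoC (/ rho) ^ k *
        (if Nat.eqb 0 k then RtoC (2 * PI) else RtoC 0))) : C_R_NormedModule)%C n =
        (RtoC (2 * PI) * h z)%C).
      { induction n as [|n IH].
        - rewrite sum_O. simpl. ring.
        - rewrite sum_Sn, IH. simpl Nat.eqb. cbv iota.
          assert (E : (RtoC (2 * PI) * h z + z ^ S n * (h z * (RtoC (/ rho) ^ S n * RtoC 0)) =
            RtoC (2 * PI) * h z)%C) by ring.
          exact E. }
      etransitivity; [exact (f_equal (fun u : C_R_NormedModule => norm (minus u (RtoC (2 * PI) * h z)%C)) E)|].
      f_equal.
      assert (E0 : (RtoC (2 * PI) * h z - RtoC (2 * PI) * h z)%C = 0%C) by ring. exact E0. }
    assert (E1 : L1 = L2).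
    { apply injective_projections.
      - assert (K := cauchy_part h h' R0 rho t0 Hrho Hh Hh' z Hz fst
          (fun U f x => continuous_C_fst U f x) C_derive_fst
          (fun f a b l => is_RInt_linear C_R_NormedModule R_NormedModule fst f a b l
             (is_linear_fst (U := R_NormedModule) (V := R_NormedModule))) eq_refl).
        apply (is_RInt_linear C_R_NormedModule R_NormedModule fst) in I1;
          [|apply (is_linear_fst (U := R_NormedModule) (V := R_NormedModule))].
        apply (is_RInt_linear C_R_NormedModule R_NormedModule fst) in I2;
          [|apply (is_linear_fst (U := R_NormedModule) (V := R_NormedModule))].
        apply (is_RInt_unique (V := R_CompleteNormedModule)) in I1.
        apply (is_RInt_unique (V := R_CompleteNormedModule)) in I2.
        rewrite <- I1, <- I2. exact K.
      - assert (K := cauchy_part h h' R0 rho t0 Hrho Hh Hh' z Hz snd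
          (fun U f x => continuous_C_snd U f x) C_derive_snd
          (fun f a b l => is_RInt_linear C_R_NormedModule R_NormedModule snd f a b l
             (is_linear_snd (U := R_NormedModule) (V := R_NormedModule))) eq_refl).
        apply (is_RInt_linear C_R_NormedModule R_NormedModule snd) in I1;
          [|apply (is_linear_snd (U := R_NormedModule) (V := R_NormedModule))].
        apply (is_RInt_linear C_R_NormedModule R_NormedModule snd) in I2;
          [|apply (is_linear_snd (U := R_NormedModule) (V := R_NormedModule))].
        apply (is_RInt_unique (V := R_CompleteNormedModule)) in I1.
        apply (is_RInt_unique (V := R_CompleteNormedModule)) in I2.
        rewrite <- I1, <- I2. exact K. }
    assert (S := is_series_linear C_R_NormedModule C_R_NormedModule (fun y => / RtoC (2 * PI) * y)%C _ _
      (Cmult_linear (/ RtoC (2 * PI))%C) S1).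
    rewrite E1, E2 in S.
    replace (/ RtoC (2 * PI) * (RtoC (2 * PI) * h z))%C with (h z) in S by (field; easy).
    revert S. apply is_series_ext. intros k.
    assert (E : (/ RtoC (2 * PI) * (z ^ k * m k) = z ^ k * (/ RtoC (2 * PI) * m k))%C) by ring.
    exact E.
Qed.

(* The even part [E] of [G] as a function of t = p z.  It is only continuous at the
   critical value t = e2, where the two preimages merge. *)
Section EvenPart.
Variables (xi : C) (e2 R0 : R) (G G' : C -> C).
Let p (z : C) : C := ((z - xi) * (z - xi) + RtoC e2)%C.
Hypothesis HG : forall z, Cmod (p z) < R0 -> continuous G z.
Hypothesis HG' : forall z, Cmod (p z) < R0 -> z <> xi -> C_deriv G z (G' z) /\ continuous G' z.

Let sg (t : C) : C := Csqrt (t - RtoC e2)%C.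
Let E (t : C) : C := (/ 2 * (G (xi + sg t) + G (xi - sg t)))%C.
Let E' (t : C) : C := ((G' (xi + sg t) - G' (xi - sg t)) / (4 * sg t))%C.

Lemma two_neq0 : RtoC 2 <> 0%C.
Proof. intros H. apply RtoC_inj in H. lra. Qed.

Lemma four_neq0 : RtoC 4 <> 0%C.
Proof. intros H. apply RtoC_inj in H. lra. Qed.

Lemma sg_sq t : (sg t * sg t)%C = (t - RtoC e2)%C.
Proof. apply Csqrt_mul. Qed.

(** Take the root closer to s0 = [sg t1]. As (s - s0)(s + s0) = t - t1 and |s - s0| <= |s + s0|, one
    has |s - s0|^2 <= |t - t1|, which is continuity at t1. If s0 <> 0, the difference quotient is
    1/(s + s0). *)
Lemma sqrt_branch t1 : exists s : C -> C,
  s t1 = sg t1 /\ (forall t, s t = sg t \/ s t = (- sg t)%C) /\ continuous s t1 /\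
  (sg t1 <> 0%C -> C_deriv s t1 (/ (2 * sg t1))%C).
Proof.
  set (s0 := sg t1).
  set (s t := if Rle_dec (Cmod (sg t - s0)%C) (Cmod (sg t + s0)%C) then sg t else (- sg t)%C).
  assert (Hs : forall t, s t = sg t \/ s t = (- sg t)%C).
  { intros t. unfold s. destruct (Rle_dec _ _); [now left | now right]. }
  assert (Hsq : forall t, (s t * s t)%C = (t - RtoC e2)%C).
  { intros t. rewrite <- sg_sq. destruct (Hs t) as [-> | ->]; ring. }
  assert (Hle : forall t, Cmod (s t - s0)%C <= Cmod (s t + s0)%C).
  { intros t. unfold s. destruct (Rle_dec _ _) as [H|H]; [easy|].
    apply Rnot_le_lt in H. rewrite <- Cmod_opp, <- (Cmod_opp (- sg t + s0)).
    replace (- (- sg t - s0))%C with (sg t + s0)%C by ring.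
    replace (- (- sg t + s0))%C with (sg t - s0)%C by ring. lra. }
  assert (H1 : s t1 = s0).
  { unfold s. destruct (Rle_dec _ _) as [H|H]; [easy|]. exfalso. apply H.
    fold s0. replace (s0 - s0)%C with (RtoC 0) by ring. rewrite Cmod_0. apply Cmod_ge_0. }
  assert (Hd : forall t, ((s t - s0) * (s t + s0))%C = (t - t1)%C).
  { intros t. replace ((s t - s0) * (s t + s0))%C with (s t * s t - s0 * s0)%C by ring.
    unfold s0. rewrite Hsq, sg_sq. ring. }
  assert (Hc : continuous s t1).
  { apply (continuous_C_eps C_R_NormedModule). intros eps He. exists (eps * eps).
    split; [nra|]. intros t Ht.
    change (norm (s t - s t1 : C_R_NormedModule)%C < eps). rewrite norm_C, H1.
    rewrite <- Hd, Cmod_mult in Ht. specialize (Hle t).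
    assert (H0 := Cmod_ge_0 (s t - s0)%C). nra. }
  exists s. split; [easy|]. split; [easy|]. split; [easy|]. intros Hs0.
  assert (Hn : forall t, (s t + s0)%C <> 0%C).
  { intros t H. specialize (Hle t). rewrite H, Cmod_0 in Hle.
    assert (H2 : (s t - s0)%C = 0%C).
    { apply Cmod_eq_0. apply Rle_antisym; [easy | apply Cmod_ge_0]. }
    apply Hs0. replace s0 with (/ 2 * ((s t + s0) - (s t - s0)))%C by (field; apply two_neq0).
    rewrite H, H2. ring. }
  exists (fun t => / (s t + s0))%C. split; [|split].
  - apply continuous_Cinv; [|apply Hn].
    apply continuous_Cplus; [easy | apply continuous_const].
  - rewrite H1. f_equal. ring.
  - intros t. rewrite H1, <- Hd. field. apply Hn.
Qed.

Lemma p_sqrt t s : s = sg t \/ s = (- sg t)%C -> p (xi + s)%C = t /\ p (xi - s)%C = t.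
Proof.
  intros H. unfold p.
  replace ((xi + s - xi) * (xi + s - xi))%C with (s * s)%C by ring.
  replace ((xi - s - xi) * (xi - s - xi))%C with (s * s)%C by ring.
  replace (s * s)%C with (sg t * sg t)%C by (destruct H as [-> | ->]; ring).
  rewrite sg_sq. split; ring.
Qed.

(** E is unchanged when the root changes sign, so the arbitrary root may be replaced by the branch
    that is continuous at t. *)
Lemma even_part_continuous t : Cmod t < R0 -> continuous E t.
Proof.
  intros Ht. destruct (sqrt_branch t) as (s & H1 & Hs & Hc & _).
  destruct (p_sqrt t (s t) (Hs t)) as [P1 P2].
  apply continuous_ext with (fun u => / 2 * (G (xi + s u) + G (xi - s u)))%C.
  { intros u. unfold E. destruct (Hs u) as [-> | ->]; [easy|].
    assert (K : (/ 2 * (G (xi + - sg u) + G (xi - - sg u)) =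
      / 2 * (G (xi + sg u) + G (xi - sg u)))%C).
    { replace (xi - - sg u)%C with (xi + sg u)%C by ring.
      replace (xi + - sg u)%C with (xi - sg u)%C by ring. ring. }
    exact K. }
  apply continuous_Cmult; [apply continuous_const|].
  apply continuous_Cplus.
  - apply (continuous_comp (fun u => xi + s u)%C G).
    + apply continuous_Cplus; [apply continuous_const | easy].
    + apply HG. now rewrite P1.
  - apply (continuous_comp (fun u => xi - s u)%C G).
    + apply continuous_Cminus; [apply continuous_const | easy].
    + apply HG. now rewrite P2.
Qed.

Lemma even_part_deriv t : Cmod t < R0 -> t <> RtoC e2 -> C_deriv E t (E' t) /\ continuous E' t.
Proof.
  intros Ht Hne. destruct (sqrt_branch t) as (s & H1 & Hs & Hc & Hd).
  assert (Hsg : sg t <> 0%C).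
  { intros H0. assert (K := sg_sq t). rewrite H0 in K. apply Hne.
    apply Ceq_minus. rewrite <- K. ring. }
  specialize (Hd Hsg).
  destruct (p_sqrt t (s t) (Hs t)) as [P1 P2].
  assert (N1 : (xi + s t)%C <> xi).
  { intros K. apply Hsg. rewrite <- H1. replace (s t) with (xi + s t - xi)%C by ring.
    rewrite K. ring. }
  assert (N2 : (xi - s t)%C <> xi).
  { intros K. apply Hsg. rewrite <- H1. replace (s t) with (xi - (xi - s t))%C by ring.
    rewrite K. ring. }
  destruct (HG' (xi + s t)%C) as [D1 C1]; [now rewrite P1 | easy |].
  destruct (HG' (xi - s t)%C) as [D2 C2]; [now rewrite P2 | easy |].
  split.
  - apply C_deriv_ext with (fun u => / 2 * (G (xi + s u) + G (xi + - (1) * s u)))%C.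
    { intros u. unfold E. destruct (Hs u) as [-> | ->].
      - replace (xi + - (1) * sg u)%C with (xi - sg u)%C by ring. easy.
      - replace (xi + - (1) * - sg u)%C with (xi + sg u)%C by ring.
        replace (xi + - sg u)%C with (xi - sg u)%C by ring. ring. }
    replace (xi - s t)%C with (xi + - (1) * s t)%C in D2 by ring.
    assert (K1 := C_deriv_plus _ _ _ _ _ (C_deriv_const xi t) Hd).
    assert (K2 := C_deriv_plus _ _ _ _ _ (C_deriv_const xi t)
      (C_deriv_mult _ _ _ _ _ (C_deriv_const (- (1))%C t) Hd)).
    assert (K := C_deriv_mult _ _ _ _ _ (C_deriv_const (/ 2)%C t)
      (C_deriv_plus _ _ _ _ _ (C_deriv_comp G _ t _ _ D1 K1) (C_deriv_comp G _ t _ _ D2 K2))).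
    cbv beta in K.
    match type of K with C_deriv _ _ ?m => replace m with (E' t) in K; [exact K|] end.
    unfold E'. rewrite H1. replace (xi + - (1) * sg t)%C with (xi - sg t)%C by ring.
    replace (RtoC 4) with (2 * 2)%C by (rewrite <- RtoC_mult; f_equal; ring).
    field. exact Hsg.
  - apply continuous_ext with (fun u => (G' (xi + s u) - G' (xi - s u)) / (4 * s u))%C.
    { intros u. unfold E'. destruct (Hs u) as [-> | ->]; [easy|].
      assert (K : ((G' (xi + - sg u) - G' (xi - - sg u)) / (4 * - sg u) =
        (G' (xi + sg u) - G' (xi - sg u)) / (4 * sg u))%C); [|exact K].
      replace (xi - - sg u)%C with (xi + sg u)%C by ring.
      replace (xi + - sg u)%C with (xi - sg u)%C by ring.
      destruct (Ceq_dec (sg u) 0%C) as [Z|Z].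
      - rewrite Z. replace (xi - 0)%C with xi by ring. replace (xi + 0)%C with xi by ring.
        unfold Cdiv. ring.
      - field. exact Z. }
    apply continuous_Cmult.
    + apply continuous_Cminus.
      * apply (continuous_comp (fun u => xi + s u)%C G'); [|easy].
        apply continuous_Cplus; [apply continuous_const | easy].
      * apply (continuous_comp (fun u => xi - s u)%C G'); [|easy].
        apply continuous_Cminus; [apply continuous_const | easy].
    + apply continuous_Cinv.
      * apply continuous_Cmult; [apply continuous_const | easy].
      * rewrite H1. apply Cmult_neq_0; [apply four_neq0 | easy].
Qed.

Lemma even_part_expansion rho : 0 < rho < R0 ->
  exists (a : nat -> C) (M : R), (forall k, Cmod (a k) <= M / rho ^ k) /\
    forall z, Cmod (p z) < rho ->
      is_series (V := C_R_NormedModule) (fun k => p z ^ k * a k)%C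
        (/ 2 * (G z + G (2 * xi - z)))%C.
Proof.
  intros Hrho.
  destruct (disc_expansion E E' R0 rho (RtoC e2) Hrho even_part_continuous even_part_deriv)
    as (a & M & Ha & Hs).
  exists a, M. split; [easy|]. intros z Hz. specialize (Hs _ Hz).
  replace (/ 2 * (G z + G (2 * xi - z)))%C with (E (p z)); [exact Hs|].
  unfold E.
  assert (K : sg (p z) = (z - xi)%C \/ sg (p z) = (- (z - xi))%C).
  { assert (H : ((sg (p z) - (z - xi)) * (sg (p z) + (z - xi)) = 0)%C).
    { replace ((sg (p z) - (z - xi)) * (sg (p z) + (z - xi)))%C with
        (sg (p z) * sg (p z) - (z - xi) * (z - xi))%C by ring.
      rewrite sg_sq. unfold p. ring. }
    destruct (Ceq_dec (sg (p z) - (z - xi))%C 0%C) as [H0|H0].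
    - left. now apply Ceq_minus.
    - right. destruct (Ceq_dec (sg (p z) + (z - xi))%C 0%C) as [H2|H2].
      + apply Ceq_minus. rewrite <- H2. ring.
      + exfalso. now apply (Cmult_neq_0 _ _ H0 H2). }
  destruct K as [-> | ->].
  - replace (xi + (z - xi))%C with z by ring.
    replace (xi - (z - xi))%C with (2 * xi - z)%C by ring. easy.
  - replace (xi + - (z - xi))%C with (2 * xi - z)%C by ring.
    replace (xi - - (z - xi))%C with z by ring. ring.
Qed.

End EvenPart.

(** The odd part of G about xi is z - xi times the even part of q(z) = (G z - G xi)/(z - xi). With q
    xi = G' xi this q is continuous everywhere and continuously differentiable off xi, which is the
    regularity that [even_part_expansion] asks for; so it applies to G and to q alike. *)
Lemma lemniscate_expansion w R0 rho (G G' : C -> C) : 0 < rho < R0 ->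
  (forall z, Cmod (lemn w z) < R0 -> C_deriv G z (G' z) /\ continuous G' z) ->
  exists (a b : nat -> C) (M : R),
    (forall k, Cmod (a k) <= M / rho ^ k /\ Cmod (b k) <= M / rho ^ k) /\
    forall z, Cmod (lemn w z) < rho ->
      is_series (V := C_R_NormedModule)
        (fun k => lemn w z ^ k * (a k + (z - RtoC (Re w)) * b k))%C (G z).
Proof.
  intros Hrho HG. set (xi := RtoC (Re w)). set (e2 := Im w ^ 2).
  assert (Hp : forall z, ((z - xi) * (z - xi) + RtoC e2)%C = lemn w z).
  { intros z. symmetry. apply lemn_shift. }
  set (q z := if Ceq_dec z xi then G' xi else ((G z - G xi) / (z - xi))%C).
  set (q' z := (G' z * / (z - xi) + (G z - G xi) * (- (1) / ((z - xi) * (z - xi))))%C).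
  assert (Hq : forall z, ((z - xi) * q z = G z - G xi)%C).
  { intros z. unfold q. destruct (Ceq_dec z xi) as [->|Hne]; [ring|]. field.
    intros E. apply Hne. now apply Ceq_minus. }
  assert (HGc : forall z, Cmod (lemn w z) < R0 -> continuous G z).
  { intros z Hz. eapply C_deriv_continuous. now apply HG. }
  assert (Hqd : forall z, Cmod (lemn w z) < R0 -> z <> xi -> C_deriv q z (q' z) /\ continuous q' z).
  { intros z Hz Hne.
    assert (H0 : (z - xi)%C <> 0%C) by (intros E; apply Hne; now apply Ceq_minus).
    destruct (HG z Hz) as [D1 D2]. split.
    - apply C_deriv_ext_loc with (fun y => (G y + - G xi) * / (y - xi))%C.
      + apply locally_C_eps. exists (Cmod (z - xi)%C). split; [now apply Cmod_gt_0|].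
        intros y Hy. unfold q. destruct (Ceq_dec y xi) as [->|_]; [|easy].
        rewrite <- Cmod_opp in Hy. replace (- (xi - z))%C with (z - xi)%C in Hy by ring. lra.
      + assert (K := C_deriv_mult _ _ _ _ _ (C_deriv_plus _ _ _ _ _ D1 (C_deriv_const (- G xi)%C z))
          (C_deriv_inv _ _ _ (C_deriv_shift xi z) H0)).
        cbv beta in K. match type of K with C_deriv _ _ ?m => replace m with (q' z) in K; [exact K|] end.
        unfold q'. ring.
    - unfold q'. apply continuous_Cplus; apply continuous_Cmult.
      + easy.
      + apply continuous_Cinv; [apply continuous_shift | easy].
      + apply continuous_Cminus; [now apply HGc | apply continuous_const].
      + apply continuous_Cmult; [apply continuous_const|]. apply continuous_Cinv.
        * apply continuous_Cmult; apply continuous_shift.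
        * now apply Cmult_neq_0. }
  assert (Hqc : forall z, Cmod (lemn w z) < R0 -> continuous q z).
  { intros z Hz. destruct (Ceq_dec z xi) as [E|Hne].
    - rewrite E in *. clear E. destruct (proj1 (HG xi Hz)) as (g & Hg1 & Hg2 & Hg3).
      apply continuous_ext with g; [|easy]. intros y. unfold q.
      destruct (Ceq_dec y xi) as [->|Hne]; [easy|].
      rewrite Hg3. assert (E : g y = (g y * (y - xi) / (y - xi))%C); [|exact E].
      field. intros E. apply Hne. now apply Ceq_minus.
    - eapply C_deriv_continuous. now apply Hqd. }
  destruct (even_part_expansion xi e2 R0 G G') with (rho := rho) as (a & Ma & Ha & Hsa).
  { intros z. rewrite Hp. apply HGc. }
  { intros z. rewrite Hp. intros Hz _. now apply HG. }
  { easy. }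
  destruct (even_part_expansion xi e2 R0 q q') with (rho := rho) as (b & Mb & Hb & Hsb).
  { intros z. rewrite Hp. apply Hqc. }
  { intros z. rewrite Hp. apply Hqd. }
  { easy. }
  exists a, b, (Rmax Ma Mb). split.
  - intros k. assert (Hk : 0 < rho ^ k) by (apply pow_lt; lra).
    split; (eapply Rle_trans; [apply Ha || apply Hb|]); unfold Rdiv;
      (apply Rmult_le_compat_r; [left; now apply Rinv_0_lt_compat|]); [apply Rmax_l | apply Rmax_r].
  - intros z Hz. specialize (Hsa z). specialize (Hsb z). rewrite Hp in Hsa, Hsb.
    specialize (Hsa Hz). specialize (Hsb Hz).
    apply (is_series_linear C_R_NormedModule C_R_NormedModule (fun y => (z - xi) * y)%C _ _
      (Cmult_linear (z - xi)%C)) in Hsb.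
    assert (K := is_series_plus _ _ _ _ Hsa Hsb).
    replace (G z) with (/ 2 * (G z + G (2 * xi - z)) + (z - xi) * (/ 2 * (q z + q (2 * xi - z))))%C.
    + revert K. apply is_series_ext. intros k.
      assert (E : (lemn w z ^ k * a k + (z - xi) * (lemn w z ^ k * b k) =
        lemn w z ^ k * (a k + (z - xi) * b k))%C) by ring.
      exact E.
    + replace ((z - xi) * (/ 2 * (q z + q (2 * xi - z))))%C with
        (/ 2 * ((z - xi) * q z - (2 * xi - z - xi) * q (2 * xi - z)))%C by ring.
      rewrite !Hq. field.
Qed.

(** * Real coordinates of stem functions *)

Lemma Cconj_RtoC (a : R) : Cconj (RtoC a) = RtoC a.
Proof. apply injective_projections; simpl; ring. Qed.

Lemma Cconj_linear : is_linear (U := C_R_NormedModule) (V := C_R_NormedModule) Cconj.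
Proof.
  split.
  - intros x y. exact (Cplus_conj x y).
  - intros k x. rewrite !scal_R_Cmult.
    assert (E : Cconj (RtoC k * x)%C = (RtoC k * Cconj x)%C).
    { now rewrite Cmult_conj, Cconj_RtoC. }
    exact E.
  - exists 1. split; [lra|]. intros x. rewrite !norm_C, Cmod_conj. lra.
Qed.

(** Averaging the expansion with its conjugate replaces the coefficients by their real parts. Real
    coefficients are what can multiply vectors of A independently of the unit J that replaces i. *)
Lemma real_lemniscate_expansion w R0 rho (G G' : C -> C) : 0 < rho < R0 ->
  (forall z, Cmod (lemn w z) < R0 -> C_deriv G z (G' z) /\ continuous G' z) ->
  (forall z, Cmod (lemn w z) < R0 -> G (Cconj z) = Cconj (G z)) ->
  exists (a b : nat -> R) (M : R),
    (forall k, Rabs (a k) <= M / rho ^ k /\ Rabs (b k) <= M / rho ^ k) /\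
    forall z, Cmod (lemn w z) < rho ->
      is_series (V := C_R_NormedModule)
        (fun k => lemn w z ^ k * (RtoC (a k) + (z - RtoC (Re w)) * RtoC (b k)))%C (G z).
Proof.
  intros Hrho HG Hc. destruct (lemniscate_expansion w R0 rho G G' Hrho HG) as (a & b & M & Hb & Hs).
  exists (fun k => Re (a k)), (fun k => Re (b k)), M. split.
  - intros k. destruct (Hb k) as [H1 H2].
    split; (eapply Rle_trans; [apply re_le_Cmod|]); easy.
  - intros z Hz.
    assert (Hz' : Cmod (lemn w (Cconj z)) < rho) by (now rewrite lemn_conj, Cmod_conj).
    assert (K := is_series_linear C_R_NormedModule C_R_NormedModule Cconj _ _ Cconj_linear (Hs _ Hz')).
    assert (K2 := is_series_linear C_R_NormedModule C_R_NormedModule (fun y => / 2 * y)%C _ _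
      (Cmult_linear (/ 2)%C) (is_series_plus _ _ _ _ (Hs z Hz) K)).
    cbv beta in K2. rewrite Hc, Cconj_conj in K2 by lra.
    match type of K2 with is_series _ ?l => change l with (/ 2 * (G z + G z))%C in K2 end.
    replace (/ 2 * (G z + G z))%C with (G z) in K2 by field.
    revert K2. apply is_series_ext. intros k.
    assert (E : (/ 2 * (lemn w z ^ k * (a k + (z - RtoC (Re w)) * b k) +
      Cconj (lemn w (Cconj z) ^ k * (a k + (Cconj z - RtoC (Re w)) * b k))) =
      lemn w z ^ k * (RtoC (Re (a k)) + (z - RtoC (Re w)) * RtoC (Re (b k))))%C); [|exact E].
    rewrite Cmult_conj, Cplus_conj, Cmult_conj, Cminus_conj, Cconj_conj, Cpow_conj, lemn_conj,
      Cconj_conj.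
    rewrite Cconj_RtoC, !re_alt. field.
Qed.

Lemma is_derive_linear (V W : NormedModule R_AbsRing) (L : V -> W) (f : R -> V) t l :
  is_linear L -> is_derive f t l -> is_derive (fun u => L (f u)) t (L l).
Proof.
  intros HL H. apply is_derive_eps. intros eps He.
  destruct (linear_norm _ HL) as (M & HM0 & HM).
  assert (He' : 0 < eps / M) by now apply Rdiv_lt_0_compat.
  generalize (proj1 (is_derive_eps V f t l) H _ He'). apply filter_imp. intros u Hu.
  assert (E : minus (minus (L (f u)) (L (f t))) (scal (u - t) (L l)) =
    L (minus (minus (f u) (f t)) (scal (u - t) l))).
  { replace (minus (minus (f u) (f t)) (scal (u - t) l)) with
      (plus (plus (f u) (scal (-1) (f t))) (scal (- (u - t)) l)) by module.
    rewrite !(linear_plus _ HL), !(linear_scal _ HL). module. }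
  rewrite E. eapply Rle_trans; [apply HM|].
  apply Rle_trans with (M * (eps / M * Rabs (u - t))).
  - apply Rmult_le_compat_l; lra.
  - right. field. lra.
Qed.

(** From z to y along one vertical and one horizontal segment, both close to z: the mean value
    theorem on each segment and the continuity of the partial derivatives give the estimate. *)
Lemma C1_differentiable (P Pa Pb : C -> R) z :
  locally z (fun y => is_derive (fun a : R => P (a, Im y)) (Re y) (Pa y) /\
                      is_derive (fun b : R => P (Re y, b)) (Im y) (Pb y)) ->
  continuous Pa z -> continuous Pb z ->
  forall eps, 0 < eps -> exists d, 0 < d /\ forall y, Cmod (y - z)%C < d ->
    Rabs (P y - P z - (Pa z * (Re y - Re z) + Pb z * (Im y - Im z))) <= eps * Cmod (y - z)%C.
Proof.
  intros Hd Ha Hb eps He. assert (He2 : 0 < eps / 2) by lra.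
  apply locally_C_eps in Hd. destruct Hd as (d1 & Hd1 & Hd).
  destruct (proj1 (continuous_C_eps R_NormedModule Pa z) Ha _ He2) as (d2 & Hd2 & H2).
  destruct (proj1 (continuous_C_eps R_NormedModule Pb z) Hb _ He2) as (d3 & Hd3 & H3).
  set (d := Rmin d1 (Rmin d2 d3)).
  assert (D1 : d <= d1) by apply Rmin_l.
  assert (D2 : d <= d2) by (eapply Rle_trans; [apply Rmin_r | apply Rmin_l]).
  assert (D3 : d <= d3) by (eapply Rle_trans; [apply Rmin_r | apply Rmin_r]).
  assert (Hdp : 0 < d) by (repeat apply Rmin_glb_lt; lra).
  exists (d / 2). split; [lra|]. intros y Hy.
  assert (Hy1 := Rmax_l (Rabs (Re y - Re z)) (Rabs (Im y - Im z))).
  assert (Hy2 := Rmax_r (Rabs (Re y - Re z)) (Rabs (Im y - Im z))).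
  assert (Hy3 := Rmax_Cmod (y - z)%C).
  change (Rmax (Rabs (Re y - Re z)) (Rabs (Im y - Im z)) <= Cmod (y - z)%C) in Hy3.
  assert (Hbox : forall a b, Rabs (a - Re z) <= Rabs (Re y - Re z) ->
    Rabs (b - Im z) <= Rabs (Im y - Im z) -> Cmod ((a, b) - z)%C < d).
  { intros a b H4 H5. replace ((a, b) - z)%C with (RtoC (a - Re z) + Ci * RtoC (b - Im z))%C
      by (apply injective_projections; simpl; unfold Re, Im; ring).
    eapply Rle_lt_trans; [apply Cmod_triangle|]. rewrite Cmod_mult, Cmod_Ci, !Cmod_R. lra. }
  assert (Hseg : forall u v x, Rmin u v <= x <= Rmax u v -> Rabs (x - u) <= Rabs (v - u)).
  { intros u v x. unfold Rmin, Rmax. destruct (Rle_dec u v); intros Hx; split_Rabs; lra. }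
  destruct (MVT_gen (fun a => P (a, Im y)) (Re z) (Re y) (fun a => Pa (a, Im y))) as (c1 & Hc1 & E1).
  { intros x Hx. apply (Hd (x, Im y)). eapply Rlt_le_trans; [|exact D1].
    apply Hbox; [apply Hseg; lra | lra]. }
  { intros x Hx. apply derivable_continuous_pt. exists (Pa (x, Im y)). apply is_derive_Reals.
    apply (Hd (x, Im y)). eapply Rlt_le_trans; [|exact D1].
    apply Hbox; [apply Hseg; lra | lra]. }
  destruct (MVT_gen (fun b => P (Re z, b)) (Im z) (Im y) (fun b => Pb (Re z, b))) as (c2 & Hc2 & E2).
  { intros x Hx. apply (Hd (Re z, x)). eapply Rlt_le_trans; [|exact D1].
    apply Hbox; [rewrite Rminus_diag, Rabs_R0; apply Rabs_pos | apply Hseg; lra]. }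
  { intros x Hx. apply derivable_continuous_pt. exists (Pb (Re z, x)). apply is_derive_Reals.
    apply (Hd (Re z, x)). eapply Rlt_le_trans; [|exact D1].
    apply Hbox; [rewrite Rminus_diag, Rabs_R0; apply Rabs_pos | apply Hseg; lra]. }
  assert (B1 : Rabs (Pa (c1, Im y) - Pa z) < eps / 2).
  { apply H2. eapply Rlt_le_trans; [|exact D2]. apply Hbox; [now apply Hseg | lra]. }
  assert (B2 : Rabs (Pb (Re z, c2) - Pb z) < eps / 2).
  { apply H3. eapply Rlt_le_trans; [|exact D3].
    apply Hbox; [rewrite Rminus_diag, Rabs_R0; apply Rabs_pos | now apply Hseg]. }
  replace (P y) with (P (Re y, Im y)) by (now destruct y).
  replace (P z) with (P (Re z, Im z)) at 1 by (now destruct z).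
  replace (P (Re y, Im y) - P (Re z, Im z) - (Pa z * (Re y - Re z) + Pb z * (Im y - Im z))) with
    ((Pa (c1, Im y) - Pa z) * (Re y - Re z) + (Pb (Re z, c2) - Pb z) * (Im y - Im z)) by lra.
  eapply Rle_trans; [apply Rabs_triang|]. rewrite !Rabs_mult.
  assert (H4 := Rabs_pos (Re y - Re z)). assert (H5 := Rabs_pos (Im y - Im z)).
  apply Rle_trans with (eps / 2 * Cmod (y - z)%C + eps / 2 * Cmod (y - z)%C); [|lra].
  apply Rplus_le_compat; (apply Rmult_le_compat; [apply Rabs_pos | easy | lra | lra]).
Qed.

Lemma C1_C_deriv (P Q Pa Pb Qa Qb : C -> R) z :
  locally z (fun y => (is_derive (fun a : R => P (a, Im y)) (Re y) (Pa y) /\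
                       is_derive (fun b : R => P (Re y, b)) (Im y) (Pb y)) /\
                      (is_derive (fun a : R => Q (a, Im y)) (Re y) (Qa y) /\
                       is_derive (fun b : R => Q (Re y, b)) (Im y) (Qb y))) ->
  continuous Pa z -> continuous Pb z -> continuous Qa z -> continuous Qb z ->
  Pa z = Qb z -> Qa z = - Pb z ->
  C_deriv (fun y => (P y, Q y)) z (Pa z, Qa z).
Proof.
  intros Hd HPa HPb HQa HQb H1 H2. apply C_deriv_of_eps. intros eps He.
  assert (He2 : 0 < eps / 2) by lra.
  destruct (C1_differentiable P Pa Pb z (filter_imp _ _ (fun y H => proj1 H) Hd) HPa HPb _ He2)
    as (d1 & Hd1 & K1).
  destruct (C1_differentiable Q Qa Qb z (filter_imp _ _ (fun y H => proj2 H) Hd) HQa HQb _ He2)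
    as (d2 & Hd2 & K2).
  exists (Rmin d1 d2). split; [now apply Rmin_glb_lt|]. intros y Hy.
  specialize (K1 y ltac:(eapply Rlt_le_trans; [exact Hy | apply Rmin_l])).
  specialize (K2 y ltac:(eapply Rlt_le_trans; [exact Hy | apply Rmin_r])).
  replace ((P y, Q y) - (P z, Q z) - (Pa z, Qa z) * (y - z))%C with
    (RtoC (P y - P z - (Pa z * (Re y - Re z) + Pb z * (Im y - Im z))) +
     Ci * RtoC (Q y - Q z - (Qa z * (Re y - Re z) + Qb z * (Im y - Im z))))%C.
  2:{ rewrite <- H1, H2. apply injective_projections; simpl; unfold Re, Im; ring. }
  eapply Rle_trans; [apply Cmod_triangle|]. rewrite Cmod_mult, Cmod_Ci, !Cmod_R. lra.
Qed.

(** In coordinates of A, the i-th components of F_1 and F_2 are the real and imaginary parts of a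
    complex function G_i. Holomorphy of F gives the Cauchy-Riemann equations for G_i, and the stem
    symmetry gives G_i (conj z) = conj (G_i z). The coefficients u and v serve every J at once. *)
Lemma stem_expansion (A : alt_star_algebra) (F : C -> A * A) w R0 rho : 0 < rho < R0 ->
  stem (fun z => Cmod (lemn w z) < R0) F -> holomorphic (fun z => Cmod (lemn w z) < R0) F ->
  exists (u v : nat -> A) (M : R),
    (forall k, norm (u k) <= M / rho ^ k /\ norm (v k) <= M / rho ^ k) /\
    forall z J, imag_sphere J -> Cmod (lemn w z) < rho ->
      is_series (fun k => inC J (lemn w z ^ k)%C **
        plus (u k) (inC J (z - RtoC (Re w))%C ** v k)) (slice_at J (F z)).
Proof.
  intros Hrho Hst (Fa & Fb & HF).
  destruct (coordinates A) as (N & e & phi & Mc & HMc & Hx & Hb & Hlin).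
  assert (Hphi : forall i, is_linear (V := R_NormedModule) (phi i)).
  { intros i. split.
    - intros x y. replace (plus x y) with (plus (scal 1 x) (scal 1 y)) by module.
      rewrite Hlin. unfold plus; simpl. ring.
    - intros k x. replace (scal k x) with (plus (scal k x) (scal 0 x)) by module.
      rewrite Hlin. unfold scal; simpl. unfold mult; simpl. ring.
    - exists (Mc + 1). split; [lra|]. intros x. eapply Rle_trans; [apply Hb|].
      generalize (norm_ge_0 x). nra. }
  assert (Hphi1 : forall i, is_linear (U := prod_NormedModule R_AbsRing A A) (V := R_NormedModule) (fun x => phi i (fst x))).
  { intros i. apply (is_linear_comp (U := prod_NormedModule R_AbsRing A A) (V := A) (W := R_NormedModule) fst (phi i)); [apply is_linear_fst | apply Hphi]. }
  assert (Hphi2 : forall i, is_linear (U := prod_NormedModule R_AbsRing A A) (V := R_NormedModule) (fun x => phi i (snd x))).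
  { intros i. apply (is_linear_comp (U := prod_NormedModule R_AbsRing A A) (V := A) (W := R_NormedModule) snd (phi i)); [apply is_linear_snd | apply Hphi]. }
  assert (Hopen : forall z, Cmod (lemn w z) < R0 -> locally z (fun y => Cmod (lemn w y) < R0)).
  { intros z Hz. apply locally_C_eps.
    assert (Hc : continuous (lemn w) z).
    { unfold lemn. apply continuous_Cmult; apply continuous_shift. }
    destruct (proj1 (continuous_C_eps C_R_NormedModule (lemn w) z) Hc (R0 - Cmod (lemn w z))
      ltac:(lra)) as (d & Hd & H).
    exists d. split; [easy|]. intros y Hy. specialize (H y Hy).
    change (norm (lemn w y - lemn w z : C_R_NormedModule)%C < R0 - Cmod (lemn w z)) in H.
    rewrite norm_C in H.
    replace (lemn w y) with ((lemn w y - lemn w z) + lemn w z)%C by ring.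
    eapply Rle_lt_trans; [apply Cmod_triangle|]. lra. }
  set (G i z := (phi i (fst (F z)), phi i (snd (F z))) : C).
  set (G' i z := (phi i (fst (Fa z)), phi i (snd (Fa z))) : C).
  assert (HG : forall i z, Cmod (lemn w z) < R0 -> C_deriv (G i) z (G' i z) /\ continuous (G' i) z).
  { intros i z Hz. destruct (HF z Hz) as (_ & _ & Ca & Cb & CR).
    assert (C1 : continuous (fun z => phi i (fst (Fa z))) z).
    { apply (continuous_comp Fa (fun x => phi i (fst x))); [easy|].
      apply (linear_cont (U := prod_NormedModule R_AbsRing A A) (V := R_NormedModule)), Hphi1. }
    assert (C2 : continuous (fun z => phi i (snd (Fa z))) z).
    { apply (continuous_comp Fa (fun x => phi i (snd x))); [easy|].
      apply (linear_cont (U := prod_NormedModule R_AbsRing A A) (V := R_NormedModule)), Hphi2. }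
    assert (C3 : continuous (fun z => phi i (fst (Fb z))) z).
    { apply (continuous_comp Fb (fun x => phi i (fst x))); [easy|].
      apply (linear_cont (U := prod_NormedModule R_AbsRing A A) (V := R_NormedModule)), Hphi1. }
    assert (C4 : continuous (fun z => phi i (snd (Fb z))) z).
    { apply (continuous_comp Fb (fun x => phi i (snd x))); [easy|].
      apply (linear_cont (U := prod_NormedModule R_AbsRing A A) (V := R_NormedModule)), Hphi2. }
    split.
    - apply (C1_C_deriv (fun z => phi i (fst (F z))) (fun z => phi i (snd (F z)))
        (fun z => phi i (fst (Fa z))) (fun z => phi i (fst (Fb z)))
        (fun z => phi i (snd (Fa z))) (fun z => phi i (snd (Fb z)))); try easy.
      + generalize (Hopen z Hz). apply filter_imp. intros y Hy.
        destruct (HF y Hy) as (D1 & D2 & _).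
        split; split.
        * exact (is_derive_linear _ _ _ _ _ _ (Hphi1 i) D1).
        * exact (is_derive_linear _ _ _ _ _ _ (Hphi1 i) D2).
        * exact (is_derive_linear _ _ _ _ _ _ (Hphi2 i) D1).
        * exact (is_derive_linear _ _ _ _ _ _ (Hphi2 i) D2).
      + apply (f_equal fst) in CR. simpl in CR.
        change (plus (fst (Fa z)) (opp (snd (Fb z))) = zero) in CR.
        replace (fst (Fa z)) with (plus (plus (fst (Fa z)) (opp (snd (Fb z)))) (snd (Fb z)))
          by module. rewrite CR. f_equal. module.
      + apply (f_equal snd) in CR. simpl in CR.
        change (plus (snd (Fa z)) (fst (Fb z)) = zero) in CR.
        replace (snd (Fa z)) with (plus (scal 1 (plus (snd (Fa z)) (fst (Fb z)))) (scal (-1) (fst (Fb z))))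
          by module. rewrite CR, Hlin.
        replace (phi i zero) with 0; [ring|].
        symmetry. exact (linear_zero _ (Hphi i)).
    - now apply continuous_C_pair. }
  assert (HGc : forall i z, Cmod (lemn w z) < R0 -> G i (Cconj z) = Cconj (G i z)).
  { intros i z Hz. destruct (Hst z Hz) as [S1 S2]. unfold G. rewrite S1, S2.
    apply injective_projections; simpl; [easy|]. exact (linear_opp _ _ (Hphi i)). }
  assert (Hex : forall i, exists (ab : (nat -> R) * (nat -> R)) (M : R),
    (forall k, Rabs (fst ab k) <= M / rho ^ k /\ Rabs (snd ab k) <= M / rho ^ k) /\
    forall z, Cmod (lemn w z) < rho ->
      is_series (V := C_R_NormedModule)
        (fun k => lemn w z ^ k * (RtoC (fst ab k) + (z - RtoC (Re w)) * RtoC (snd ab k)))%C (G i z)).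
  { intros i. destruct (real_lemniscate_expansion w R0 rho (G i) (G' i) Hrho (HG i) (HGc i))
      as (a & b & M & H). now exists (a, b), M. }
  set (ab i := proj1_sig (constructive_indefinite_description _ (Hex i))).
  assert (Hab : forall i, exists M,
    (forall k, Rabs (fst (ab i) k) <= M / rho ^ k /\ Rabs (snd (ab i) k) <= M / rho ^ k) /\
    forall z, Cmod (lemn w z) < rho ->
      is_series (V := C_R_NormedModule)
        (fun k => lemn w z ^ k * (RtoC (fst (ab i) k) + (z - RtoC (Re w)) * RtoC (snd (ab i) k)))%C (G i z)).
  { intros i. unfold ab. now destruct (constructive_indefinite_description _ (Hex i)). }
  clearbody ab. clear Hex.
  exists (fun k => lin_sum A N (fun i => fst (ab i) k) e).
  exists (fun k => lin_sum A N (fun i => snd (ab i) k) e).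
  assert (HMx : forall n, exists M, 0 <= M /\ forall i k, (i < n)%nat ->
    Rabs (fst (ab i) k) <= M / rho ^ k /\ Rabs (snd (ab i) k) <= M / rho ^ k).
  { induction n as [|n (M & HM0 & HM)]; [exists 0; split; [lra | intros; lia]|].
    destruct (Hab n) as (M' & HM' & _). exists (Rmax M M').
    split; [eapply Rle_trans; [exact HM0 | apply Rmax_l]|].
    intros i k Hi. assert (Hk : 0 < / rho ^ k) by (apply Rinv_0_lt_compat, pow_lt; lra).
    destruct (Nat.eq_dec i n) as [->|Hne].
    - destruct (HM' k) as [H1 H2]. unfold Rdiv in *.
      split; (eapply Rle_trans; [eassumption|]); (apply Rmult_le_compat_r; [lra | apply Rmax_r]).
    - destruct (HM i k ltac:(lia)) as [H1 H2]. unfold Rdiv in *.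
      split; (eapply Rle_trans; [eassumption|]); (apply Rmult_le_compat_r; [lra | apply Rmax_l]). }
  destruct (HMx N) as (M & HM0 & HM).
  exists (M * norm_sum A N e). split.
  - intros k. assert (Hk : 0 < / rho ^ k) by (apply Rinv_0_lt_compat, pow_lt; lra).
    replace (M * norm_sum A N e / rho ^ k) with (M / rho ^ k * norm_sum A N e)
      by (unfold Rdiv; ring).
    assert (0 <= M / rho ^ k) by (apply Rmult_le_pos; lra).
    split; (apply lin_sum_bound; [easy|]); intros i Hi; now apply HM.
  - intros z J HJ Hz. unfold slice_at.
    rewrite (Hx (fst (F z))), (Hx (snd (F z))).
    assert (H : forall n, is_series (fun k => inC J (lemn w z ^ k)%C **
        plus (lin_sum A n (fun i => fst (ab i) k) e)
             (inC J (z - RtoC (Re w))%C ** lin_sum A n (fun i => snd (ab i) k) e))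
      (plus (lin_sum A n (fun i => phi i (fst (F z))) e)
            (J ** lin_sum A n (fun i => phi i (snd (F z))) e))).
    { induction n as [|n IH]; simpl lin_sum.
      - apply is_series_eps. intros eps He. exists 0%nat. intros n _.
        eapply Rle_lt_trans; [|exact He]. right.
        transitivity (norm (zero : A)); [|exact norm_zero]. f_equal.
        assert (E : sum_n (fun k => inC J (lemn w z ^ k)%C **
          plus (zero : A) (inC J (z - RtoC (Re w))%C ** zero)) n = zero).
        { induction n as [|n IHn].
          - rewrite sum_O, amul_zero_r, plus_zero_l. apply amul_zero_r.
          - rewrite sum_Sn, IHn, amul_zero_r.
            replace (plus zero zero) with (zero : A) by module. rewrite amul_zero_r. module. }
        etransitivity; [exact (f_equal (fun x => minus x (plus zero (J ** zero))) E)|].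
        rewrite amul_zero_r. module.
      - destruct (Hab n) as (_ & _ & Hs). specialize (Hs z Hz).
        apply (is_series_linear C_R_NormedModule A (fun y => inC J y ** e n) _ _
          (inC_act_linear A J (e n))) in Hs.
        assert (K := is_series_plus _ _ _ _ IH Hs).
        assert (E : plus (plus (lin_sum A n (fun i => phi i (fst (F z))) e)
            (J ** lin_sum A n (fun i => phi i (snd (F z))) e)) (inC J (G n z) ** e n) =
          plus (plus (lin_sum A n (fun i => phi i (fst (F z))) e) (scal (phi n (fst (F z))) (e n)))
            (J ** plus (lin_sum A n (fun i => phi i (snd (F z))) e)
                       (scal (phi n (snd (F z))) (e n)))).
        { rewrite inC_act, amul_plus_r, amul_scal_r. unfold G; simpl. module. }
        apply (fun K => eq_ind _ (fun l : A => is_series _ l) K _ E).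
        revert K. apply is_series_ext. intros k.
        rewrite <- (inC_mul_act A J HJ), inC_plus, amul_plus_l, inC_RtoC, areal_mul_l.
        rewrite <- (inC_mul_act A J HJ (z - RtoC (Re w))%C), inC_RtoC, areal_mul_l.
        etransitivity; [symmetry; apply amul_plus_r|]. f_equal.
        assert (E3 : forall I V : A, I ** plus V (scal (snd (ab n) k) (e n)) =
          plus (I ** V) (scal (snd (ab n) k) (I ** e n))).
        { intros I V. now rewrite amul_plus_r, amul_scal_r. }
        rewrite amul_scal_r.
        apply (fun H => eq_trans H (f_equal (plus _) (eq_sym (E3 _ _)))). module. }
    apply H.
Qed.

(** * The pseudo-metric balls and the spherical expansion *)

Lemma lemn_continuous w z : continuous (lemn w) z.
Proof. unfold lemn. apply continuous_Cmult; apply continuous_shift. Qed.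

Lemma lemn_near w z eps : 0 < eps -> exists d, 0 < d /\
  forall y, Cmod (y - z)%C < d -> Rabs (Cmod (lemn w y) - Cmod (lemn w z)) < eps.
Proof.
  intros He. destruct (proj1 (continuous_C_eps C_R_NormedModule (lemn w) z) (lemn_continuous w z) eps He)
    as (d & Hd & H).
  exists d. split; [easy|]. intros y Hy. specialize (H y Hy).
  change (norm (lemn w y - lemn w z : C_R_NormedModule)%C < eps) in H. rewrite norm_C in H.
  assert (H1 := Cmod_triangle (lemn w y - lemn w z)%C (lemn w z)).
  assert (H2 := Cmod_triangle (lemn w z - lemn w y)%C (lemn w y)).
  replace (lemn w y - lemn w z + lemn w z)%C with (lemn w y) in H1 by ring.
  replace (lemn w z - lemn w y + lemn w y)%C with (lemn w z) in H2 by ring.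
  rewrite <- Cmod_opp in H2. replace (- lemn w z)%C with (- lemn w z)%C in H2 by ring.
  rewrite Cmod_opp in H2. rewrite <- (Cmod_opp (lemn w z - lemn w y)) in H2.
  replace (- (lemn w z - lemn w y))%C with (lemn w y - lemn w z)%C in H2 by ring.
  split_Rabs; lra.
Qed.

(** Around each point there is a box on which either D holds or |lemn w z| exceeds r^2 by at least
    the size of the box. Compactness of a large square yields a common positive size, and R0 - r^2
    is chosen no larger. *)
Lemma lemniscate_neighborhood (D : C -> Prop) w r : 0 < r -> open D ->
  (forall z, Cmod (lemn w z) <= r ^ 2 -> D z) ->
  exists R0, r ^ 2 < R0 /\ forall z, Cmod (lemn w z) < R0 -> D z.
Proof.
  intros Hr Hop HD.
  assert (Hloc : forall u v : R, exists d : posreal, forall z, Rabs (Re z - u) < d ->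
    Rabs (Im z - v) < d -> D z \/ r ^ 2 + d <= Cmod (lemn w z)).
  { intros u v. destruct (Rle_dec (Cmod (lemn w (u, v))) (r ^ 2)) as [Hle|Hgt].
    - destruct (Hop _ (HD _ Hle)) as [d Hd]. exists d. intros z H1 H2. left. apply Hd. now split.
    - set (e := Cmod (lemn w (u, v)) - r ^ 2).
      destruct (lemn_near w (u, v) (e / 2)) as (d & Hd & H); [unfold e; lra|].
      assert (Hm : 0 < Rmin (d / 2) (e / 2)) by (apply Rmin_glb_lt; unfold e; lra).
      exists (mkposreal _ Hm). simpl. intros z H1 H2. right.
      assert (H3 := Rmin_l (d / 2) (e / 2)). assert (H4 := Rmin_r (d / 2) (e / 2)).
      assert (Hz : Cmod (z - (u, v))%C < d).
      { replace (z - (u, v))%C with (RtoC (Re z - u) + Ci * RtoC (Im z - v))%C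
          by (apply injective_projections; simpl; unfold Re, Im; ring).
        eapply Rle_lt_trans; [apply Cmod_triangle|]. rewrite Cmod_mult, Cmod_Ci, !Cmod_R. lra. }
      specialize (H z Hz). apply Rabs_def2 in H. unfold e in *. lra. }
  set (delta u v := proj1_sig (constructive_indefinite_description _ (Hloc u v))).
  assert (Hdelta : forall u v z, Rabs (Re z - u) < delta u v ->
    Rabs (Im z - v) < delta u v -> D z \/ r ^ 2 + delta u v <= Cmod (lemn w z)).
  { intros u v. unfold delta. now destruct (constructive_indefinite_description _ (Hloc u v)). }
  (* By [dist_node_le] with u = r + 1, this square contains every z with |lemn w z| <= (r + 1)^2,
     hence all z with |lemn w z| < r^2 + 1. *)
  set (B := Cmod w + ((r + 1) + 2 * Rabs (Im w))).
  destruct (compactness_value_2d (- B) B (- B) B delta) as [d Hd].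
  exists (r ^ 2 + Rmin d 1). split.
  { assert (0 < Rmin d 1) by (apply Rmin_glb_lt; [apply cond_pos | lra]). lra. }
  intros z Hz.
  assert (H1 := Rmin_l d 1). assert (H2 := Rmin_r d 1).
  assert (Hzw := dist_node_le w z (r + 1) ltac:(lra) ltac:(nra)).
  assert (HzB : Cmod z <= B).
  { replace z with (w + (z - w))%C by ring. eapply Rle_trans; [apply Cmod_triangle|].
    unfold B. lra. }
  assert (K := Rmax_Cmod z). assert (K1 := Rmax_l (Rabs (fst z)) (Rabs (snd z))).
  assert (K2 := Rmax_r (Rabs (fst z)) (Rabs (snd z))).
  assert (B1 : - B <= Re z <= B) by (unfold Re; apply Rabs_le_between; lra).
  assert (B2 : - B <= Im z <= B) by (unfold Im; apply Rabs_le_between; lra).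
  apply NNPP. intros HnD. apply (Hd _ _ B1 B2). intros (u & v & _ & _ & E1 & E2 & E3).
  destruct (Hdelta u v z E1 E2) as [H|H]; [easy|]. lra.
Qed.

(** The value t = [lemn w z] is shrunk to (1 - e) t and lifted through the square root h' closer to
    h = z - xi. Then |h' - h|^2 <= |h' - h| |h' + h| = e |t| < eps^2, which covers the double point
    h = 0 as well. *)
Lemma near_inside w z r eps : 0 < r -> 0 < eps -> Cmod (lemn w z) <= r ^ 2 ->
  exists z', Cmod (z' - z)%C < eps /\ Cmod (lemn w z') < r ^ 2.
Proof.
  intros Hr He Hz. set (xi := RtoC (Re w)). set (t := lemn w z).
  set (e := Rmin (/ 2) (eps ^ 2 / (2 * r ^ 2))).
  assert (Hr2 : 0 < r ^ 2) by nra.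
  assert (He0 : 0 < e).
  { apply Rmin_glb_lt; [lra|]. apply Rdiv_lt_0_compat; nra. }
  assert (He1 : e <= / 2) by apply Rmin_l.
  assert (He2 : e * r ^ 2 < eps ^ 2).
  { apply Rle_lt_trans with (eps ^ 2 / (2 * r ^ 2) * r ^ 2).
    - apply Rmult_le_compat_r; [lra | apply Rmin_r].
    - replace (eps ^ 2 / (2 * r ^ 2) * r ^ 2) with (eps ^ 2 / 2) by (field; lra). nra. }
  set (h := (z - xi)%C).
  destruct (Csqrt_exists (h * h - RtoC e * t)%C) as [h0 Hh0].
  assert (Hx : exists h', (h' * h')%C = (h * h - RtoC e * t)%C /\ Cmod (h' - h)%C <= Cmod (h' + h)%C).
  { destruct (Rle_dec (Cmod (h0 - h)%C) (Cmod (h0 + h)%C)) as [Hle|Hgt]; [now exists h0|].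
    exists (- h0)%C. split; [rewrite <- Hh0; ring|].
    rewrite <- Cmod_opp, <- (Cmod_opp (- h0 + h)).
    replace (- (- h0 - h))%C with (h0 + h)%C by ring.
    replace (- (- h0 + h))%C with (h0 - h)%C by ring. lra. }
  destruct Hx as (h' & Hh' & Hle).
  exists (xi + h')%C. split.
  - replace (xi + h' - z)%C with (h' - h)%C by (unfold h; ring).
    assert (H1 : Cmod (h' - h)%C * Cmod (h' + h)%C = e * Cmod t).
    { rewrite <- Cmod_mult. replace ((h' - h) * (h' + h))%C with (h' * h' - h * h)%C by ring.
      rewrite Hh'. replace (h * h - RtoC e * t - h * h)%C with (- (RtoC e * t))%C by ring.
      rewrite Cmod_opp, Cmod_mult, Cmod_R, Rabs_pos_eq; lra. }
    assert (H0 := Cmod_ge_0 (h' - h)%C). assert (Ht := Cmod_ge_0 t). fold t in Hz.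
    apply Rnot_le_lt. intros Hge. nra.
  - rewrite lemn_shift. fold xi. replace (xi + h' - xi)%C with h' by ring. rewrite Hh'.
    replace (h * h - RtoC e * t + RtoC (Im w ^ 2))%C with (RtoC (1 - e) * t)%C.
    2:{ unfold t. rewrite lemn_shift. fold xi. fold h. rewrite RtoC_minus. ring. }
    rewrite Cmod_mult, Cmod_R, Rabs_pos_eq by lra. fold t in Hz. assert (Ht := Cmod_ge_0 t). nra.
Qed.

Lemma sqrt_lt_iff a r : 0 <= a -> 0 < r -> sqrt a < r <-> a < r ^ 2.
Proof.
  intros Ha Hr. split; intros H.
  - rewrite <- (sqrt_sqrt a) by easy. assert (0 <= sqrt a) by apply sqrt_pos. nra.
  - rewrite <- (sqrt_pow2 r) by lra. apply sqrt_lt_1; nra.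
Qed.

Lemma U_plane_lemn w r z : 0 < r -> U_plane w r z <-> Cmod (lemn w z) < r ^ 2.
Proof.
  intros Hr. unfold U_plane, lemn. rewrite Cmod_mult. apply sqrt_lt_iff; [|easy].
  apply Rmult_le_pos; apply Cmod_ge_0.
Qed.

(** * Balls and their boundaries along the plane of the centre *)

Section Geometry.
Variable A : alt_star_algebra.
Hypothesis hnorm : norm_compatible A.
Variables (J : A) (w : C) (r : R).
Hypothesis HJ : imag_sphere J.
Hypothesis Hr : 0 < r.
Let y : A := inC J w.

Lemma u_dist_inC I z : imag_sphere I -> u_dist (inC I z) y = sqrt (Cmod (lemn w z)).
Proof. intros HI. unfold u_dist, y. now rewrite Delta_inC, norm_inC. Qed.

Lemma U_ball_inC I z : imag_sphere I -> U_ball y r (inC I z) <-> Cmod (lemn w z) < r ^ 2.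
Proof.
  intros HI. unfold U_ball. rewrite u_dist_inC, sqrt_lt_iff by (easy || apply Cmod_ge_0).
  split; [easy|]. intros H. split; [now apply cone_inC | easy].
Qed.

Lemma norm_inC_minus z z' : norm (minus (inC J z) (inC J z')) = Cmod (z - z')%C.
Proof. rewrite <- inC_minus. now apply norm_inC. Qed.

Lemma adherent_inC (E : A -> Prop) z :
  (forall eps, 0 < eps -> exists z', Cmod (z' - z)%C < eps /\ E (inC J z')) ->
  adherent E (inC J z).
Proof.
  intros H P HP. destruct (locally_norm_le_locally (inC J z) P HP) as [eps Heps].
  destruct (H eps (cond_pos eps)) as (z' & Hz' & HE). exists (inC J z'). split; [|easy].
  apply Heps. unfold ball_norm. eapply Rle_lt_trans; [right; apply norm_inC_minus | easy].
Qed.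

Lemma adherent_inC_inv (E : A -> Prop) z : (forall x, E x -> slice_plane J x) ->
  adherent E (inC J z) -> forall eps, 0 < eps -> exists z', Cmod (z' - z)%C < eps /\ E (inC J z').
Proof.
  intros HE H eps He.
  destruct (H (ball_norm (inC J z) (mkposreal eps He))) as (x & Hx & HxE).
  { apply (locally_le_locally_norm (inC J z) (ball_norm (inC J z) (mkposreal eps He))).
    exists (mkposreal eps He). now intros. }
  destruct (HE x HxE) as [z' ->]. exists z'. split; [|easy].
  rewrite <- norm_inC_minus. exact Hx.
Qed.

Lemma closure_ball z : Cmod (lemn w z) <= r ^ 2 -> closure_in (@quadratic_cone A) (U_ball y r) (inC J z).
Proof.
  intros Hz. split; [now apply cone_inC|]. apply adherent_inC. intros eps He.
  destruct (near_inside w z r eps Hr He Hz) as (z' & H1 & H2). exists z'. split; [easy|].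
  now apply U_ball_inC.
Qed.

Lemma boundary_inC z : boundary_in (slice_plane J) (U_slice J y r) (inC J z) <->
  Cmod (lemn w z) = r ^ 2.
Proof.
  split.
  - intros (_ & H1 & H2). apply Rle_antisym; apply Rnot_lt_le; intros Hlt.
    + destruct (lemn_near w z (Cmod (lemn w z) - r ^ 2) ltac:(lra)) as (d & Hd & H).
      destruct (adherent_inC_inv _ z (fun x Hx => proj2 Hx) H1 d Hd) as (z' & Hz' & [HE _]).
      apply U_ball_inC in HE; [|easy]. specialize (H z' Hz'). apply Rabs_def2 in H. lra.
    + destruct (lemn_near w z (r ^ 2 - Cmod (lemn w z)) ltac:(lra)) as (d & Hd & H).
      destruct (adherent_inC_inv _ z (fun x Hx => proj1 Hx) H2 d Hd) as (z' & Hz' & [_ HE]).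
      apply HE. split; [|now exists z']. apply U_ball_inC; [easy|].
      specialize (H z' Hz'). apply Rabs_def2 in H. lra.
  - intros Hz. split; [now exists z|]. split.
    + apply adherent_inC. intros eps He.
      destruct (near_inside w z r eps Hr He ltac:(lra)) as (z' & H1 & H2).
      exists z'. split; [easy|]. split; [now apply U_ball_inC | now exists z'].
    + apply adherent_inC. intros eps He. exists z. split.
      { replace (z - z)%C with (RtoC 0) by ring. now rewrite Cmod_0. }
      split; [now exists z|]. intros [HU _]. apply U_ball_inC in HU; [lra | easy].
Qed.

(** [real] sends an infinite least upper bound to 0; the bound G excludes that case. Its size does
    not matter. *)
Lemma sup_boundary_le (f : A -> A) G z :
  (forall z, Cmod (lemn w z) = r ^ 2 -> norm (f (inC J z)) <= G) ->
  Cmod (lemn w z) = r ^ 2 -> norm (f (inC J z)) <= sup_boundary J y r f.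
Proof.
  intros HG Hz. unfold sup_boundary. set (E := fun v => _).
  assert (HE : forall z, Cmod (lemn w z) = r ^ 2 -> E (norm (f (inC J z)))).
  { intros z' Hz'. exists (inC J z'). split; [now apply boundary_inC | easy]. }
  destruct (Lub_Rbar_correct E) as [H1 H2].
  assert (Hub : Rbar_le (Lub_Rbar E) G).
  { apply H2. intros v (x & Hx & ->). destruct Hx as [[z' ->] Hx].
    apply HG. apply boundary_inC. split; [now exists z' | exact Hx]. }
  assert (Hlb := H1 _ (HE z Hz)).
  destruct (Lub_Rbar E) as [l | |]; simpl in *; easy.
Qed.

End Geometry.

(** * Estimates and uniqueness for spherical series *)

Section TermBound.
Variable A : alt_star_algebra.
Hypothesis hnorm : norm_compatible A.
Variable M : R.
Hypothesis HM1 : 1 <= M.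
Hypothesis HM : forall x y : A, norm (x ** y) <= M * norm x * norm y.

(** Replacing the unit I by J in the centre moves it by at most 2 |Im w|; added to [dist_node_le]
    this gives the 4. Indexing by [S n] sacrifices one power of u and so covers both parities at
    once. *)
Lemma spherical_term_bound (I J : A) w z n s u : imag_sphere I -> imag_sphere J -> 0 <= u ->
  Cmod (lemn w z) <= u ^ 2 ->
  norm (spherical_term (inC J w) (S n) s (inC I z)) <=
    M ^ 2 * (u ^ n * (u + 4 * Rabs (Im w))) * norm s.
Proof.
  intros HI HJ Hu Hz. rewrite spherical_term_inC by easy.
  unfold newton_lin, newton_cst.
  assert (Hp : forall m, Cmod (lemn w z ^ m)%C <= u ^ (2 * m)).
  { intros m. rewrite Cmod_pow, pow_mult. apply pow_incr. split; [apply Cmod_ge_0 | easy]. }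
  assert (H0 := Rabs_pos (Im w)). assert (Hs := norm_ge_0 s).
  destruct (even_or_odd_div2 (S n)) as [[E1 E2]|[E1 E2]]; rewrite E1.
  - rewrite inC_zero, amul_zero_l, Cmult_1_r.
    apply Rle_trans with (M * Cmod (lemn w z ^ Nat.div2 (S n))%C * norm s).
    { apply Rle_trans with (norm (inC I (lemn w z ^ Nat.div2 (S n))%C ** s));
        [right; f_equal; module | now apply norm_act]. }
    apply Rmult_le_compat_r; [easy|].
    specialize (Hp (Nat.div2 (S n))). rewrite <- E2 in Hp. simpl pow in Hp.
    assert (Hun : 0 <= u ^ n) by now apply pow_le.
    apply Rle_trans with (M * (u ^ n * (u + 4 * Rabs (Im w)))).
    + apply Rmult_le_compat_l; [lra|]. eapply Rle_trans; [exact Hp|]. nra.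
    + apply Rmult_le_compat_r; [|nra]. apply Rmult_le_pos; lra.
  - assert (En : n = (2 * Nat.div2 (S n))%nat) by lia. set (m := Nat.div2 (S n)) in *.
    replace (minus (inC I (lemn w z ^ m * z)%C ** s) (inC I (lemn w z ^ m)%C ** (inC J w ** s)))
      with (inC I (lemn w z ^ m)%C ** (minus (inC I z) (inC J w) ** s)).
    2:{ rewrite amul_minus_l, amul_minus_r, inC_mul_act by easy. easy. }
    eapply Rle_trans; [now apply norm_act|].
    assert (Hd : norm (minus (inC I z) (inC J w)) <= u + 4 * Rabs (Im w)).
    { replace (minus (inC I z) (inC J w)) with
        (plus (inC I (z - w)%C) (minus (scal (Im w) (inC I Ci)) (scal (Im w) (inC J Ci)))).
      2:{ rewrite inC_minus, !inC_Ci. unfold inC. module. }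
      assert (Hn : forall K : A, imag_sphere K -> norm (scal (Im w) (inC K Ci)) <= Rabs (Im w)).
      { intros K HK. eapply Rle_trans; [apply norm_scal_le|].
        rewrite norm_inC, Cmod_Ci by easy. lra. }
      apply Rle_trans with ((u + 2 * Rabs (Im w)) + (Rabs (Im w) + Rabs (Im w))); [|lra].
      apply norm_triangle_le.
      - rewrite norm_inC by easy. now apply dist_node_le.
      - apply norm_minus_le; now apply Hn. }
    specialize (Hp m). rewrite <- En in Hp.
    apply Rle_trans with (M * u ^ n * (M * (u + 4 * Rabs (Im w)) * norm s)).
    + apply Rmult_le_compat; [|apply norm_ge_0| |].
      * apply Rmult_le_pos; [lra | apply Cmod_ge_0].
      * apply Rmult_le_compat_l; lra.
      * eapply Rle_trans; [apply HM|]. apply Rmult_le_compat_r; [easy|].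
        apply Rmult_le_compat_l; lra.
    + right. ring.
Qed.

End TermBound.

Lemma coef_cst_pos M : 1 <= M -> 0 < coef_cst M.
Proof. intros HM. unfold coef_cst. assert (0 <= M ^ 2 * (1 + M)) by (apply Rmult_le_pos; nra). lra. Qed.

Lemma bounded_terms (V : NormedModule R_AbsRing) (a : nat -> V) l : is_series a l ->
  exists B, 0 <= B /\ forall n, norm (a n) <= B.
Proof.
  intros H. destruct (series_term_small V a l H 1 Rlt_0_1) as [N HN].
  assert (HB : exists B, 0 <= B /\ forall n, (n < N)%nat -> norm (a n) <= B).
  { clear HN. induction N as [|N (B & HB0 & HB)]; [exists 0; split; [lra | lia]|].
    exists (Rmax B (norm (a N))). split; [eapply Rle_trans; [exact HB0 | apply Rmax_l]|].
    intros n Hn. destruct (Nat.eq_dec n N) as [->|]; [apply Rmax_r|].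
    eapply Rle_trans; [apply HB; lia | apply Rmax_l]. }
  destruct HB as (B & HB0 & HB). exists (B + 1). split; [lra|]. intros n.
  destruct (le_lt_dec N n) as [Hn|Hn]; [specialize (HN n Hn); lra | specialize (HB n Hn); lra].
Qed.

Section Expansion.
Variable A : alt_star_algebra.
Hypothesis hnorm : norm_compatible A.
Variable M : R.
Hypothesis HM1 : 1 <= M.
Hypothesis HM : forall x y : A, norm (x ** y) <= M * norm x * norm y.

(** With rho halfway between r^2 and R0 and R1 = sqrt rho, [stem_expansion] has the terms u_k + (z -
    xi) v_k. They become s_(2k) + (z - w) s_(2k+1) for s_(2k) = u_k + (w - xi) v_k, on every plane
    [C_I], because xi is real and hence the same element of all planes. *)
Lemma spherical_expansion (J : A) w (F : C -> A * A) r R0 : imag_sphere J -> 0 < r -> r ^ 2 < R0 ->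
  stem (fun z => Cmod (lemn w z) < R0) F -> holomorphic (fun z => Cmod (lemn w z) < R0) F ->
  exists R1 B (s : nat -> A), r < R1 /\ (forall n, norm (s n) <= B / R1 ^ n) /\
    forall I z, imag_sphere I -> Cmod (lemn w z) < R1 ^ 2 ->
      is_series (fun n => spherical_term (inC J w) n (s n) (inC I z)) (slice_at I (F z)).
Proof.
  intros HJ Hr HR0 Hst Hhol. set (rho := (r ^ 2 + R0) / 2).
  assert (Hr2 : 0 < r ^ 2) by nra.
  destruct (stem_expansion A F w R0 rho ltac:(unfold rho; lra) Hst Hhol) as (u & v & B0 & Hb & Hs).
  set (R1 := sqrt rho). set (xi := RtoC (Re w)).
  assert (HR1 : R1 ^ 2 = rho) by (apply pow2_sqrt; unfold rho; lra).
  assert (HR1p : 0 < R1) by (apply sqrt_lt_R0; unfold rho; lra).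
  assert (HrR1 : r < R1).
  { rewrite <- (sqrt_pow2 r) by lra. apply sqrt_lt_1; unfold rho; lra. }
  assert (Hpow : forall k, R1 ^ (2 * k) = rho ^ k) by (intros; now rewrite pow_mult, HR1).
  set (s n := if Nat.even n then plus (u (Nat.div2 n)) (inC J (w - xi)%C ** v (Nat.div2 n))
              else v (Nat.div2 n)).
  assert (Hse : forall k, s (2 * k)%nat = plus (u k) (inC J (w - xi)%C ** v k)).
  { intros k. unfold s. rewrite Nat.even_even, Nat.div2_double. easy. }
  assert (Hso : forall k, s (S (2 * k)) = v k).
  { intros k. unfold s. rewrite Nat.even_succ, Nat.odd_even, Nat.div2_succ_double. easy. }
  assert (HB0 : 0 <= B0).
  { destruct (Hb 0%nat) as [H _]. simpl in H. generalize (norm_ge_0 (u 0%nat)). lra. }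
  set (B := B0 + M * Cmod (w - xi)%C * B0 + B0 * R1).
  assert (HwB : 0 <= M * Cmod (w - xi)%C * B0).
  { repeat apply Rmult_le_pos; [lra | apply Cmod_ge_0 | easy]. }
  assert (HsB : forall n, norm (s n) <= B / R1 ^ n).
  { intros n. destruct (even_or_odd_div2 n) as [[_ E]|[_ E]]; rewrite E; set (k := Nat.div2 n).
    - rewrite Hse, Hpow. destruct (Hb k) as [H1 H2].
      assert (Hk : 0 < / rho ^ k) by (rewrite <- Hpow; apply Rinv_0_lt_compat, pow_lt; lra).
      apply Rle_trans with (B0 / rho ^ k + M * Cmod (w - xi)%C * (B0 / rho ^ k)).
      + apply norm_triangle_le; [easy|]. eapply Rle_trans; [now apply norm_act|].
        apply Rmult_le_compat_l; [|easy]. apply Rmult_le_pos; [lra | apply Cmod_ge_0].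
      + unfold B, Rdiv. assert (0 <= B0 * R1) by (apply Rmult_le_pos; lra). nra.
    - rewrite Hso. destruct (Hb k) as [_ H2].
      change (R1 ^ S (2 * k)) with (R1 * R1 ^ (2 * k)). rewrite Hpow.
      assert (Hk : 0 < rho ^ k) by (rewrite <- Hpow; apply pow_lt; lra).
      eapply Rle_trans; [exact H2|].
      replace (B0 / rho ^ k) with (B0 * R1 / (R1 * rho ^ k)) by (field; lra).
      apply Rmult_le_compat_r; [|unfold B; lra].
      left. apply Rinv_0_lt_compat. now apply Rmult_lt_0_compat. }
  exists R1, B, s. split; [easy|]. split; [easy|].
  intros I z HI Hz. rewrite HR1 in Hz.
  apply is_series_unpair.
  - generalize (Hs z I HI Hz). apply is_series_ext. intros k.
    rewrite Hse, Hso, !spherical_term_inC by easy.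
    unfold newton_lin, newton_cst.
    rewrite Nat.even_even, Nat.even_succ, Nat.odd_even, Nat.div2_double, Nat.div2_succ_double.
    rewrite Cmult_1_r, inC_zero, amul_zero_l, <- (inC_mul_act A I HI _ z).
    replace (minus (minus (inC I (lemn w z ^ k)%C ** plus (u k) (inC J (w - xi)%C ** v k)) zero) zero)
      with (inC I (lemn w z ^ k)%C ** plus (u k) (inC J (w - xi)%C ** v k)) by module.
    fold xi. rewrite !inC_minus, !amul_minus_l, !amul_plus_r, !amul_minus_r.
    replace (inC J xi ** v k) with (inC I xi ** v k); [module|].
    unfold xi. now rewrite !inC_RtoC.
  - (* the terms decay geometrically, by comparison with a slightly larger lemniscate *)
    set (m := Cmod (lemn w z)) in *. set (t := sqrt ((m + rho) / 2)).
    assert (Hm : 0 <= m) by apply Cmod_ge_0.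
    assert (Ht2 : t ^ 2 = (m + rho) / 2) by (apply pow2_sqrt; lra).
    assert (Ht0 : 0 < t) by (apply sqrt_lt_R0; lra).
    assert (HtR : t < R1) by (apply sqrt_lt_1; lra).
    assert (Hq : 0 <= t / R1 < 1).
    { split; [apply Rdiv_le_0_compat; lra|]. apply Rlt_div_l; lra. }
    set (K := M ^ 2 * (t + 4 * Rabs (Im w)) * B / R1).
    assert (HB : 0 <= B) by (unfold B; assert (0 <= B0 * R1) by (apply Rmult_le_pos; lra); lra).
    assert (HK : 0 <= K).
    { apply Rdiv_le_0_compat; [|easy]. apply Rmult_le_pos; [|easy].
      apply Rmult_le_pos; [apply pow2_ge_0 | generalize (Rabs_pos (Im w)); lra]. }
    intros eps He.
    destruct (pow_lt_1_zero (t / R1) ltac:(rewrite Rabs_pos_eq; lra) (eps / (K + 1))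
      ltac:(apply Rdiv_lt_0_compat; lra)) as [N HN].
    exists (S N). intros [|n] Hn; [lia|].
    eapply Rle_lt_trans; [apply (spherical_term_bound A hnorm M HM1 HM I J w z n (s (S n)) t);
      try easy; [lra | rewrite Ht2; fold m; lra]|].
    apply Rle_lt_trans with (K * (t / R1) ^ n).
    + assert (HR1n : 0 < R1 ^ n) by now apply pow_lt.
      replace (K * (t / R1) ^ n) with (M ^ 2 * (t ^ n * (t + 4 * Rabs (Im w))) * (B / R1 ^ S n)).
      * apply Rmult_le_compat_l; [|apply HsB].
        apply Rmult_le_pos; [apply pow2_ge_0|]. apply Rmult_le_pos; [now apply pow_le; lra|].
        generalize (Rabs_pos (Im w)); lra.
      * unfold K, Rdiv. rewrite Rpow_mult_distr, pow_inv. simpl pow. field. lra.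
    + specialize (HN n ltac:(lia)). rewrite Rabs_pos_eq in HN by (apply pow_le; lra).
      apply Rle_lt_trans with (K * (eps / (K + 1))).
      * apply Rmult_le_compat_l; lra.
      * replace (K * (eps / (K + 1))) with (eps * (K / (K + 1))) by (field; lra).
        rewrite <- (Rmult_1_r eps) at 2. apply Rmult_lt_compat_l; [easy|].
        apply Rlt_div_l; lra.
Qed.

(** Applies [coef_bound], whose weight needs a positive supremum, to S0 + e and lets e tend to 0.
    The case S0 = 0 is the source of uniqueness. *)
Lemma coef_bound_le (J : A) w (s : nat -> A) (g : C -> A) r R1 B S0 :
  imag_sphere J -> 0 < r < R1 -> (forall n, norm (s n) <= B / R1 ^ n) -> 0 <= S0 ->
  (forall z, Cmod (lemn w z) = r ^ 2 ->
     is_series (fun n => inC J (newton w n z) ** s n) (g z) /\ norm (g z) <= S0) ->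
  forall n, norm (s n) <= coef_cst M * S0 / r ^ n.
Proof.
  intros HJ Hr Hs HS Hg n. apply le_epsilon. intros eps He.
  assert (HK := coef_cst_pos M HM1).
  assert (Hrn : 0 < r ^ n) by (apply pow_lt; lra).
  set (e := eps * r ^ n / coef_cst M).
  assert (He' : 0 < e) by (apply Rdiv_lt_0_compat; [now apply Rmult_lt_0_compat | easy]).
  eapply Rle_trans.
  - apply (coef_bound A hnorm M HM1 HM J w s g r R1 B (S0 + e)); try easy; [lra|].
    intros z Hz. destruct (Hg z Hz). split; [easy | lra].
  - right. unfold e. field. lra.
Qed.

(** The terms at one point z1 with [lemn w z1] = R1^2 are bounded, which bounds d n by a multiple of
    1/R1^n. On the smaller radius r/2 the sum is 0, so [coef_bound_le] with S0 = 0 makes every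
    coefficient vanish. *)
Lemma spherical_series_unique (J : A) w (d : nat -> A) r : imag_sphere J -> 0 < r ->
  (forall z, Cmod (lemn w z) < r ^ 2 ->
     is_series (fun n => inC J (newton w n z) ** d n) zero) ->
  forall n, d n = zero.
Proof.
  (* Any radius strictly between r/2 and r would do. *)
  intros HJ Hr Hd. set (R1 := 3 / 4 * r).
  destruct (Csqrt_exists (RtoC (R1 ^ 2) - RtoC (Im w ^ 2))%C) as [h Hh].
  set (z1 := (RtoC (Re w) + h)%C).
  assert (Hz1 : lemn w z1 = RtoC (R1 ^ 2)).
  { rewrite lemn_shift. unfold z1. replace (RtoC (Re w) + h - RtoC (Re w))%C with h by ring.
    rewrite Hh. ring. }
  assert (HR1 : 0 < R1 < r) by (unfold R1; lra).
  assert (Hz1m : Cmod (lemn w z1) = R1 ^ 2).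
  { rewrite Hz1, Cmod_R, Rabs_pos_eq; nra. }
  destruct (bounded_terms A _ _ (Hd z1 ltac:(rewrite Hz1m; nra))) as (B & HB0 & HB).
  assert (Hne : (z1 - w)%C <> 0%C).
  { intros E. assert (lemn w z1 = 0%C) by (unfold lemn; rewrite E; ring).
    rewrite H, Cmod_0 in Hz1m. nra. }
  assert (Hnp := proj1 (Cmod_gt_0 _) Hne).
  (* m compensates for the single factor z1 - w of odd Newton polynomials, so that m R1^n is a lower
     bound for both parities. *)
  set (m := Rmin 1 (Cmod (z1 - w)%C / R1)).
  assert (Hm : 0 < m).
  { apply Rmin_glb_lt; [lra|]. apply Rdiv_lt_0_compat; lra. }
  assert (Hnew : forall n, m * R1 ^ n <= Cmod (newton w n z1)).
  { intros n. assert (Hp : forall k, Cmod (lemn w z1 ^ k)%C = R1 ^ (2 * k)).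
    { intros k. now rewrite Cmod_pow, Hz1m, pow_mult. }
    destruct (even_or_odd_div2 n) as [[_ E]|[_ E]]; rewrite E; set (k := Nat.div2 n).
    - rewrite newton_even, Hp. rewrite <- (Rmult_1_l (R1 ^ (2 * k))) at 2.
      apply Rmult_le_compat_r; [apply pow_le; lra | apply Rmin_l].
    - rewrite newton_odd, Cmod_mult, Hp. change (R1 ^ S (2 * k)) with (R1 * R1 ^ (2 * k)).
      replace (R1 ^ (2 * k) * Cmod (z1 - w)%C) with (Cmod (z1 - w)%C / R1 * (R1 * R1 ^ (2 * k)))
        by (field; lra).
      apply Rmult_le_compat_r; [|apply Rmin_r]. apply Rmult_le_pos; [lra | apply pow_le; lra]. }
  assert (HdB : forall n, norm (d n) <= (M * B / m) / R1 ^ n).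
  { intros n. assert (HRn : 0 < R1 ^ n) by (apply pow_lt; lra).
    assert (Hpos : 0 < Cmod (newton w n z1)).
    { eapply Rlt_le_trans; [|apply Hnew]. now apply Rmult_lt_0_compat. }
    rewrite <- (inC_inv_act A J HJ (newton w n z1) (d n)) by now apply Cmod_gt_0.
    eapply Rle_trans; [now apply norm_act|]. rewrite Cmod_inv by now apply Cmod_gt_0.
    replace (M * B / m / R1 ^ n) with (M * / (m * R1 ^ n) * B) by (field; lra).
    apply Rmult_le_compat; [|apply norm_ge_0| |apply HB].
    - apply Rmult_le_pos; [lra|]. left; now apply Rinv_0_lt_compat.
    - apply Rmult_le_compat_l; [lra|]. apply Rinv_le_contravar; [|apply Hnew].
      now apply Rmult_lt_0_compat. }
  intros n.
  assert (H0 := coef_bound_le J w d (fun _ => zero) (r / 2) R1 _ 0 HJ ltac:(unfold R1; lra) HdB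
    (Rle_refl 0)).
  apply (norm_eq_zero (V := A)). apply Rle_antisym; [|apply norm_ge_0].
  eapply Rle_trans; [apply H0|].
  - intros z Hz. split; [apply Hd; rewrite Hz; nra | right; exact norm_zero].
  - right. field. apply pow_nonzero. lra.
Qed.

(** Summing the bounds on the terms gives the fraction (u + 4 |Im w|)/(r - u). It is at most twice
    (r + 2 |Im w|)/(r - u), and the remaining factors of the fraction in the statement are at least
    1; the 2 goes into the constant. *)
Lemma spherical_tail_bound (I J : A) w z (s : nat -> A) x r S0 u n : imag_sphere I -> imag_sphere J ->
  0 <= u < r -> 0 <= S0 -> Cmod (lemn w z) <= u ^ 2 ->
  (forall n, norm (s n) <= coef_cst M * S0 / r ^ n) ->
  is_series (fun n => spherical_term (inC J w) n (s n) (inC I z)) x ->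
  norm (minus x (sum_n (fun k => spherical_term (inC J w) k (s k) (inC I z)) n)) <=
    2 * M ^ 2 * coef_cst M * S0 * (u ^ n / r ^ n) *
      ((3 * r + 2 * Rabs (Im w)) * (r + 2 * Rabs (Im w)) ^ 2 / (r * (r - u) ^ 2)).
Proof.
  intros HI HJ Hu HS Hz Hs Hx. set (eta := Rabs (Im w)).
  assert (Heta : 0 <= eta) by apply Rabs_pos.
  assert (HK := coef_cst_pos M HM1).
  set (a k := spherical_term (inC J w) k (s k) (inC I z)).
  assert (Ha : is_series (fun k => a (S n + k)%nat) (minus x (sum_n a n))).
  { apply (is_series_incr_n a (S n)); [lia|]. simpl pred.
    assert (E : x = plus (minus x (sum_n a n)) (sum_n a n)) by module.
    exact (eq_ind _ (fun l : A => is_series a l) Hx _ E). }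
  assert (Hq : 0 <= u / r < 1).
  { split; [apply Rdiv_le_0_compat; lra|]. apply Rlt_div_l; lra. }
  set (c := M ^ 2 * (u + 4 * eta) * (coef_cst M * S0) * (u ^ n / r ^ n) / r).
  assert (Hb : forall k, norm (a (S n + k)%nat) <= c * (u / r) ^ k).
  { intros k. change (S n + k)%nat with (S (n + k)). unfold a.
    eapply Rle_trans; [apply (spherical_term_bound A hnorm M HM1 HM I J w z (n + k) _ u); easy|].
    fold eta. assert (Hr0 : r <> 0) by lra. assert (Hrn : r ^ n <> 0) by (apply pow_nonzero; lra).
    assert (Hrk : r ^ k <> 0) by (apply pow_nonzero; lra).
    replace (c * (u / r) ^ k) with
      (M ^ 2 * (u ^ (n + k) * (u + 4 * eta)) * (coef_cst M * S0 / r ^ S (n + k))).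
    - apply Rmult_le_compat_l; [|apply Hs].
      apply Rmult_le_pos; [apply pow2_ge_0|]. apply Rmult_le_pos; [apply pow_le; lra | lra].
    - unfold c, Rdiv. rewrite Rpow_mult_distr, pow_inv. simpl pow. rewrite !pow_add. field. easy. }
  eapply Rle_trans; [apply (series_norm_le A _ _ _ _ Hb Ha (is_series_geom_scal c _ Hq))|].
  set (pw := u ^ n / r ^ n).
  assert (Hpw : 0 <= pw).
  { apply Rdiv_le_0_compat; [apply pow_le; lra | apply pow_lt; lra]. }
  replace (c / (1 - u / r)) with
    (M ^ 2 * (coef_cst M * S0) * pw * ((u + 4 * eta) / (r - u))) by (unfold c; fold pw; field; lra).
  replace (2 * M ^ 2 * coef_cst M * S0 * pw * ((3 * r + 2 * eta) * (r + 2 * eta) ^ 2 / (r * (r - u) ^ 2)))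
    with (M ^ 2 * (coef_cst M * S0) * pw *
     (2 * ((3 * r + 2 * eta) / r * ((r + 2 * eta) / (r - u))) * ((r + 2 * eta) / (r - u))))
    by (field; lra).
  apply Rmult_le_compat_l.
  { apply Rmult_le_pos; [|easy]. apply Rmult_le_pos; [apply pow2_ge_0|].
    apply Rmult_le_pos; lra. }
  assert (H1 : 1 <= (3 * r + 2 * eta) / r) by (apply Rle_div_r; lra).
  assert (H2 : 1 <= (r + 2 * eta) / (r - u)) by (apply Rle_div_r; lra).
  assert (H3 : (u + 4 * eta) / (r - u) <= 2 * ((r + 2 * eta) / (r - u))).
  { unfold Rdiv. rewrite <- Rmult_assoc. apply Rmult_le_compat_r; [|lra].
    left; apply Rinv_0_lt_compat; lra. }
  assert (H4 : 1 <= (3 * r + 2 * eta) / r * ((r + 2 * eta) / (r - u))) by nra.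
  eapply Rle_trans; [exact H3|]. nra.
Qed.

End Expansion.

(** * Stem functions and the contour formulas *)

Section SliceValues.
Variable A : alt_star_algebra.
Implicit Types (J I s : A) (u v : A * A) (z w : C).

Lemma pair_minus u v : minus u v = (minus (fst u) (fst v), minus (snd u) (snd v)).
Proof. reflexivity. Qed.

Lemma slice_at_plus J u v : slice_at J (plus u v) = plus (slice_at J u) (slice_at J v).
Proof.
  change (plus u v) with (plus (fst u) (fst v), plus (snd u) (snd v)).
  unfold slice_at; cbn [fst snd]. rewrite amul_plus_r. module.
Qed.

Lemma slice_at_minus J u v : slice_at J (minus u v) = minus (slice_at J u) (slice_at J v).
Proof. rewrite pair_minus. unfold slice_at; cbn [fst snd]. rewrite amul_minus_r. module. Qed.

Lemma slice_at_scal J (a : R) u : slice_at J (scal a u) = scal a (slice_at J u).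
Proof.
  change (scal a u) with (scal a (fst u), scal a (snd u)).
  unfold slice_at; cbn [fst snd]. rewrite amul_scal_r. module.
Qed.

Lemma slice_at_sum_n J (a : nat -> A * A) n :
  slice_at J (sum_n a n) = sum_n (fun k => slice_at J (a k)) n.
Proof.
  induction n as [|n IH]; [now rewrite !sum_O|]. rewrite !sum_Sn, <- IH.
  exact (slice_at_plus J _ _).
Qed.

Lemma slice_at_inj J u v : imag_sphere J -> slice_at J u = slice_at J v ->
  slice_at (opp J) u = slice_at (opp J) v -> u = v.
Proof.
  intros HJ H1 H2. destruct u as [a b], v as [a' b']. unfold slice_at in *; cbn [fst snd] in *.
  rewrite !amul_opp_l in H2.
  assert (Ea : a = a').
  { transitivity (scal (/ 2) (plus (plus a (J ** b)) (plus a (opp (J ** b))))); [module; field|].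
    rewrite H1, H2. module; field. }
  subst a'. f_equal.
  assert (Eb : J ** b = J ** b').
  { transitivity (minus (plus a (J ** b)) a); [module|]. rewrite H1. module. }
  assert (E : forall x, J ** (J ** x) = opp x).
  { intros x. rewrite <- amul_alt_l, (imag_sphere_sq A J HJ), areal_mul_l. module. }
  transitivity (opp (J ** (J ** b))); [rewrite E; module|]. rewrite Eb, E. module.
Qed.

Lemma slice_at_mul_assoc I u s : associative_algebra A ->
  slice_at I (cmul u (ofA s)) = slice_at I u ** s.
Proof.
  intros H. unfold slice_at, cmul, ofA; cbn [fst snd].
  rewrite !amul_zero_r, !amul_plus_r, amul_plus_l, amul_zero_r, <- H. module.
Qed.

Lemma cmul_inC_ofA J z z' s :
  cmul (inC J z, inC J z') (ofA s) = (inC J z ** s, inC J z' ** s).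
Proof.
  unfold cmul, ofA; cbn [fst snd]. rewrite !amul_zero_r. f_equal; module.
Qed.

Lemma ofC_inC J z : ofC A z = (inC J (RtoC (Re z)), inC J (RtoC (Im z))).
Proof. unfold ofC. now rewrite !inC_RtoC. Qed.

Lemma ofA_inC J z : ofA (inC J z) = (inC J z, inC J (RtoC 0)).
Proof. unfold ofA. now rewrite inC_zero. Qed.

(** Complex scalars act associatively on the complexification, so multiplying by 1/z identifies the
    inverse that [epsilon] picks. *)
Lemma cinv_ofC z : z <> 0%C -> cinv (ofC A z) = ofC A (/ z)%C.
Proof.
  intros Hz. unfold cinv, inverse.
  assert (E1 : ofC A 1%C = @cone A).
  { unfold ofC, cone, areal; simpl. f_equal; module. }
  assert (H : exists v, cmul (ofC A z) v = cone A /\ cmul v (ofC A z) = cone A).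
  { exists (ofC A (/ z)%C). rewrite !ofC_mul, Cinv_r, Cinv_l by easy. easy. }
  assert (Hs := epsilon_spec (inhabits (cone A)) _ H). set (v := epsilon _ _) in *.
  destruct Hs as [Hs _].
  assert (Hv : cmul (ofC A (/ z)%C) (cmul (ofC A z) v) = v).
  { destruct v as [a b]. rewrite !cmul_ofC. cbn [fst snd].
    assert (E2 : (Re (/ z) * Re z - Im (/ z) * Im z = 1)%R).
    { assert (E := f_equal Re (Cinv_l z Hz)). exact E. }
    assert (E3 : (Re (/ z) * Im z + Im (/ z) * Re z = 0)%R).
    { assert (E := f_equal Im (Cinv_l z Hz)). exact E. }
    set (p := Re (/ z)%C) in *. set (q := Im (/ z)%C) in *.
    f_equal.
    - transitivity (plus (scal (p * Re z - q * Im z) a) (scal (- (p * Im z + q * Re z)) b));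
        [module|]. rewrite E2, E3. module.
    - transitivity (plus (scal (p * Re z - q * Im z) b) (scal (p * Im z + q * Re z) a));
        [module|]. rewrite E2, E3. module. }
  rewrite <- Hv, Hs, <- E1, ofC_mul. f_equal. ring.
Qed.

Lemma spherical_stem_inC J w n z : imag_sphere J -> spherical_stem (inC J w) n z =
  (inC J (RtoC (Re (newton_lin w n z)) - w * RtoC (Re (newton_cst w n z)))%C,
   inC J (RtoC (Im (newton_lin w n z)) - w * RtoC (Im (newton_cst w n z)))%C).
Proof.
  intros HJ. transitivity (cmul (spherical_stem (inC J w) n z) (ofA aone)).
  - destruct (spherical_stem (inC J w) n z) as [a b]. unfold cmul, ofA; cbn [fst snd].
    rewrite !amul_zero_r, !amul_one_r. f_equal; module.
  - rewrite spherical_stem_mul by easy. rewrite !amul_one_r.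
    unfold inC, areal; simpl. f_equal; module.
Qed.

Lemma stem_cmul (D : C -> Prop) (F G : C -> A * A) : stem D F -> stem D G ->
  stem D (fun z => cmul (F z) (G z)).
Proof.
  intros HF HG z Hz. destruct (HF z Hz) as [F1 F2], (HG z Hz) as [G1 G2].
  unfold cmul; cbn [fst snd]. rewrite F1, F2, G1, G2.
  rewrite !amul_opp_l, !amul_opp_r. split; module.
Qed.

Lemma spherical_stem_conj J w n D : imag_sphere J -> stem D (spherical_stem (inC J w) n).
Proof.
  intros HJ z _. rewrite !spherical_stem_inC, newton_lin_conj, newton_cst_conj by easy.
  cbn [fst snd]. rewrite !re_conj, !im_conj, <- inC_opp. split; [easy|].
  f_equal. rewrite !RtoC_opp. ring.
Qed.

Lemma slice_at_spherical_stem J w n z u : imag_sphere J ->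
  slice_at J (cmul (spherical_stem (inC J w) n z) u) = inC J (newton w n z) ** slice_at J u.
Proof.
  intros HJ. rewrite spherical_stem_inC, slice_at_cmul, newton_split by easy. do 2 f_equal.
  generalize (newton_lin w n z) (newton_cst w n z). intros a b.
  apply injective_projections; simpl; unfold Re, Im; ring.
Qed.

Lemma slice_at_opp_spherical_stem J w n z u : imag_sphere J ->
  slice_at (opp J) (cmul (spherical_stem (inC J w) n z) u) =
  inC J (newton w n (Cconj z)) ** slice_at (opp J) u.
Proof.
  intros HJ.
  rewrite spherical_stem_inC, slice_at_opp_cmul, newton_split, newton_lin_conj, newton_cst_conj by easy.
  do 2 f_equal. generalize (newton_lin w n z) (newton_cst w n z). intros a b.
  apply injective_projections; simpl; unfold Re, Im; ring.
Qed.

End SliceValues.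

(** * Stem functions rebuilt from their values along J and - J *)

Section HalfSum.
Variable A : alt_star_algebra.
Variable J : A.
Hypothesis HJ : imag_sphere J.

(* With [a, b] the values of a stem function along [J] and [- J], the stem
   function is [half_sum a b]. *)
Definition half_sum (a b : A) : A * A :=
  (scal (/ 2) (plus a b), scal (- / 2) (J ** minus a b)).

(** [half_sum] is a sum of two such linear maps, so derivatives and limits pass through it. *)
Definition act_pair (k l : R) (a : A) : A * A := (scal k a, scal l (J ** a)).

Lemma act_pair_linear k l : is_linear (act_pair k l).
Proof.
  assert (Hp : forall a b : A, act_pair k l (plus a b) = plus (act_pair k l a) (act_pair k l b)).
  { intros a b. change (act_pair k l (plus a b) =
      (plus (scal k a) (scal k b), plus (scal l (J ** a)) (scal l (J ** b)))).
    unfold act_pair. rewrite amul_plus_r. f_equal; module. }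
  assert (Hs : forall (e : R) (a : A), act_pair k l (scal e a) = scal e (act_pair k l a)).
  { intros e a. change (act_pair k l (scal e a) = (scal e (scal k a), scal e (scal l (J ** a)))).
    unfold act_pair. rewrite amul_scal_r. f_equal; module. }
  destruct (product_bounded A) as (M & HM1 & HM).
  split; [exact Hp | exact Hs |].
  assert (H2 : 0 < sqrt 2) by (apply sqrt_lt_R0; lra).
  assert (HMJ : 0 <= M * norm J) by (apply Rmult_le_pos; [lra | apply norm_ge_0]).
  assert (Hk := Rabs_pos k). assert (Hl := Rabs_pos l).
  assert (HlM : 0 <= Rabs l * (M * norm J)) by now apply Rmult_le_pos.
  exists (sqrt 2 * (1 + Rabs k + Rabs l * (M * norm J))).
  split; [apply Rmult_lt_0_compat; lra|]. intros a.
  eapply Rle_trans; [apply (norm_prod (U := A) (V := A))|].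
  rewrite Rmult_assoc. apply Rmult_le_compat_l; [lra|].
  assert (Ha := norm_ge_0 a). apply Rmax_lub.
  - eapply Rle_trans; [apply norm_scal_le|]. apply Rmult_le_compat_r; [easy | lra].
  - eapply Rle_trans; [apply norm_scal_le|].
    apply Rle_trans with (Rabs l * (M * norm J * norm a)).
    + apply Rmult_le_compat_l; [easy | apply HM].
    + rewrite <- Rmult_assoc. apply Rmult_le_compat_r; [easy | lra].
Qed.

Lemma half_sum_split a b : half_sum a b = plus (act_pair (/ 2) (- / 2) a) (act_pair (/ 2) (/ 2) b).
Proof.
  change (half_sum a b = (plus (scal (/ 2) a) (scal (/ 2) b),
    plus (scal (- / 2) (J ** a)) (scal (/ 2) (J ** b)))).
  unfold half_sum. rewrite amul_minus_r. f_equal; module.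
Qed.

Lemma slice_at_half_sum a b : slice_at J (half_sum a b) = a.
Proof.
  unfold slice_at, half_sum; cbn [fst snd]. rewrite amul_scal_r, <- amul_alt_l.
  rewrite (imag_sphere_sq A J HJ), areal_mul_l. module; field.
Qed.

Lemma slice_at_opp_half_sum a b : slice_at (opp J) (half_sum a b) = b.
Proof.
  unfold slice_at, half_sum; cbn [fst snd]. rewrite amul_scal_r, amul_opp_l, <- amul_alt_l.
  rewrite (imag_sphere_sq A J HJ), areal_mul_l. module; field.
Qed.

(** Holomorphy of an A-valued function for the complex structure on A given by left multiplication
    by J, with the continuity of the derivative included. *)
Definition J_derivative (D : C -> Prop) (Phi Phi' : C -> A) : Prop := forall z, D z ->
  (forall eps, 0 < eps -> exists d, 0 < d /\ forall z', Cmod (z' - z)%C < d ->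
     norm (minus (minus (Phi z') (Phi z)) (inC J (z' - z)%C ** Phi' z)) <= eps * Cmod (z' - z)%C) /\
  (forall eps, 0 < eps -> exists d, 0 < d /\ forall z', Cmod (z' - z)%C < d ->
     norm (minus (Phi' z') (Phi' z)) < eps).

Lemma J_derivative_line D Phi Phi' (p : R -> C) t e : J_derivative D Phi Phi' -> D (p t) ->
  Cmod e = 1 -> (forall u, (p u - p t)%C = (RtoC (u - t) * e)%C) ->
  is_derive (fun u => Phi (p u)) t (inC J e ** Phi' (p t)).
Proof.
  intros HP HD He Hp. apply (is_derive_eps A). intros eps Heps.
  destruct (proj1 (HP _ HD) eps Heps) as (d & Hd & H).
  assert (Hm : forall u, Cmod (p u - p t)%C = Rabs (u - t)).
  { intros u. rewrite Hp, Cmod_mult, He, Cmod_R. ring. }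
  apply locally_R_eps. exists d. split; [easy|]. intros u Hu.
  specialize (H (p u)). rewrite Hm in H. specialize (H Hu).
  rewrite Hp, inC_scal, amul_scal_l in H. exact H.
Qed.

(** Along the imaginary direction Phi(z) has derivative J Phi'(z), while Phi(conj z) has derivative
    - J Phi'(conj z). With J (J x) = - x the Cauchy-Riemann equation of the stem function
    follows. *)
Lemma half_sum_holomorphic (D : C -> Prop) Phi Phi' : conj_invariant D -> open D ->
  J_derivative D Phi Phi' ->
  forall G : C -> A * A, (forall z, D z -> G z = half_sum (Phi z) (Phi (Cconj z))) ->
  holomorphic D G.
Proof.
  intros HD Hop HP G HG.
  assert (Hd1 : forall p t a b, is_derive (fun u => Phi (p u)) t a ->
    is_derive (fun u => Phi (Cconj (p u))) t b ->
    is_derive (fun u => half_sum (Phi (p u)) (Phi (Cconj (p u)))) t (half_sum a b)).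
  { intros p t a b Ha Hb. rewrite half_sum_split.
    apply is_derive_ext with
      (fun u => plus (act_pair (/ 2) (- / 2) (Phi (p u))) (act_pair (/ 2) (/ 2) (Phi (Cconj (p u))))).
    { intros u. symmetry. apply half_sum_split. }
    apply (is_derive_plus (V := prod_NormedModule R_AbsRing A A)).
    - apply (is_derive_linear A (prod_NormedModule R_AbsRing A A) (act_pair (/ 2) (- / 2)));
        [apply act_pair_linear | exact Ha].
    - apply (is_derive_linear A (prod_NormedModule R_AbsRing A A) (act_pair (/ 2) (/ 2)));
        [apply act_pair_linear | exact Hb]. }
  assert (Hc' : forall z, D z -> continuous Phi' z).
  { intros z Hz. apply continuous_C_eps. intros eps He. apply (HP z Hz). easy. }
  assert (Hcc : forall z, D z -> continuous (fun z => Phi' (Cconj z)) z).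
  { intros z Hz. apply (continuous_comp Cconj Phi'); [|now apply Hc', HD].
    apply (linear_cont (U := C_R_NormedModule) (V := C_R_NormedModule)). apply Cconj_linear. }
  assert (Hcs : forall (p q : C -> A) z, continuous p z -> continuous q z ->
    continuous (fun z => half_sum (p z) (q z)) z).
  { intros p q z Hp Hq. apply continuous_ext with
      (fun z => plus (act_pair (/ 2) (- / 2) (p z)) (act_pair (/ 2) (/ 2) (q z))).
    { intros u. symmetry. apply half_sum_split. }
    apply (continuous_plus (V := prod_NormedModule R_AbsRing A A)).
    - apply (continuous_comp p (act_pair (/ 2) (- / 2))); [easy|].
      apply (linear_cont (U := A) (V := prod_NormedModule R_AbsRing A A)), act_pair_linear.
    - apply (continuous_comp q (act_pair (/ 2) (/ 2))); [easy|].
      apply (linear_cont (U := A) (V := prod_NormedModule R_AbsRing A A)), act_pair_linear. }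
  assert (Hcl : forall (p : C -> A) z, continuous p z -> continuous (fun z => J ** p z) z).
  { intros p z Hp. apply (continuous_comp p (fun v => J ** v)); [easy|].
    apply (linear_cont (U := A) (V := A)), amul_linear_r. }
  exists (fun z => half_sum (Phi' z) (Phi' (Cconj z))).
  exists (fun z => half_sum (J ** Phi' z) (opp (J ** Phi' (Cconj z)))).
  intros z Hz.
  assert (Hloc : locally z (fun y => half_sum (Phi y) (Phi (Cconj y)) = G y)).
  { generalize (Hop z Hz). apply filter_imp. intros y Hy. now rewrite HG. }
  destruct Hloc as [d Hd].
  split; [|split; [|split; [|split]]].
  - apply is_derive_ext_loc with (fun a : R => half_sum (Phi (a, Im z)) (Phi (Cconj (a, Im z)))).
    { exists d. intros a Ha. apply Hd. split; [exact Ha | apply ball_center]. }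
    apply (Hd1 (fun a : R => (a, Im z))).
    + replace (Phi' z) with (inC J 1%C ** Phi' (Re z, Im z)).
      * apply (J_derivative_line D Phi Phi' (fun a : R => (a, Im z))); [easy | now destruct z | apply Cmod_1 |].
        intros u. apply injective_projections; simpl; ring.
      * rewrite inC_one, amul_one_l. now destruct z.
    + replace (Phi' (Cconj z)) with (inC J 1%C ** Phi' (Cconj (Re z, Im z))).
      * apply (J_derivative_line D Phi Phi' (fun a : R => Cconj (a, Im z)));
          [easy | apply HD; now destruct z | apply Cmod_1 |].
        intros u. apply injective_projections; simpl; ring.
      * rewrite inC_one, amul_one_l. now destruct z.
  - apply is_derive_ext_loc with (fun b : R => half_sum (Phi (Re z, b)) (Phi (Cconj (Re z, b)))).
    { exists d. intros b Hb. apply Hd. split; [apply ball_center | exact Hb]. }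
    apply (Hd1 (fun b : R => (Re z, b))).
    + replace (J ** Phi' z) with (inC J Ci ** Phi' (Re z, Im z)).
      * apply (J_derivative_line D Phi Phi' (fun b : R => (Re z, b))); [easy | now destruct z | apply Cmod_Ci |].
        intros u. apply injective_projections; simpl; ring.
      * rewrite inC_Ci. now destruct z.
    + replace (opp (J ** Phi' (Cconj z))) with (inC J (- Ci)%C ** Phi' (Cconj (Re z, Im z))).
      * apply (J_derivative_line D Phi Phi' (fun b : R => Cconj (Re z, b)));
          [easy | apply HD; now destruct z | rewrite Cmod_opp; apply Cmod_Ci |].
        intros u. apply injective_projections; simpl; ring.
      * rewrite inC_opp, inC_Ci, amul_opp_l. now destruct z.
  - apply Hcs; [now apply Hc' | now apply Hcc].
  - apply Hcs; [now apply Hcl, Hc'|].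
    apply (continuous_opp (V := A)). now apply Hcl, Hcc.
  - assert (E : forall x, J ** (J ** x) = opp x).
    { intros x. rewrite <- amul_alt_l, (imag_sphere_sq A J HJ), areal_mul_l. module. }
    generalize (Phi' z) (Phi' (Cconj z)). intros a b.
    apply injective_projections; simpl; rewrite ?amul_minus_r, ?amul_opp_r, ?E.
    + change (plus (scal (/ 2) (plus a b))
        (opp (scal (- / 2) (minus (opp a) (opp (opp b))))) = (zero : A)). module; field.
    + change (plus (scal (- / 2) (minus (J ** a) (J ** b)))
        (scal (/ 2) (plus (J ** a) (opp (J ** b)))) = (zero : A)). module; field.
Qed.

End HalfSum.

Lemma lemn_sub q z : (lemn q z = (q - z) * (Cconj q - z))%C.
Proof. unfold lemn. ring. Qed.

(** Since [lemn q z] = (q - z)(conj q - z), the kernel is 1/(q - z) when i is read as J, and 1/(q -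
    conj z) when i is read as - J. Its two components are the corresponding half sum and half
    difference; the factor - i of k is the inverse of J. *)
Lemma remainder_kernel (A : alt_star_algebra) (J : A) w n q dz z v : imag_sphere J ->
  newton w (S n) q <> 0%C -> lemn q z <> 0%C ->
  let k u := (- Ci * / newton w (S n) q * / (q - u))%C in
  cmul (cmul (cmul (cmul (cmul (cinv (Delta_stem (inC J q) z))
      (minus (ofA (aconj (inC J q))) (ofC A z))) (ofA (ainv J)))
      (ofA (ainv (spherical (inC J w) (S n) (inC J q))))) (ofA (inC J dz))) (ofA v) =
  (inC J (RtoC (/ 2) * k z * dz + RtoC (/ 2) * k (Cconj z) * dz)%C ** v,
   inC J (RtoC (- / 2) * Ci * k z * dz + RtoC (/ 2) * Ci * k (Cconj z) * dz)%C ** v).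
Proof.
  intros HJ Hn Hl k.
  assert (HCi : Ci <> 0%C) by (intros E; apply (f_equal Im) in E; simpl in E; lra).
  assert (Hl' : lemn q (Cconj z) <> 0%C).
  { rewrite lemn_conj. intros E. apply Hl. rewrite <- (Cconj_conj (lemn q z)), E.
    apply injective_projections; simpl; ring. }
  rewrite Delta_stem_inC, cinv_ofC, aconj_inC, spherical_inC, ainv_inC by easy.
  replace (ainv J) with (inC J (- Ci)%C).
  2:{ transitivity (ainv (inC J Ci)); [|now rewrite inC_Ci].
    rewrite ainv_inC by easy. f_equal.
    replace (/ Ci)%C with (- (Ci * Ci) / Ci)%C; [field; easy|].
    replace (Ci * Ci)%C with (- RtoC 1)%C by (apply injective_projections; simpl; ring). field; easy. }
  assert (Hq : minus (ofA (inC J (Cconj q))) (ofC A z) =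
    (inC J (Cconj q - RtoC (Re z))%C, inC J (- RtoC (Im z))%C)).
  { rewrite pair_minus. unfold ofA, ofC; cbn [fst snd]. rewrite inC_minus, inC_opp, !inC_RtoC.
    f_equal; module. }
  rewrite Hq, (ofC_inC A J), !ofA_inC, !cmul_inC, cmul_inC_ofA by easy.
  set (l := (/ lemn q z)%C).
  assert (H1 : (l * (Cconj q - z) = / (q - z))%C).
  { unfold l. rewrite lemn_sub in Hl |- *. field.
    split; intros E; apply Hl; rewrite E; ring. }
  assert (H2 : (Cconj l * (Cconj q - Cconj z) = / (q - Cconj z))%C).
  { replace (Cconj l) with (/ lemn q (Cconj z))%C.
    - rewrite lemn_sub in Hl' |- *. field. split; intros E; apply Hl'; rewrite E; ring.
    - unfold l. rewrite lemn_conj. symmetry. now apply Cinv_conj. }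
  unfold k. rewrite <- H1, <- H2. clearbody l. clear H1 H2.
  replace (Cconj l) with (RtoC (Re l) - Ci * RtoC (Im l))%C
    by (apply injective_projections; simpl; unfold Re, Im; ring).
  replace (Cconj z) with (RtoC (Re z) - Ci * RtoC (Im z))%C
    by (apply injective_projections; simpl; unfold Re, Im; ring).
  assert (El : l = (RtoC (Re l) + Ci * RtoC (Im l))%C)
    by (apply injective_projections; simpl; unfold Re, Im; ring).
  assert (Ez : z = (RtoC (Re z) + Ci * RtoC (Im z))%C)
    by (apply injective_projections; simpl; unfold Re, Im; ring).
  revert El Ez.
  generalize (/ newton w (S n) q)%C (Cconj q). intros m q'.
  generalize (RtoC (Re l)) (RtoC (Im l)) (RtoC (Re z)) (RtoC (Im z)). intros l1 l2 z1 z2 El Ez. rewrite El, Ez.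
  assert (E2 : RtoC (/ 2) = (/ 2)%C) by (rewrite RtoC_inv; easy).
  assert (Ei : (Ci * Ci)%C = (- RtoC 1)%C) by (apply injective_projections; simpl; ring).
  rewrite RtoC_opp, E2.
  f_equal; do 2 f_equal.
  (* [ring] treats [Ci] as an atom; the two sides differ by a multiple of Ci^2 + 1 = 0, which is
     added explicitly. *)
  - match goal with |- ?a = ?b => transitivity (a + (Ci * Ci + RtoC 1) * (l2 * z2 * m * Ci * dz))%C end.
    + rewrite Ei. ring.
    + field.
  - match goal with |- ?a = ?b => transitivity (a + (Ci * Ci + RtoC 1) * (l2 * (q' - z1) - l1 * z2) * m * Ci * dz)%C end.
    + rewrite Ei. ring.
    + field.
Qed.

(** * Contour formulas for the coefficients and the remainders *)

Section ContourFormulas.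
Variable A : alt_star_algebra.
Hypothesis hnorm : norm_compatible A.
Variable J : A.
Hypothesis HJ : imag_sphere J.
Variables (w : C) (r R1 B : R) (s : nat -> A) (f : A -> A).
Hypothesis Hr : 0 < r < R1.
Hypothesis Hs : forall n, norm (s n) <= B / R1 ^ n.
Hypothesis Hf : forall z, Cmod (lemn w z) <= r ^ 2 ->
  is_series (fun n => inC J (newton w n z) ** s n) (f (inC J z)).
Variable c : list (R -> C).
Hypothesis Hc1 : forall h, In h c -> C1_arc h.
Hypothesis Hcl : Permutation (map (fun h => h 0) c) (map (fun h => h 1) c).
Hypothesis Htr : on_trace c (fun z => Cmod (lemn w z) = r ^ 2).
Hypothesis Hin : forall z, Cmod (lemn w z) < r ^ 2 -> winding_int c z = (2 * PI * Ci)%C.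

Let inside (z : C) : Prop := Cmod (lemn w z) < r ^ 2.
Let g (z : C) : A := f (inC J z).

Lemma coef_integral_eq n : coef_integral J (inC J w) f c n = s n.
Proof.
  assert (H := vcauchy_coef A hnorm J HJ w r R1 B s g Hr Hs Hf c Hc1 Hcl Htr Hin n).
  assert (H0 := newton_trace_neq0 w r R1 Hr c Htr (S n)).
  unfold coef_integral.
  rewrite (is_cint_contour_int A c _ (inC J (2 * PI * Ci)%C ** s n)).
  - assert (Hpi := PI_RGT_0). assert (H2 : (2 * PI * Ci)%C <> 0%C).
    { intros E. apply (f_equal Im) in E. simpl in E. lra. }
    replace (scal (2 * PI) J) with (inC J (2 * PI * Ci)%C).
    2:{ unfold inC, areal; simpl. module. }
    rewrite ainv_inC by easy. now apply inC_inv_act.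
  - revert H. apply is_cint_ext. intros h t Hh Ht.
    rewrite spherical_inC, ainv_inC, inC_mul by (try easy; now apply (H0 h t)). easy.
Qed.

Lemma inside_conj z : inside z -> inside (Cconj z).
Proof. unfold inside. now rewrite lemn_conj, Cmod_conj. Qed.

Lemma trace_lemn_neq0 z h t : inside z -> In h c -> 0 <= t <= 1 -> lemn (h t) z <> 0%C.
Proof.
  intros Hz Hh Ht. assert (Hht : Cmod (lemn w (h t)) = r ^ 2) by exact (Htr h t Hh Ht).
  unfold inside in Hz. unfold lemn. apply Cmult_neq_0; intros E; apply Ceq_minus in E;
    rewrite E in Hz; rewrite ?lemn_conj, ?Cmod_conj in Hz; lra.
Qed.

Let integrand n z (q dz : C) : A * A :=
  cmul (cmul (cmul (cmul (cmul (cinv (Delta_stem (inC J q) z))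
      (minus (ofA (aconj (inC J q))) (ofC A z))) (ofA (ainv J)))
      (ofA (ainv (spherical (inC J w) (S n) (inC J q))))) (ofA (inC J dz))) (ofA (f (inC J q))).

(** The part of the kernel that does not depend on z: what is left is the Cauchy kernel 1/(q - z),
    so the remainder is a Cauchy-type integral. *)
Let density n (q : C) : C := (- Ci * / newton w (S n) q)%C.

Lemma remainder_cint n (Phi : C -> A) :
  (forall z, inside z -> vcauchy A J g c (fun q => density n q * / (q - z))%C (Phi z)) ->
  forall z, inside z ->
    is_cint c (fun h t => fst (integrand n z (h t) (velocity h t))) (fst (half_sum A J (Phi z) (Phi (Cconj z)))) /\
    is_cint c (fun h t => snd (integrand n z (h t) (velocity h t))) (snd (half_sum A J (Phi z) (Phi (Cconj z)))).
Proof.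
  intros HPhi z Hz. assert (H0 := newton_trace_neq0 w r R1 Hr c Htr (S n)).
  assert (H1 := HPhi z Hz). assert (H2 := HPhi _ (inside_conj z Hz)).
  assert (Hk : forall h t, In h c -> 0 <= t <= 1 ->
    integrand n z (h t) (velocity h t) = _) by
    (intros h t Hh Ht; exact (remainder_kernel A J w n (h t) (velocity h t) z (f (inC J (h t))) HJ
      (H0 h t Hh Ht) (trace_lemn_neq0 z h t Hz Hh Ht))).
  split.
  - assert (H := vcauchy_lin A J HJ g c (RtoC (/ 2)) _ (RtoC (/ 2)) _ _ _ H1 H2).
    replace (fst (half_sum A J (Phi z) (Phi (Cconj z)))) with
      (plus (inC J (RtoC (/ 2)) ** Phi z) (inC J (RtoC (/ 2)) ** Phi (Cconj z))).
    2:{ unfold half_sum; cbn [fst]. rewrite !inC_RtoC, !areal_mul_l. module. }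
    revert H. apply is_cint_ext. intros h t Hh Ht.
    rewrite (Hk h t Hh Ht); cbn [fst]. unfold g, density. do 2 f_equal. ring.
  - assert (H := vcauchy_lin A J HJ g c (RtoC (- / 2) * Ci)%C _ (RtoC (/ 2) * Ci)%C _ _ _ H1 H2).
    replace (snd (half_sum A J (Phi z) (Phi (Cconj z)))) with
      (plus (inC J (RtoC (- / 2) * Ci)%C ** Phi z) (inC J (RtoC (/ 2) * Ci)%C ** Phi (Cconj z))).
    2:{ unfold half_sum; cbn [snd]. rewrite !inC_scal, !inC_Ci, !amul_scal_l, amul_minus_r. module. }
    revert H. apply is_cint_ext. intros h t Hh Ht.
    rewrite (Hk h t Hh Ht); cbn [snd]. unfold g, density. do 2 f_equal. ring.
Qed.

Lemma remainder_stem_half_sum n : exists Phi Phi' : C -> A,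
  J_derivative A J inside Phi Phi' /\
  (forall z, inside z -> remainder_stem J (inC J w) f c n z = half_sum A J (Phi z) (Phi (Cconj z))) /\
  (forall z, inside z ->
     vcauchy A J g c (fun q => density n q * / (q - z))%C (Phi z)).
Proof.
  assert (H0 := newton_trace_neq0 w r R1 Hr c Htr (S n)).
  destruct (cauchy_type_derivative A hnorm J HJ w r R1 B s g Hr Hs Hf c Hc1 Htr (density n))
    as (Phi & Phi' & H).
  { intros h t Hh Ht. apply continuous_Cmult; [apply continuous_const|].
    apply continuous_Cinv; [apply newton_continuous | now apply (H0 h t)]. }
  exists Phi, Phi'. split; [|split].
  - intros z Hz. split; apply (H z Hz).
  - intros z Hz. destruct (remainder_cint n Phi (fun z Hz => proj1 (H z Hz)) z Hz) as [E1 E2].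
    unfold remainder_stem, contour_int2. apply injective_projections; cbn [fst snd].
    + now apply is_cint_contour_int.
    + now apply is_cint_contour_int.
  - intros z Hz. apply (H z Hz).
Qed.

Lemma remainder_value n z L : inside z ->
  vcauchy A J g c (fun q => density n q * / (q - z))%C L ->
  inC J (newton w (S n) z) ** L =
  scal (2 * PI) (minus (f (inC J z)) (sum_n (fun k => inC J (newton w k z) ** s k) n)).
Proof.
  intros Hz HL.
  assert (H := vcauchy_remainder A hnorm J HJ w r R1 B s g Hr Hs Hf c Hc1 Hcl Htr Hin z n Hz).
  (* Multiplying the density by i N_(n+1)(z) gives the kernel of [vcauchy_remainder]; the summand
     with coefficient 0 only fits the shape of [vcauchy_lin]. *)
  assert (H1 := vcauchy_lin A J HJ g c (Ci * newton w (S n) z)%C _ (RtoC 0) _ _ _ HL HL).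
  set (T := minus (f (inC J z)) (sum_n (fun k => inC J (newton w k z) ** s k) n)) in *.
  assert (Ei : (Ci * Ci)%C = (- RtoC 1)%C) by (apply injective_projections; simpl; ring).
  assert (E : inC J (2 * PI * Ci)%C ** T =
    plus (inC J (Ci * newton w (S n) z)%C ** L) (inC J (RtoC 0) ** L)).
  { refine (vcauchy_unique A J g c _ _ _ H (vcauchy_ext A J g c _ _ _ _ H1)).
    intros h t Hh Ht. unfold density.
    generalize (newton w (S n) z) (/ newton w (S n) (h t))%C (/ (h t - z))%C. intros a b e.
    transitivity (- (Ci * Ci) * a * b * e)%C; [ring|]. rewrite Ei. ring. }
  transitivity (inC J (- Ci)%C ** (inC J (2 * PI * Ci)%C ** T)).
  - rewrite E, amul_plus_r, !inC_mul_act by easy.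
    transitivity (plus (inC J (newton w (S n) z) ** L) (inC J (RtoC 0) ** L)).
    { rewrite inC_zero, amul_zero_l. module. }
    f_equal; do 2 f_equal; [|ring].
    transitivity (- (Ci * Ci) * newton w (S n) z)%C; [rewrite Ei; ring | ring].
  - rewrite inC_mul_act by easy.
    replace (- Ci * (2 * PI * Ci))%C with (RtoC (2 * PI))
      by (apply injective_projections; simpl; ring).
    now rewrite inC_RtoC, areal_mul_l.
Qed.

Lemma remainder_stem_regular n :
  stem (U_plane w r) (remainder_stem J (inC J w) f c n) /\
  holomorphic (U_plane w r) (remainder_stem J (inC J w) f c n).
Proof.
  destruct (remainder_stem_half_sum n) as (Phi & Phi' & Hd & Hh & _).
  assert (HU : forall z, U_plane w r z <-> inside z) by (intros z; apply U_plane_lemn; lra).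
  split.
  - intros z Hz. apply HU in Hz. rewrite (Hh z Hz), (Hh _ (inside_conj z Hz)), Cconj_conj.
    unfold half_sum; cbn [fst snd]. rewrite !amul_minus_r. split; module.
  - apply (half_sum_holomorphic A J HJ _ Phi Phi').
    + intros z Hz. apply HU. apply inside_conj. now apply HU.
    + intros z Hz. apply HU in Hz.
      destruct (inside_distance w r c Htr z Hz) as (d & Hd0 & Hdi & _).
      apply locally_C_eps. exists d. split; [easy|]. intros u Hu. now apply HU, Hdi.
    + intros z Hz. now apply Hd, HU.
    + intros z Hz. now apply Hh, HU.
Qed.

Lemma slice_remainder n I z (P : C -> A * A) : imag_sphere I -> inside z ->
  stem (U_plane w r) P -> slice (fun z => cmul (P z) (remainder_stem J (inC J w) f c n z)) (inC I z) =
    slice_at I (cmul (P z) (remainder_stem J (inC J w) f c n z)).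
Proof.
  intros HI Hz HP.
  assert (HU : U_plane w r z) by (apply U_plane_lemn; [lra | easy]).
  destruct (stem_cmul A _ _ _ HP (proj1 (remainder_stem_regular n)) z HU) as [H1 H2].
  now apply slice_inC.
Qed.

(** Associativity lets the evaluation i |-> I pass to the left through the constant factors of the
    kernel, down to the inverse of [Delta], which is a complex scalar. *)
Lemma remainder_associative n I z : associative_algebra A -> imag_sphere I -> inside z ->
  slice (remainder_stem J (inC J w) f c n) (inC I z) =
  remainder_integral J (inC J w) f c n (inC I z).
Proof.
  intros Hass HI Hz.
  assert (HU : U_plane w r z) by (apply U_plane_lemn; [lra | easy]).
  destruct (remainder_stem_half_sum n) as (Phi & Phi' & _ & Hh & Hv).
  destruct (remainder_cint n Phi Hv z Hz) as [H1 H2].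
  destruct (proj1 (remainder_stem_regular n) z HU) as [K1 K2].
  rewrite (slice_inC A _ I z HI K1 K2), Hh by easy. symmetry. apply is_cint_contour_int.
  apply (is_cint_linear A A _ _ _ _ (amul_linear_r A I)) in H2.
  generalize (is_cint_plus _ _ _ _ _ _ H1 H2). apply is_cint_ext. intros h t Hh' Ht.
  change (slice_at I (integrand n z (h t) (velocity h t)) =
    ainv (Defs.Delta (inC J (h t)) (inC I z)) ** minus (aconj (inC J (h t))) (inC I z) ** ainv J **
      ainv (spherical (inC J w) (S n) (inC J (h t))) ** inC J (velocity h t) ** f (inC J (h t))).
  unfold integrand. rewrite !slice_at_mul_assoc by easy. do 4 f_equal.
  assert (Hl := trace_lemn_neq0 z h t Hz Hh' Ht).
  rewrite Delta_stem_inC, cinv_ofC, slice_at_cmul_ofC, Delta_inC, ainv_inC by easy.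
  f_equal. rewrite slice_at_minus, slice_at_ofC. f_equal.
  unfold slice_at, ofA; cbn [fst snd]. rewrite amul_zero_r. module.
Qed.

Variable F : C -> A * A.
Hypothesis HF : forall I z, imag_sphere I -> inside z -> f (inC I z) = slice_at I (F z).

(** Along a foreign plane [C_I] the factors cannot be regrouped. Both sides are instead values at I
    of stem functions, and these agree because their values along J and - J do, by [remainder_value]
    at z and at conj z. *)
Lemma remainder_identity n I z : imag_sphere I -> inside z ->
  minus (f (inC I z)) (sum_n (fun k => spherical_term (inC J w) k (s k) (inC I z)) n) =
  scal (/ (2 * PI)) (slice (fun z => cmul (spherical_stem (inC J w) (S n) z)
                                          (remainder_stem J (inC J w) f c n z)) (inC I z)).
Proof.
  intros HI Hz. assert (Hpi := PI_RGT_0).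
  rewrite slice_remainder by (easy || now apply spherical_stem_conj).
  rewrite <- slice_at_scal.
  set (T := minus (F z) (sum_n (fun k => cmul (spherical_stem (inC J w) k z) (ofA (s k))) n)).
  assert (HT : forall K, imag_sphere K -> slice_at K T =
    minus (f (inC K z)) (sum_n (fun k => spherical_term (inC J w) k (s k) (inC K z)) n)).
  { intros K HK. unfold T. rewrite slice_at_minus, slice_at_sum_n, (HF K z) by easy. f_equal.
    apply sum_n_ext. intros k. now rewrite slice_at_stem_mul, spherical_term_inC. }
  rewrite <- HT by easy. f_equal.
  destruct (remainder_stem_half_sum n) as (Phi & Phi' & _ & Hh & Hv).
  rewrite Hh by easy.
  assert (HJ' := imag_sphere_opp A J HJ).
  assert (Hval : forall u, inside u ->
    minus (f (inC J u)) (sum_n (fun k => spherical_term (inC J w) k (s k) (inC J u)) n) =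
    scal (/ (2 * PI)) (inC J (newton w (S n) u) ** Phi u)).
  { intros u Hu. rewrite (remainder_value n u (Phi u) Hu (Hv u Hu)), <- scal_Rmult.
    rewrite Rinv_l, scal_R1 by lra. f_equal. apply sum_n_ext. intros k.
    now rewrite spherical_term_slice. }
  apply (slice_at_inj A J); [easy | |].
  - rewrite HT, Hval by easy.
    now rewrite slice_at_scal, slice_at_spherical_stem, slice_at_half_sum.
  - rewrite HT by easy. rewrite !inC_opp_conj, Hval by now apply inside_conj.
    now rewrite slice_at_scal, slice_at_opp_spherical_stem, slice_at_opp_half_sum.
Qed.

End ContourFormulas.

Lemma lemniscate_point w r : exists z, lemn w z = RtoC (r ^ 2).
Proof.
  destruct (Csqrt_exists (RtoC (r ^ 2) - RtoC (Im w ^ 2))%C) as [h Hh].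
  exists (RtoC (Re w) + h)%C. rewrite lemn_shift.
  replace (RtoC (Re w) + h - RtoC (Re w))%C with h by ring. rewrite Hh. ring.
Qed.

Lemma Omega_inC_conj (A : alt_star_algebra) (D : C -> Prop) (J : A) z : conj_invariant D ->
  imag_sphere J -> Omega D (inC J z) -> D z.
Proof.
  intros HD HJ (I & u & HI & Hu & E).
  destruct (inC_eq_cases A J I z u HJ HI E) as [[-> _]|[-> _]]; [easy | now apply HD].
Qed.

Section BoundaryContour.
Variable A : alt_star_algebra.
Hypothesis hnorm : norm_compatible A.
Variables (J : A) (w : C) (r : R) (c : list (R -> C)).
Hypothesis HJ : imag_sphere J.
Hypothesis Hr : 0 < r.
Hypothesis Hc : boundary_param J (U_slice J (inC J w) r) c.

Lemma boundary_param_trace : on_trace c (fun z => Cmod (lemn w z) = r ^ 2).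
Proof.
  intros h t Hh Ht. apply (boundary_inC A hnorm J w r HJ Hr). apply (bp_trace Hc). now exists h, t.
Qed.

Lemma boundary_param_winding z : Cmod (lemn w z) < r ^ 2 -> winding_int c z = (2 * PI * Ci)%C.
Proof.
  intros Hz. apply (bp_inside Hc). split; [|now exists z]. now apply U_ball_inC.
Qed.

End BoundaryContour.

Theorem theorem5p4 (A : alt_star_algebra)
    (hnorm : norm_compatible A)
    (hS : exists J : A, imag_sphere J) :
  exists K K' : R, 0 < K /\ 0 < K' /\
  forall (D : C -> Prop) (f : A -> A) (y J : A) (w : C) (r : R),
    (exists z, D z) -> open D -> conj_invariant D -> connected (@Omega A D) ->
    slice_regular D f ->
    Omega D y -> imag_sphere J -> y = inC J w ->
    0 < r ->
    (forall x, closure_in (@quadratic_cone A) (U_ball y r) x -> Omega D x) ->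
  exists s : nat -> A,
    unique (fun s' : nat -> A =>
      forall x, U_ball y r x ->
        is_series (fun n => spherical_term y n (s' n) x) (f x)) s /\
    (forall c, boundary_param J (U_slice J y r) c ->
      forall n, s n = coef_integral J y f c n) /\
    (forall n, norm (s n) <= K * sup_boundary J y r f / r ^ n) /\
    (forall c, boundary_param J (U_slice J y r) c ->
      forall n,
        stem (U_plane w r) (remainder_stem J y f c n) /\
        holomorphic (U_plane w r) (remainder_stem J y f c n) /\
        (forall x, U_ball y r x ->
          minus (f x) (sum_n (fun k => spherical_term y k (s k) x) n) =
          scal (/ (2 * PI))
            (slice (fun z => cmul (spherical_stem y (S n) z)
                                  (remainder_stem J y f c n z)) x)) /\
        (associative_algebra A -> forall x, U_ball y r x ->
          slice (remainder_stem J y f c n) x = remainder_integral J y f c n x)) /\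
    (forall n x, U_ball y r x ->
      norm (minus (f x) (sum_n (fun k => spherical_term y k (s k) x) n)) <=
      K' * sup_boundary J y r f * (u_dist x y ^ n / r ^ n) *
      ((3 * r + 2 * Rabs (Im w)) * (r + 2 * Rabs (Im w)) ^ 2 /
       (r * (r - u_dist x y) ^ 2))).
Proof.
  destruct (product_bounded A) as (M & HM1 & HM).
  assert (HK := coef_cst_pos M HM1).
  (* Both constants are functions of M alone, hence of the algebra and its norm. *)
  exists (coef_cst M), (2 * M ^ 2 * coef_cst M).
  split; [easy|]. split; [apply Rmult_lt_0_compat; [nra | easy]|].
  intros D f y J w r _ Hop HD _ (F & Hst & Hhol & HfF) _ HJ -> Hr Hclo.
  assert (HDz : forall z, Cmod (lemn w z) <= r ^ 2 -> D z).
  { intros z Hz. apply (Omega_inC_conj A D J z HD HJ), Hclo. now apply closure_ball. }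
  (* The hypothesis on the closure leaves room: the expansion is taken on a larger domain, so the
     coefficients decay like 1/R1^n with R1 > r and the series still converges on the boundary. *)
  destruct (lemniscate_neighborhood D w r Hr Hop HDz) as (R0 & HR0 & HDR).
  assert (HfI : forall I z, imag_sphere I -> Cmod (lemn w z) < R0 -> f (inC I z) = slice_at I (F z)).
  { intros I z HI Hz. assert (Hd := HDR z Hz). rewrite HfF by now exists I, z.
    destruct (Hst z Hd) as [H1 H2]. now apply slice_inC. }
  destruct (spherical_expansion A hnorm M HM1 HM J w F r R0 HJ Hr HR0) as (R1 & B & s & HR1 & Hs & Hexp).
  { intros z Hz. now apply Hst, HDR. }
  { destruct Hhol as (Fa & Fb & H). exists Fa, Fb. intros z Hz. now apply H, HDR. }
  assert (Hr2 : 0 < r ^ 2) by nra.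
  assert (HR12 : r ^ 2 < R1 ^ 2) by nra.
  assert (Hf : forall z, Cmod (lemn w z) <= r ^ 2 ->
    is_series (fun n => inC J (newton w n z) ** s n) (f (inC J z))).
  { intros z Hz. rewrite (HfI J z HJ) by lra.
    generalize (Hexp J z HJ ltac:(lra)). apply is_series_ext. intros n.
    now apply spherical_term_slice. }
  assert (Hball : forall x, U_ball (inC J w) r x ->
    exists I z, imag_sphere I /\ x = inC I z /\ Cmod (lemn w z) < r ^ 2).
  { intros x Hx. destruct (cone_repr A x hS (proj1 Hx)) as (I & z & HI & ->).
    exists I, z. split; [easy|]. split; [easy|]. now apply (U_ball_inC A hnorm J w r HJ Hr I z HI) in Hx. }
  assert (Hser : forall x, U_ball (inC J w) r x ->
    is_series (fun n => spherical_term (inC J w) n (s n) x) (f x)).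
  { intros x Hx. destruct (Hball x Hx) as (I & z & HI & -> & Hz).
    rewrite (HfI I z HI) by lra. apply Hexp; [easy | lra]. }
  set (S0 := sup_boundary J (inC J w) r f).
  assert (HS0 : forall z, Cmod (lemn w z) = r ^ 2 -> norm (f (inC J z)) <= S0).
  (* Finiteness of the supremum comes from the normal convergence of the expansion on the
     boundary. *)
  { assert (HG : exists G, forall z, Cmod (lemn w z) = r ^ 2 -> norm (f (inC J z)) <= G).
    { set (e := r + 2 * Rabs (Im w)).
      assert (He : 0 <= e) by (unfold e; generalize (Rabs_pos (Im w)); lra).
      assert (Hq : 0 <= r / R1 < 1).
      { split; [apply Rdiv_le_0_compat; lra | apply Rlt_div_l; lra]. }
      exists (M * (e / r) * B / (1 - r / R1)). intros z Hz.
      refine (series_norm_le A _ _ _ _ _ (Hf z (Req_le _ _ Hz)) (is_series_geom_scal _ _ Hq)).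
      intros n. assert (HRn : 0 < R1 ^ n) by (apply pow_lt; lra).
      eapply Rle_trans; [now apply norm_act|].
      replace (M * (e / r) * B * (r / R1) ^ n) with (M * (r ^ n * e / r) * (B / R1 ^ n)).
      - apply Rmult_le_compat; [|apply norm_ge_0| |apply Hs].
        + apply Rmult_le_pos; [lra | apply Cmod_ge_0].
        + apply Rmult_le_compat_l; [lra|]. apply Rle_div_r; [easy|].
          apply newton_bound; lra.
      - unfold Rdiv. rewrite Rpow_mult_distr, pow_inv. field. lra. }
    destruct HG as [G HG]. intros z Hz. now apply (sup_boundary_le A hnorm J w r HJ Hr f G). }
  (* The boundary is not empty, so the supremum dominates at least one norm. *)
  assert (HS0p : 0 <= S0).
  { destruct (lemniscate_point w r) as [z Hz].
    eapply Rle_trans; [exact (norm_ge_0 (f (inC J z))) | apply (HS0 z)].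
    rewrite Hz, Cmod_R, Rabs_pos_eq; lra. }
  assert (Hsb : forall n, norm (s n) <= coef_cst M * S0 / r ^ n).
  { apply (coef_bound_le A hnorm M HM1 HM J w s (fun z => f (inC J z)) r R1 B S0); try easy.
    intros z Hz. split; [apply Hf; lra | now apply HS0]. }
  exists s. split; [|split; [|split; [exact Hsb | split]]].
  - split; [exact Hser|]. intros s' Hs'. apply functional_extensionality. intros n.
    (* Restricted to the plane of the centre, the difference of two expansions is a Newton series
       with sum 0. *)
    assert (E : forall n, minus (s n) (s' n) = zero).
    { apply (spherical_series_unique A hnorm M HM1 HM J w _ r HJ Hr). intros z Hz.
      assert (HU : U_ball (inC J w) r (inC J z)) by now apply U_ball_inC.
      assert (H1 := is_series_minus _ _ _ _ (Hser _ HU) (Hs' _ HU)).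
      assert (E0 : minus (f (inC J z)) (f (inC J z)) = zero) by module.
      refine (eq_ind _ (fun l : A => is_series _ l) _ _ E0).
      revert H1. apply is_series_ext. intros k. rewrite !spherical_term_slice by easy.
      symmetry. apply amul_minus_r. }
    transitivity (plus (minus (s n) (s' n)) (s' n)); [module|]. rewrite E. module.
  - intros c Hc n. symmetry.
    apply (coef_integral_eq A hnorm J HJ w r R1 B s f); try easy.
    + apply (bp_C1 Hc).
    + apply (bp_closed Hc).
    + now apply (boundary_param_trace A hnorm J w r c).
    + now apply (boundary_param_winding A hnorm J w r c).
  - intros c Hc n.
    assert (Hc1 := bp_C1 Hc). assert (Hcl := bp_closed Hc).
    assert (Htr := boundary_param_trace A hnorm J w r c HJ Hr Hc).
    assert (Hin := boundary_param_winding A hnorm J w r c HJ Hr Hc).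
    destruct (remainder_stem_regular A hnorm J HJ w r R1 B s f (conj Hr HR1) Hs Hf c Hc1 Htr n)
      as [H1 H2].
    split; [exact H1|]. split; [exact H2|]. split.
    + intros x Hx. destruct (Hball x Hx) as (I & z & HI & -> & Hz).
      apply (remainder_identity A hnorm J HJ w r R1 B s f) with F; try easy.
      intros I' z' HI' Hz'. apply HfI; [easy | lra].
    + intros Hass x Hx. destruct (Hball x Hx) as (I & z & HI & -> & Hz).
      now apply (remainder_associative A hnorm J HJ w r R1 B s f).
  - intros n x Hx. assert (Hx' := Hx). destruct (Hball x Hx) as (I & z & HI & -> & Hz).
    assert (Hu : u_dist (inC I z) (inC J w) ^ 2 = Cmod (lemn w z)).
    { rewrite (u_dist_inC A hnorm J w HJ I z HI). apply pow2_sqrt, Cmod_ge_0. }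
    apply (spherical_tail_bound A hnorm M HM1 HM); try easy.
    + split; [apply sqrt_pos | apply Hx].
    + lra.
    + now apply Hser.
Qed.
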